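(* For $i=1,\dots,6$ let $\Delta_{t_i}=\Delta(\mathrm{Fl}(\mathbb{C}^4),\mathcal{L}_\lambda,v_{\mathbf{s}_{t_i}},\tau_\lambda)\subset\mathbb{R}^6$ with $\lambda=2\varpi_1+2\varpi_2+2\varpi_3$. After an appropriate translation by a lattice vector, $\Delta_{t_i}$ equals $$\{\mathbf{g}\in\mathbb{R}^6\mid\langle\mathbf{g},\mathbf{u}\rangle\ge-1\ \text{for every column }\mathbf{u}\text{ of }N_i\},$$ and the columns of $N_i$ are precisely the facet normal vectors of $\Delta_{t_i}$ (one for each facet), where $$N_1=\begin{bmatrix}1&0&0&0&0&0&-1&0&0&0&0&0&0\\0&1&1&0&0&0&-1&-1&-1&0&0&0&0\\0&0&1&0&0&0&-1&-1&0&-1&0&0&0\\1&0&0&1&0&0&0&0&-1&0&-1&0&0\\0&1&1&0&1&0&0&0&0&0&0&-1&0\\0&0&0&0&0&1&-1&-1&0&-1&0&0&-1\end{bmatrix},$$ $$N_2=\begin{bmatrix}1&0&0&0&0&0&-1&0&0&0&0&0&0\\0&1&0&0&0&0&-1&-1&-1&-1&0&0&0\\0&0&1&0&0&0&0&-1&0&0&0&0&0\\1&0&0&1&0&0&0&-1&0&-1&-1&0&0\\0&1&0&0&1&0&0&0&0&0&0&-1&0\\0&0&1&0&0&1&-1&0&-1&0&0&0&-1\end{bmatrix},$$ $$N_3=\begin{bmatrix}1&0&0&0&0&0&-1&-1&-1&0&0&0&0\\1&1&0&0&0&0&0&-1&-1&-1&0&0&0\\0&0&1&0&0&0&0&0&-1&0&0&0&0\\0&0&0&1&0&0&-1&-1&-1&0&-1&0&0\\1&1&0&0&1&0&0&0&0&0&0&-1&0\\0&0&1&0&0&1&0&0&0&-1&0&0&-1\end{bmatrix},$$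 $$N_4=\begin{bmatrix}1&1&0&0&0&0&0&-1&-1&0&0&0&0&0\\1&1&1&1&0&0&0&0&-1&-1&0&0&0&0\\1&0&1&0&0&0&0&0&0&-1&-1&0&0&0\\0&0&0&0&1&0&0&-1&-1&0&0&-1&0&0\\1&1&1&1&0&1&0&0&0&0&0&0&-1&0\\0&0&0&0&0&0&1&0&0&-1&-1&0&0&-1\end{bmatrix},$$ $$N_5=\begin{bmatrix}1&1&0&0&0&0&0&-1&-1&0&0&0&0&0\\0&0&1&1&0&0&0&-1&0&-1&0&0&0&0\\0&1&1&0&0&0&0&-1&-1&-1&-1&0&0&0\\0&0&1&1&1&0&0&0&0&0&0&-1&0&0\\0&0&0&0&0&1&0&-1&-1&-1&-1&0&-1&0\\1&1&0&0&0&0&1&0&0&0&0&0&0&-1\end{bmatrix},$$ $$N_6=\begin{bmatrix}1&0&0&0&0&0&-1&0&0&0&0&0&0\\0&1&0&0&0&0&-1&-1&-1&0&0&0&0\\0&0&1&0&0&0&-1&0&-1&-1&0&0&0\\0&1&0&1&0&0&0&0&0&0&-1&0&0\\1&0&0&0&1&0&-1&-1&-1&-1&0&-1&0\\0&0&1&0&0&1&0&0&0&0&0&0&-1\end{bmatrix}.$$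
   Context: **Flag variety.** $G=\mathrm{SL}_4(\mathbb{C})$, $B$ is the upper triangular Borel subgroup, $U^-$ is the group of lower unitriangular matrices, $G/B=\mathrm{Fl}(\mathbb{C}^4)$, and $U^-\hookrightarrow G/B$ is the open embedding $u\mapsto uB$. $U^-_{w_0}=U^-\cap B\widetilde{w}_0B$, with $\widetilde{w}_0$ a lift of the longest element $w_0$ of $\mathfrak{S}_4$, is open in $U^-$, so $\mathbb{C}(G/B)=\mathbb{C}(U^-_{w_0})$. For a matrix $x$, $D_{I,K}(x)$ is the minor with rows $I$ and columns $K$; $[i]=\{1,\dots,i\}$; $\varpi_i$ are the fundamental weights. **Line bundle and section.** $\lambda=2\varpi_1+2\varpi_2+2\varpi_3$, and $\mathcal{L}_\lambda$ is the anticanonical line bundle of $G/B$; $H^0(G/B,\mathcal{L}_\lambda^{\otimes k})$ is identified with the regular functions $f$ on $G$ satisfying $f(gb)=(k\lambda)(b)f(g)$ for $b\in B$ (with $k\lambda$ extended to $B$ trivially on its unipotent radical). The section $\tau_\lambda$ is $\prod_{i=1}^3D_{[i],[i]}^2$, nowhere vanishing on $U^-$. **Newton--Okounkov body.** For a valuation $v$ on $\mathbb{C}(G/B)\setminus\{0\}$ with values in $\mathbb{Z}^6$ and one-dimensional leaves, $\Delta(G/B,\mathcal{L}_\lambda,v,\tau_\lambda)$ is the closure of $\bigcup_{k\ge1}\{\frac1k v(\sigma/\tau_\lambda^k)\mid \sigma\in H^0(G/B,\mathcal{L}_\lambda^{\otimes k})\setminus\{0\}\}$. **Seeds and mutations.**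 $J=\{1,\dots,6\}$, $J_{\mathrm{uf}}=\{1,2,3\}$. A seed $\mathbf{s}=(\mathbf{A},\varepsilon)$ of $\mathbb{C}(U^-_{w_0})$ consists of a free generating set $\mathbf{A}=(A_j)_{j\in J}$ of this field and an integer matrix $\varepsilon=(\varepsilon_{i,j})_{i\in J_{\mathrm{uf}},j\in J}$ with skew-symmetrizable $J_{\mathrm{uf}}\times J_{\mathrm{uf}}$-part. With $[a]_+=\max\{a,0\}$, the mutation $\mu_k(\mathbf{s})=(\mathbf{A}',\varepsilon')$, $k\in J_{\mathrm{uf}}$, is given by $A_i'=A_i$ for $i\ne k$, $A_k'=A_k^{-1}(\prod_jA_j^{[\varepsilon_{k,j}]_+}+\prod_jA_j^{[-\varepsilon_{k,j}]_+})$, $\varepsilon'_{i,j}=-\varepsilon_{i,j}$ if $i=k$ or $j=k$, and $\varepsilon'_{i,j}=\varepsilon_{i,j}+\mathrm{sgn}(\varepsilon_{i,k})[\varepsilon_{i,k}\varepsilon_{k,j}]_+$ otherwise. **The seeds involved.** The seed $\mathbf{s}_{t_0}$ comes from the reduced word $(1,2,1,3,2,1)$ of $w_0$: its cluster variables are the restrictions to $U^-_{w_0}$ of $A_1=D_{\{2\},\{1\}}$, $A_2=D_{\{2,3\},\{1,2\}}$, $A_3=D_{\{3\},\{1\}}$, $A_4=D_{\{2,3,4\},\{1,2,3\}}$, $A_5=D_{\{3,4\},\{1,2\}}$, $A_6=D_{\{4\},\{1\}}$, and the rows of its exchange matrix are $(0,-1,1,0,0,0)$, $(1,0,-1,-1,1,0)$,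 $(-1,1,0,0,-1,1)$. The others (writing $t_i$ for $\mathbf{s}_{t_i}$) are $t_1=\mu_2(t_0)$, $t_2=\mu_3(t_1)$, $t_3=\mu_1(t_2)$, $t_4=\mu_1(t_1)$, $t_7=\mu_3(t_0)$, $t_5=\mu_1(t_7)$, $t_8=\mu_1(t_0)$, $t_6=\mu_3(t_8)$. **The valuation $v_{\mathbf{s}}$.** For a seed $\mathbf{s}=(\mathbf{A},\varepsilon)$, order $\mathbb{Z}^J$ (row vectors) by $a\preceq_\varepsilon a'$ iff $a=a'+u\varepsilon$ for some $u\in\mathbb{Z}_{\ge0}^{J_{\mathrm{uf}}}$. Fix a total order on $\mathbb{Z}^J$ compatible with addition refining the opposite order of $\preceq_\varepsilon$. Then $v_{\mathbf{s}}$ sends a nonzero polynomial in the $A_j$ to the exponent vector of its lowest monomial, extended to quotients by $v_{\mathbf{s}}(f/g)=v_{\mathbf{s}}(f)-v_{\mathbf{s}}(g)$. **Known description (Fujita--Oya).** Each $\Delta_{\mathbf{s}}=\Delta(G/B,\mathcal{L}_\lambda,v_{\mathbf{s}},\tau_\lambda)$ is a rational convex polytope. $\Delta_{\mathbf{s}_{t_0}}$ is the set of $g\in\mathbb{R}^6$ with $g_1+g_2+g_4\ge0$, $g_2+g_4\ge0$, $g_3+g_5\ge0$, $g_4,g_5,g_6\ge0$, $g_1+g_3+g_6\le2$, $g_2+g_5\le2$, $g_3+g_6\le2$, $g_4,g_5,g_6\le2$. If $\mathbf{s}'=\mu_k(\mathbf{s})$, then $\Delta_{\mathbf{s}'}=\mu_k^T(\Delta_{\mathbf{s}})$,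 where $\mu_k^T(g)=g'$ with $g'_k=-g_k$ and $g'_j=g_j+[-\varepsilon_{k,j}]_+g_k+\varepsilon_{k,j}[g_k]_+$ for $j\ne k$, with $\varepsilon$ the exchange matrix of $\mathbf{s}$. *)

(* Defs.v *)
(* The notations of mpoly clash with those of MathComp-Analysis, hence the
   filtered import below. *)
From HB Require Import structures.
From mathcomp Require Import all_boot all_order all_algebra.
From mathcomp Require Import all_classical all_reals all_analysis.
From mathcomp Require Import complex.
From mathcomp Require Import -(notations) mpoly.

Set Implicit Arguments.
Unset Strict Implicit.
Unset Printing Implicit Defensive.

Import Order.TTheory GRing.Theory Num.Theory numFieldNormedType.Exports.

Local Open Scope classical_set_scope.
Local Open Scope ring_scope.

(* In the names and arguments below, cluster indices, mutation directions and
   the rows and columns of minors are numbered from 1; ordinals start at 0. *)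

Section FlagVariety.
Variable R : realType.
Local Notation C := R[i].

(* D_{I,K}(x); I and K are increasing lists of the same length. *)
Definition minor (S : comNzRingType) (I K : seq nat) (x : 'M[S]_4) : S :=
  \det (\matrix_(a < size I, b < size I)
          x (inord (nth 0%N I a).-1) (inord (nth 0%N K b).-1)).

Definition tau (S : comNzRingType) (x : 'M[S]_4) : S :=
  \prod_(1 <= i < 4) minor (iota 1 i) (iota 1 i) x ^+ 2.

(* The character varpi_i of the diagonal torus, extended to B. *)
Definition varpi (i : nat) (b : 'M[C]_4) : C := \prod_(j < 4 | (j < i)%N) b j j.

Definition lambda (b : 'M[C]_4) : C := \prod_(1 <= i < 4) varpi i b ^+ 2.

Definition SL4 : set 'M[C]_4 := [set g | \det g = 1].

Definition borel : set 'M[C]_4 := [set b | SL4 b /\ is_trig_mx b^T].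

(* A regular function on SL_4 is the restriction of a polynomial in the 16
   matrix entries, so polynomials represent regular functions; two of them
   represent the same function when they agree on SL_4. *)
Definition matpoly := mpoly (4 * 4) C.

Definition at_mx (F : matpoly) (g : 'M[C]_4) : C := meval (fun i => mxvec g 0 i) F.

(* F represents a section of the k-th power of the line bundle L_lambda. *)
Definition is_section (k : nat) (F : matpoly) : Prop :=
  forall g b, SL4 g -> borel b -> at_mx F (g *m b) = lambda b ^+ k * at_mx F g.

Definition nonzero_section (k : nat) (F : matpoly) : Prop :=
  is_section k F /\ exists2 g, SL4 g & at_mx F g != 0.

(* The function field of G/B, which is that of the affine space U^-, with the
   six entries below the diagonal as coordinates. *)
Definition KGB := {fraction (mpoly 6 C)}.

Definition constU (c : C) : KGB := tofrac (mpolyC 6 c).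

Definition coordU (i : 'I_6) : KGB := tofrac (mpolyX C (mnm1 i)).

(* The generic point of U^-: the entry (i, j) with j < i is the coordinate of
   index i (i - 1) / 2 + j, for i and j numbered from 0. *)
Definition generic_lower : 'M[KGB]_4 :=
  \matrix_(i, j) if i == j then 1
                 else if (j < i)%N then coordU (inord ('C(i, 2) + j)) else 0.

(* The restriction of sigma / tau_lambda^k to U^-. *)
Definition section_ratio (k : nat) (F : matpoly) : KGB :=
  mmap constU (fun i => mxvec generic_lower 0 i) F / tau generic_lower ^+ k.

Definition int_row (a : 'rV[int]_6) : 'rV[R]_6 := map_mx (fun z : int => z%:~R) a.

Definition NObody (v : KGB -> 'rV[int]_6) : set 'rV[R]_6 :=
  closure [set x | exists k F, [/\ (0 < k)%N, nonzero_section k F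
                   & x = (k%:R)^-1 *: int_row (v (section_ratio k F))]].

(* The underlying data of a seed. Freeness of the cluster variables and
   skew-symmetrizability are not fields: they hold for t0 below and are
   preserved by mutation, and all seeds considered are mutations of t0. *)
Record seed := Seed { cvar : 'I_6 -> KGB; exch : 'M[int]_(3, 6) }.

Definition uf (k : 'I_3) : 'I_6 := widen_ord (isT : (3 <= 6)%N) k.

Definition posp (a : int) : int := Num.max a 0.

Definition mutate (k : 'I_3) (s : seed) : seed :=
  let A := cvar s in let e := exch s in
  Seed
    (fun i => if i == uf k
       then (A i)^-1 * (\prod_j A j ^ posp (e k j) + \prod_j A j ^ posp (- e k j))
       else A i)
    (\matrix_(i, j) if (i == k) || (j == uf k) then - e i j
       else e i j + Num.sg (e i (uf k)) * posp (e i (uf k) * e k j)).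

Definition mu (k : nat) (s : seed) : seed := mutate (inord k.-1) s.

(* The matrix with a given list of rows. *)
Definition mx_of_rows (m n : nat) (rows : seq (seq int)) : 'M[int]_(m, n) :=
  \matrix_(i, j) nth 0 (nth [::] rows i) j.

Definition t0 : seed :=
  Seed (fun j => nth 0 [:: minor [:: 2] [:: 1] generic_lower;
                           minor [:: 2; 3] [:: 1; 2] generic_lower;
                           minor [:: 3] [:: 1] generic_lower;
                           minor [:: 2; 3; 4] [:: 1; 2; 3] generic_lower;
                           minor [:: 3; 4] [:: 1; 2] generic_lower;
                           minor [:: 4] [:: 1] generic_lower]%N j)
       (mx_of_rows 3 6 [:: [::  0; -1;  1;  0;  0; 0];
                           [::  1;  0; -1; -1;  1; 0];
                           [:: -1;  1;  0;  0; -1; 1]]).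

Definition t1 := mu 2 t0.
Definition t2 := mu 3 t1.
Definition t3 := mu 1 t2.
Definition t4 := mu 1 t1.
Definition t7 := mu 3 t0.
Definition t5 := mu 1 t7.
Definition t8 := mu 1 t0.
Definition t6 := mu 3 t8.

(* a is below a' for the partial order attached to the exchange matrix e. *)
Definition exch_le (e : 'M[int]_(3, 6)) (a a' : 'rV[int]_6) : Prop :=
  exists u : 'rV[int]_3, (forall i, 0 <= u 0 i) /\ a = a' + u *m e.

(* A total order on Z^6, compatible with addition, refining the opposite of
   exch_le; le a b reads "a is at most b". *)
Definition adapted_order (e : 'M[int]_(3, 6)) (le : rel 'rV[int]_6) : Prop :=
  [/\ antisymmetric le, transitive le, total le,
      forall a b c : 'rV[int]_6, le a b -> le (a + c) (b + c)
    & forall a a', exch_le e a a' -> le a' a].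

(* The exponent of the lowest monomial of P (junk value 0 if P = 0). *)
Definition low_exp (le : rel 'rV[int]_6) (P : mpoly 6 C) : 'rV[int]_6 :=
  head 0 (sort le [seq \row_j (m j)%:Z | m : multinom 6 <- msupp P]).

Definition at_vars (s : seed) (P : mpoly 6 C) : KGB := mmap constU (cvar s) P.

(* f is written as a quotient P / Q of polynomials in the cluster variables;
   the value does not depend on the choice of P and Q, since the cluster
   variables are algebraically independent and le is compatible with addition. *)
Definition vseed (s : seed) (le : rel 'rV[int]_6) (f : KGB) : 'rV[int]_6 :=
  let PQ := xget (0, 0) [set PQ : mpoly 6 C * mpoly 6 C |
    [/\ at_vars s PQ.1 != 0, at_vars s PQ.2 != 0
      & f = at_vars s PQ.1 / at_vars s PQ.2]] in
  low_exp le PQ.1 - low_exp le PQ.2.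

Definition Delta (s : seed) (le : rel 'rV[int]_6) : set 'rV[R]_6 :=
  NObody (vseed s le).

End FlagVariety.

Section Polytopes.
Variable R : realType.

Definition pairing (g : 'rV[R]_6) (u : 'cV[R]_6) : R := (g *m u) 0 0.

Definition int_col (u : 'cV[int]_6) : 'cV[R]_6 := map_mx (fun z : int => z%:~R) u.

Definition polytope_of (n : nat) (N : 'M[int]_(6, n)) : set 'rV[R]_6 :=
  [set g | forall j, - 1 <= pairing g (int_col (col j N))].

(* F is cut out on P by the valid inequality <x, u> >= c. *)
Definition exposes (P : set 'rV[R]_6) (u : 'cV[R]_6) (c : R)
    (F : set 'rV[R]_6) : Prop :=
  (forall x, P x -> c <= pairing x u) /\ F = [set x | P x /\ pairing x u = c].

(* The affine hull of S has dimension d: it is x0 + the row space of V. *)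
Definition has_dim (S : set 'rV[R]_6) (d : nat) : Prop :=
  exists (x0 : 'rV[R]_6) (V : 'M[R]_(d, 6)),
    [/\ row_free V, S x0, forall i, S (x0 + row i V)
      & forall x, S x -> (x - x0 <= V)%MS].

Definition facet (P F : set 'rV[R]_6) : Prop :=
  (exists u c, exposes P u c F) /\ exists d, has_dim P d.+1 /\ has_dim F d.

Definition primitive (u : 'cV[int]_6) : Prop :=
  (\big[gcdn/0%N]_i `|u i ord0|%N) = 1%N.

(* u is the primitive inner normal vector of the facet F of P. *)
Definition facet_normal (P F : set 'rV[R]_6) (u : 'cV[int]_6) : Prop :=
  [/\ facet P F, primitive u & exists c, exposes P (int_col u) c F].

Definition translate_is_polytope (n : nat) (P : set 'rV[R]_6)
    (N : 'M[int]_(6, n)) : Prop :=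
  exists a : 'rV[int]_6, [set g + int_row R a | g in P] = polytope_of N.

(* The columns of N are the facet normals of P, one for each facet. *)
Definition columns_are_facet_normals (n : nat) (P : set 'rV[R]_6)
    (N : 'M[int]_(6, n)) : Prop :=
  (forall u, (exists F, facet_normal P F u) <-> exists j, u = col j N) /\
  (forall F, facet P F -> exists! j, facet_normal P F (col j N)).

Definition described_by (n : nat) (P : set 'rV[R]_6) (N : 'M[int]_(6, n)) : Prop :=
  translate_is_polytope P N /\ columns_are_facet_normals P N.

End Polytopes.

Definition N1 : 'M[int]_(6, 13) := mx_of_rows 6 13 [::
  [::  1;  0;  0;  0;  0;  0; -1;  0;  0;  0;  0;  0;  0];
  [::  0;  1;  1;  0;  0;  0; -1; -1; -1;  0;  0;  0;  0];
  [::  0;  0;  1;  0;  0;  0; -1; -1;  0; -1;  0;  0;  0];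
  [::  1;  0;  0;  1;  0;  0;  0;  0; -1;  0; -1;  0;  0];
  [::  0;  1;  1;  0;  1;  0;  0;  0;  0;  0;  0; -1;  0];
  [::  0;  0;  0;  0;  0;  1; -1; -1;  0; -1;  0;  0; -1]].

Definition N2 : 'M[int]_(6, 13) := mx_of_rows 6 13 [::
  [::  1;  0;  0;  0;  0;  0; -1;  0;  0;  0;  0;  0;  0];
  [::  0;  1;  0;  0;  0;  0; -1; -1; -1; -1;  0;  0;  0];
  [::  0;  0;  1;  0;  0;  0;  0; -1;  0;  0;  0;  0;  0];
  [::  1;  0;  0;  1;  0;  0;  0; -1;  0; -1; -1;  0;  0];
  [::  0;  1;  0;  0;  1;  0;  0;  0;  0;  0;  0; -1;  0];
  [::  0;  0;  1;  0;  0;  1; -1;  0; -1;  0;  0;  0; -1]].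

Definition N3 : 'M[int]_(6, 13) := mx_of_rows 6 13 [::
  [::  1;  0;  0;  0;  0;  0; -1; -1; -1;  0;  0;  0;  0];
  [::  1;  1;  0;  0;  0;  0;  0; -1; -1; -1;  0;  0;  0];
  [::  0;  0;  1;  0;  0;  0;  0;  0; -1;  0;  0;  0;  0];
  [::  0;  0;  0;  1;  0;  0; -1; -1; -1;  0; -1;  0;  0];
  [::  1;  1;  0;  0;  1;  0;  0;  0;  0;  0;  0; -1;  0];
  [::  0;  0;  1;  0;  0;  1;  0;  0;  0; -1;  0;  0; -1]].

Definition N4 : 'M[int]_(6, 14) := mx_of_rows 6 14 [::
  [::  1;  1;  0;  0;  0;  0;  0; -1; -1;  0;  0;  0;  0;  0];
  [::  1;  1;  1;  1;  0;  0;  0;  0; -1; -1;  0;  0;  0;  0];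
  [::  1;  0;  1;  0;  0;  0;  0;  0;  0; -1; -1;  0;  0;  0];
  [::  0;  0;  0;  0;  1;  0;  0; -1; -1;  0;  0; -1;  0;  0];
  [::  1;  1;  1;  1;  0;  1;  0;  0;  0;  0;  0;  0; -1;  0];
  [::  0;  0;  0;  0;  0;  0;  1;  0;  0; -1; -1;  0;  0; -1]].

Definition N5 : 'M[int]_(6, 14) := mx_of_rows 6 14 [::
  [::  1;  1;  0;  0;  0;  0;  0; -1; -1;  0;  0;  0;  0;  0];
  [::  0;  0;  1;  1;  0;  0;  0; -1;  0; -1;  0;  0;  0;  0];
  [::  0;  1;  1;  0;  0;  0;  0; -1; -1; -1; -1;  0;  0;  0];
  [::  0;  0;  1;  1;  1;  0;  0;  0;  0;  0;  0; -1;  0;  0];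
  [::  0;  0;  0;  0;  0;  1;  0; -1; -1; -1; -1;  0; -1;  0];
  [::  1;  1;  0;  0;  0;  0;  1;  0;  0;  0;  0;  0;  0; -1]].

Definition N6 : 'M[int]_(6, 13) := mx_of_rows 6 13 [::
  [::  1;  0;  0;  0;  0;  0; -1;  0;  0;  0;  0;  0;  0];
  [::  0;  1;  0;  0;  0;  0; -1; -1; -1;  0;  0;  0;  0];
  [::  0;  0;  1;  0;  0;  0; -1;  0; -1; -1;  0;  0;  0];
  [::  0;  1;  0;  1;  0;  0;  0;  0;  0;  0; -1;  0;  0];
  [::  1;  0;  0;  0;  1;  0; -1; -1; -1; -1;  0; -1;  0];
  [::  0;  0;  1;  0;  0;  1;  0;  0;  0;  0;  0;  0; -1]].

(* Main.v *)
(* The valuation v of a seed is determined on all cluster variables of this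
   finite type (A_3) cluster algebra by exchange relations p q = M1 + M2: the
   ratio M2 / M1 is a product of y-variables of the initial seed or of their
   inverses (sign coherence), so that one of the two monomials has the strictly
   smaller value.
     Upper bound. In each of the 14 clusters the values of the six variables form
   a basis of Z^6, hence v (f) is the value of one of the monomials of the Laurent
   expansion of f. A section is polynomial in the coordinates of U^-, hence its
   exponents at the frozen variables are nonnegative. By the symmetry w0 of the
   flag variety it is also (D_4 D_34 D_234)^(2 k) times a polynomial in ratios of
   flag minors of the same weight, hence each of its monomials has degree at most
   2 k for each fundamental weight. Every facet inequality arises in this way from
   some cluster.
     Lower bound. Cluster monomials of bounded degree are sections, and the 14
   cones spanned by the values of the clusters cover R^6; a real point is a limit
   of values of monomials with integral parts of its coordinates as exponents. *)

Require Import Defs.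
From HB Require Import structures.
From mathcomp Require Import all_boot all_order all_algebra.
From mathcomp Require Import all_classical all_reals all_analysis.
From mathcomp Require Import complex ring lra.
From mathcomp Require Import -(notations) mpoly.

Set Implicit Arguments.
Unset Strict Implicit.
Unset Printing Implicit Defensive.

Import Order.TTheory GRing.Theory Num.Theory numFieldNormedType.Exports.

Local Open Scope classical_set_scope.
Local Open Scope ring_scope.

(** * Valuations given by lowest exponents *)

(** The order [le] is only known to refine the opposite of [exch_le], so each comparison of values
    has to be certified by a nonnegative combination of rows of the exchange matrix; the resulting
    body is then the same for every such [le]. A second obstacle is that [is_section] is an equation
    between values at complex matrices, whereas the valuation lives on the function field. The
    comparison with the opposite cell is therefore proved at complex points and carried to the
    generic point, since a polynomial vanishing at all complex points is zero. The common bound -1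
    has one source. In every cluster the product D_4 D_34 D_234 has frozen exponents 1 and the other
    exponents 0, and it has degree 1 for each fundamental weight. At its value (0, 0, 0, 1, 1, 1)
    each frozen exponent, and each difference between 2 and a degree, is thus equal to 1; moving
    this point to the origin gives the translation. What depends on the seed is finite and integral,
    and is settled by computation on certificates; the rest of the argument is uniform in the
    seed. *)

Section LowestExponents.
Variables (R : realType) (le : rel 'rV[int]_6).
Hypothesis le_anti : antisymmetric le.
Hypothesis le_trans : transitive le.
Hypothesis le_total : total le.
Hypothesis le_add : forall a b c : 'rV[int]_6, le a b -> le (a + c) (b + c).
Implicit Types P Q : mpoly 6 R[i].

Definition exp_row (m : multinom 6) : 'rV[int]_6 := \row_j (m j)%:Z.

Lemma exp_row_inj : injective exp_row.
Proof.
move=> m m' /rowP e; apply/mnmP => j.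
by have := e j; rewrite !mxE => -[].
Qed.

Lemma exp_rowD m m' : exp_row (mnm_add m m') = exp_row m + exp_row m'.
Proof. by apply/rowP => j; rewrite !mxE mnmDE. Qed.

Lemma low_expP P : P != 0 ->
  exists m, [/\ m \in msupp P, low_exp le P = exp_row m
    & forall m', m' \in msupp P -> le (exp_row m) (exp_row m')].
Proof.
move=> P0; rewrite /low_exp -[fun m : multinom 6 => _]/exp_row.
set s := sort _ _.
have s_sorted : sorted le s by apply: sort_sorted.
have s_mem : s =i [seq exp_row m | m <- msupp P] by move=> x; rewrite mem_sort.
have s0 : s != [::].
  by rewrite -size_eq0 size_sort size_map size_eq0 msupp_eq0.
case: s s0 s_sorted s_mem => // x s _ /= s_path s_mem.
have : x \in x :: s by rewrite mem_head.
rewrite s_mem => /mapP [m mP xm]; exists m; split=> // m' m'P.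
have : exp_row m' \in x :: s by rewrite s_mem map_f.
rewrite inE -xm => /orP [/eqP ->|]; first by have := le_total x x; rewrite orbb.
by move: s_path; rewrite path_sortedE // => /andP [/allP + _] => /[apply].
Qed.

Lemma low_exp_unique P m : m \in msupp P ->
  (forall m', m' \in msupp P -> le (exp_row m) (exp_row m')) ->
  low_exp le P = exp_row m.
Proof.
move=> mP m_min.
have P0 : P != 0 by apply: contraTneq mP => ->; rewrite msupp0.
have [m1 [m1P -> m1_min]] := low_expP P0.
by apply: le_anti; rewrite m1_min // m_min.
Qed.

(** Compatibility with addition makes the sum of the two lowest exponents minimal in the product and
    attained by one pair of monomials only, so its coefficient is a product of two nonzero ones. *)
Lemma low_expM P Q : P != 0 -> Q != 0 ->
  low_exp le (P * Q) = low_exp le P + low_exp le Q.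
Proof.
move=> /low_expP [p [pP -> p_min]] /low_expP [q [qQ -> q_min]].
have uniq_pq m1 m2 : m1 \in msupp P -> m2 \in msupp Q ->
    mnm_add p q = mnm_add m1 m2 -> m1 = p /\ m2 = q.
  move=> m1P m2Q e.
  have e1 : exp_row p + exp_row q = exp_row m1 + exp_row m2.
    by rewrite -!exp_rowD e.
  have : exp_row m1 = exp_row p.
    apply: le_anti; rewrite p_min // andbT.
    have := le_add (- exp_row q + exp_row m1) (q_min _ m2Q).
    by rewrite addrA subrr add0r addrCA [exp_row m2 + _]addrC -e1 addrC addrK.
  move=> m1p; split; first exact: exp_row_inj.
  by apply: exp_row_inj; apply: (addrI (exp_row p)); rewrite e1 m1p.
rewrite -exp_rowD; apply: low_exp_unique => [|m].
  rewrite mcoeff_msupp.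
  suff -> : mcoeff (mnm_add p q) (P * Q) = mcoeff p P * mcoeff q Q.
    by rewrite mulf_neq0 // -mcoeff_msupp.
  rewrite {1}(mpolyE P) {1}(mpolyE Q) mulr_suml raddf_sum /=.
  rewrite (bigD1_seq p) ?msupp_uniq //= [X in _ + X]big_seq_cond [X in _ + X]big1 ?addr0.
    rewrite mulr_sumr raddf_sum (bigD1_seq q) ?msupp_uniq //=.
    rewrite [X in _ + X]big_seq_cond [X in _ + X]big1 ?addr0.
      by rewrite -scalerAl -scalerAr -mpolyXD !mcoeffZ mcoeffX eqxx mulr1.
    move=> m /andP [mQ mq]; rewrite -scalerAl -scalerAr -mpolyXD !mcoeffZ mcoeffX.
    case: eqP => [/esym /uniq_pq[]// _ e|]; last by rewrite !mulr0.
    by rewrite e eqxx in mq.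
  move=> m /andP [mP mp]; rewrite mulr_sumr raddf_sum big_seq big1 //= => m' m'Q.
  rewrite -scalerAl -scalerAr -mpolyXD !mcoeffZ mcoeffX.
  case: eqP => [/esym /uniq_pq[]// e|]; last by rewrite !mulr0.
  by rewrite e eqxx in mp.
move=> /msuppM_le /allpairsP [[m1 m2] /= [m1P m2Q ->]]; rewrite !exp_rowD.
apply: (@le_trans (exp_row m1 + exp_row q)); first exact: le_add (p_min _ m1P).
by rewrite ![exp_row m1 + _]addrC; apply/le_add/q_min.
Qed.

Lemma low_expD P Q : P != 0 -> Q != 0 -> low_exp le P != low_exp le Q ->
  le (low_exp le P) (low_exp le Q) ->
  P + Q != 0 /\ low_exp le (P + Q) = low_exp le P.
Proof.
move=> /low_expP [p [pP -> p_min]] /low_expP [q [qQ -> q_min]] pq lepq.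
have pPQ : p \in msupp (P + Q).
  rewrite mcoeff_msupp mcoeffD.
  suff /eqP -> : mcoeff p Q == 0 by rewrite addr0 -mcoeff_msupp.
  apply: contraNT pq; rewrite -mcoeff_msupp => /q_min leqp.
  by apply/eqP/le_anti; rewrite lepq.
split; first by apply: contraTneq pPQ => ->; rewrite msupp0.
apply: low_exp_unique => // m /msuppD_le; rewrite mem_cat.
by case/orP => [/p_min//|/q_min]; apply: le_trans.
Qed.

Lemma low_expC (c : R[i]) : c != 0 -> low_exp le (mpolyC 6 c) = 0.
Proof.
move=> c0; have -> : 0 = exp_row (@mnm0 6).
  by apply/rowP => j; rewrite !mxE mnm0E.
apply: low_exp_unique; rewrite msuppC (negPf c0) ?mem_head // => m'.
by rewrite inE => /eqP ->; have := le_total (exp_row mnm0) (exp_row mnm0); rewrite orbb.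
Qed.

Lemma low_expX j : low_exp le (mpolyX R[i] (mnm1 j)) = delta_mx 0 j.
Proof.
have -> : delta_mx 0 j = exp_row (mnm1 j).
  by apply/rowP => k; rewrite !mxE mnm1E eqxx eq_sym; case: eqP.
apply: low_exp_unique; rewrite msuppX ?mem_head // => m'.
rewrite inE => /eqP ->; have := le_total (exp_row (mnm1 j)) (exp_row (mnm1 j)).
by rewrite orbb.
Qed.

End LowestExponents.

Lemma constU_is_zmod_morphism (R : realType) : zmod_morphism (@constU R).
Proof. by move=> c d; rewrite /constU !rmorphB. Qed.

HB.instance Definition _ (R : realType) :=
  GRing.isZmodMorphism.Build R[i] (KGB R) (@constU R) (@constU_is_zmod_morphism R).

Lemma constU_is_monoid_morphism (R : realType) : monoid_morphism (@constU R).
Proof. by split=> [|c d]; rewrite /constU ?rmorph1 // !rmorphM. Qed.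

HB.instance Definition _ (R : realType) :=
  GRing.isMonoidMorphism.Build R[i] (KGB R) (@constU R)
    (@constU_is_monoid_morphism R).

Lemma constU1 (R : realType) : @constU R 1 = 1.
Proof. exact: rmorph1. Qed.

Lemma mpolyM_neq0 (R : realType) (P Q : mpoly 6 R[i]) :
  P != 0 -> Q != 0 -> P * Q != 0.
Proof. exact: mulf_neq0. Qed.

(** Sums are constrained only when the two values differ, the case in which the value of a sum is
    determined by those of its terms. *)
Record is_valuation (F K : fieldType) (iota : F -> K) (le : rel 'rV[int]_6)
    (v : K -> 'rV[int]_6) : Prop := IsValuation {
  val_mul : forall f g, f != 0 -> g != 0 -> v (f * g) = v f + v g;
  val_const : forall c, c != 0 -> v (iota c) = 0;
  val_add : forall f g, f != 0 -> g != 0 -> v f != v g -> le (v f) (v g) ->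
    f + g != 0 /\ v (f + g) = v f }.

Section SeedValuation.
Variables (R : realType) (s : seed R) (le : rel 'rV[int]_6).
Hypothesis le_adapted : adapted_order (exch s) le.

Definition at_vars_rmorphism : {rmorphism mpoly 6 R[i] -> KGB R} :=
  mmap (@constU R) (cvar s).

Lemma at_varsE P : at_vars s P = at_vars_rmorphism P.
Proof. by []. Qed.

Hypothesis vars_free : forall P, at_vars s P = 0 -> P = 0.
Hypothesis vars_generate : forall f : KGB R, exists P Q,
  at_vars s Q != 0 /\ f = at_vars s P / at_vars s Q.

Lemma at_vars_neq0 P : P != 0 -> at_vars s P != 0.
Proof. by apply: contraNneq => /vars_free ->. Qed.

(** Freeness turns an equality of two quotients into an equality of cross products of polynomials,
    on which [low_exp] is additive; hence the pair chosen by [xget] is immaterial. *)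
Lemma vseed_ratio P Q : P != 0 -> Q != 0 ->
  vseed s le (at_vars s P / at_vars s Q) = low_exp le P - low_exp le Q.
Proof.
case: le_adapted => le_anti le_trans le_total le_add _ P0 Q0; rewrite /vseed.
case: xgetP => [[P' Q'] /= _ [P'0 Q'0 e]|/(_ (P, Q)) []]; last first.
  by split; rewrite ?at_vars_neq0.
have {}P'0 : P' != 0 by apply: contraNneq P'0 => ->; rewrite at_varsE rmorph0.
have {}Q'0 : Q' != 0 by apply: contraNneq Q'0 => ->; rewrite at_varsE rmorph0.
have : P' * Q = P * Q'.
  apply/eqP; rewrite -subr_eq0; apply/eqP/vars_free.
  rewrite at_varsE rmorphB !rmorphM -!at_varsE.
  apply/eqP; rewrite subr_eq0 eq_sym -eqr_div ?at_vars_neq0 //; exact/eqP.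
move=> /(congr1 (low_exp le)); rewrite !low_expM // => e'.
by apply/eqP; rewrite subr_eq addrAC eq_sym subr_eq e'.
Qed.

Lemma vseed_repr f : f != 0 -> exists P Q,
  [/\ P != 0, Q != 0, f = at_vars s P / at_vars s Q
    & vseed s le f = low_exp le P - low_exp le Q].
Proof.
case: (vars_generate f) => P [Q [Q0 fE]] f0.
have {}Q0 : Q != 0 by apply: contraNneq Q0 => ->; rewrite at_varsE rmorph0.
have P0 : P != 0.
  by apply: contraNneq f0 => P0; rewrite fE P0 at_varsE rmorph0 mul0r.
by exists P, Q; split=> //; rewrite fE vseed_ratio.
Qed.

Lemma vseed_valuation : is_valuation (@constU R) le (vseed s le).
Proof.
have le_ad := le_adapted.
case: le_ad => le_anti le_trans le_total le_add _.
split.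
- move=> f g /vseed_repr [P [Q [P0 Q0 -> ->]]] /vseed_repr [P' [Q' [P'0 Q'0 -> ->]]].
  have -> : at_vars s P / at_vars s Q * (at_vars s P' / at_vars s Q')
      = at_vars s (P * P') / at_vars s (Q * Q').
    by rewrite !at_varsE !rmorphM invfM mulrACA.
  by rewrite vseed_ratio ?mpolyM_neq0 // !low_expM // opprD addrACA.
- move=> c c0.
  have -> : constU c = at_vars s (mpolyC 6 c) / at_vars s (mpolyC 6 1).
    by rewrite /at_vars !mmapC /= constU1 divr1.
  by rewrite vseed_ratio ?mpolyC_eq0 ?oner_eq0 // !low_expC ?oner_eq0 // subr0.
- move=> f g /vseed_repr [P [Q [P0 Q0 -> ->]]] /vseed_repr [P' [Q' [P'0 Q'0 -> ->]]].
  move=> vne vle.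
  have -> : at_vars s P / at_vars s Q + at_vars s P' / at_vars s Q'
      = at_vars s (P * Q' + P' * Q) / at_vars s (Q * Q').
    by rewrite addf_div ?at_vars_neq0 // !at_varsE rmorphD !rmorphM.
  have [||||n0 nE] := @low_expD R le le_anti le_trans le_total (P * Q') (P' * Q).
  + exact: mpolyM_neq0.
  + exact: mpolyM_neq0.
  + rewrite !low_expM //; apply: contra vne => /eqP e.
    by rewrite subr_eq addrAC eq_sym subr_eq e.
  + rewrite !low_expM //; have := le_add _ _ (low_exp le Q + low_exp le Q') vle.
    by rewrite addrA subrK [low_exp le Q + _]addrC addrA subrK.
  have n1 : Q * Q' != 0 by apply: mpolyM_neq0.
  have n2 : at_vars s (P * Q' + P' * Q) != 0 by apply: at_vars_neq0 n0.
  have n3 : at_vars s (Q * Q') != 0 by apply: at_vars_neq0 n1.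
  rewrite (vseed_ratio n0 n1); split.
    by rewrite mulf_eq0 invr_eq0; apply/norP; split; [exact: n2|exact: n3].
  by rewrite nE !low_expM // opprD addrACA addrN addr0.
Qed.

Lemma vseed_cvar j : vseed s le (cvar s j) = delta_mx 0 j.
Proof.
case: le_adapted => le_anti le_trans le_total le_add _.
have -> : cvar s j = at_vars s (mpolyX _ (mnm1 j)) / at_vars s (mpolyC 6 1).
  by rewrite /at_vars mmapC /= constU1 divr1 mmapX mmap1U.
rewrite vseed_ratio ?low_expC ?low_expX ?subr0 ?oner_eq0 //.
by apply/eqP => /(congr1 (mcoeff (mnm1 j))); rewrite mcoeffX eqxx mcoeff0;
  apply/eqP; rewrite oner_eq0.
Qed.

End SeedValuation.

(** * Values of Laurent polynomials in a chart *)

Section ValuationTheory.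
Variables (F K : fieldType) (iota : {rmorphism F -> K}) (le : rel 'rV[int]_6).
Variable v : K -> 'rV[int]_6.
Hypothesis le_total : total le.
Hypothesis vP : is_valuation iota le v.

Lemma val_one : v 1 = 0.
Proof. by rewrite -(rmorph1 iota) (val_const vP) ?oner_eq0. Qed.

Lemma val_inv f : f != 0 -> v f^-1 = - v f.
Proof.
move=> f0; apply/eqP; rewrite -addr_eq0 -(val_mul vP) ?invr_eq0 //.
by rewrite mulVf // val_one.
Qed.

Lemma valXz f (z : int) : f != 0 -> v (f ^ z) = v f *~ z.
Proof.
move=> f0; have valXn (n : nat) : v (f ^+ n) = v f *+ n.
  elim: n => [|n IHn]; first by rewrite expr0 val_one mulr0n.
  by rewrite exprS (val_mul vP) ?expf_neq0 // IHn mulrS.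
case: z => n; first by rewrite -exprnP valXn.
by rewrite NegzE -exprnN val_inv ?expf_neq0 // valXn mulrNz.
Qed.

Lemma val_prod (I : Type) (r : seq I) (f : I -> K) :
  (forall i, f i != 0) -> v (\prod_(i <- r) f i) = \sum_(i <- r) v (f i).
Proof.
move=> f0; elim: r => [|i r IHr]; first by rewrite !big_nil val_one.
rewrite !big_cons (val_mul vP) // ?IHr //.
by rewrite prodf_seq_neq0; apply: sub_all (all_predT _) => j _; apply: f0.
Qed.

Lemma val_neq_add f g : f != 0 -> g != 0 -> v f != v g ->
  f + g != 0 /\ (v (f + g) = v f \/ v (f + g) = v g).
Proof.
move=> f0 g0 vfg; have /orP [l|l] := le_total (v f) (v g).
  by have [] := val_add vP f0 g0 vfg l; split => //; left.
rewrite addrC; rewrite eq_sym in vfg.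
by have [] := val_add vP g0 f0 vfg l; split => //; right.
Qed.

Definition laurent (x : 'I_6 -> K) (m : 'rV[int]_6) : K := \prod_j x j ^ m 0 j.

Lemma laurentD x m m' : (forall j, x j != 0) ->
  laurent x (m + m') = laurent x m * laurent x m'.
Proof.
move=> x0; rewrite /laurent -big_split /=; apply: eq_bigr => j _.
by rewrite !mxE expfzDr.
Qed.

Lemma laurent0 x : laurent x 0 = 1.
Proof. by rewrite /laurent big1 // => j _; rewrite mxE expr0z. Qed.

Definition val_mx (x : 'I_6 -> K) : 'M[int]_6 := \matrix_i v (x i).

Lemma laurent_neq0 x m : (forall j, x j != 0) -> laurent x m != 0.
Proof.
by move=> x0; apply/prodf_neq0 => j _; rewrite expfz_neq0.
Qed.

Lemma val_laurent x m : (forall j, x j != 0) ->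
  v (laurent x m) = m *m val_mx x.
Proof.
move=> x0; rewrite /laurent val_prod => [|j]; last by rewrite expfz_neq0.
apply/rowP => k; rewrite summxE mxE; apply: eq_bigr => j _.
by rewrite valXz // /val_mx mxE -scaler_int mxE intz.
Qed.

(** When [M] is an additive submonoid this is a subalgebra of the Laurent polynomials in [x], so a
    condition on exponents has to be tested on generators only. *)
Definition in_span (x : 'I_6 -> K) (M : 'rV[int]_6 -> Prop) (f : K) : Prop :=
  exists2 l : seq (F * 'rV[int]_6), (forall t, t \in l -> M t.2)
    & f = \sum_(t <- l) iota t.1 * laurent x t.2.

Lemma in_spanD x M f g : in_span x M f -> in_span x M g -> in_span x M (f + g).
Proof.
move=> [l lM ->] [l' l'M ->]; exists (l ++ l'); last by rewrite big_cat.
by move=> t; rewrite mem_cat => /orP [/lM|/l'M].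
Qed.

Lemma in_span0 x M : in_span x M 0.
Proof. by exists [::]; rewrite ?big_nil. Qed.

Lemma in_span_sum x M (I : Type) (r : seq I) f :
  (forall i, in_span x M (f i)) -> in_span x M (\sum_(i <- r) f i).
Proof.
move=> fM; elim: r => [|i r IHr]; first by rewrite big_nil; apply: in_span0.
by rewrite big_cons; apply: in_spanD.
Qed.

Lemma in_span_laurent x (M : 'rV[int]_6 -> Prop) m c :
  M m -> in_span x M (iota c * laurent x m).
Proof.
by move=> Mm; exists [:: (c, m)]; rewrite ?big_seq1 // => t; rewrite inE => /eqP ->.
Qed.

Lemma in_spanM x (M : 'rV[int]_6 -> Prop) f g : (forall j, x j != 0) ->
  (forall m m', M m -> M m' -> M (m + m')) ->
  in_span x M f -> in_span x M g -> in_span x M (f * g).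
Proof.
move=> x0 MD [l lM ->] [l' l'M ->]; rewrite big_distrl big_seq /=.
elim/big_ind: _ => [|f1 f2|t /lM tM]; first exact: in_span0.
  exact: in_spanD.
rewrite big_distrr big_seq /=.
elim/big_ind: _ => [|f1 f2|t' /l'M t'M]; first exact: in_span0.
  exact: in_spanD.
rewrite mulrACA -rmorphM -laurentD //; exact/in_span_laurent/MD.
Qed.

Lemma in_spanX x (M : 'rV[int]_6 -> Prop) f n : (forall j, x j != 0) ->
  (forall m m', M m -> M m' -> M (m + m')) -> M 0 ->
  in_span x M f -> in_span x M (f ^+ n).
Proof.
move=> x0 MD M0 fM; elim: n => [|n IHn].
  by rewrite expr0 -(laurent0 x) -[laurent _ _]mul1r -(rmorph1 iota);
    apply: in_span_laurent.
by rewrite exprS; apply: in_spanM.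
Qed.

Lemma in_span_mmap x (M : 'rV[int]_6 -> Prop) n (h : 'I_n -> K) (P : mpoly n F) :
  (forall j, x j != 0) ->
  (forall m m', M m -> M m' -> M (m + m')) -> M 0 ->
  (forall i, in_span x M (h i)) -> in_span x M (mmap iota h P).
Proof.
move=> x0 MD M0 hM; rewrite /mmap; apply: in_span_sum => m.
have M1 : in_span x M 1.
  by rewrite -(laurent0 x) -[laurent _ _]mul1r -(rmorph1 iota);
    apply: in_span_laurent.
apply: in_spanM => //.
  rewrite -[iota _]mulr1 -(laurent0 x); exact: in_span_laurent.
rewrite /mmap1; elim/big_ind: _ => // [f g|i _]; first exact: in_spanM.
exact: in_spanX.
Qed.

(** Merging equal exponents and dropping zero coefficients leaves monomials whose values will be
    pairwise distinct. *)
Lemma span_collect x (M : 'rV[int]_6 -> Prop) (l : seq (F * 'rV[int]_6)) :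
  (forall t, t \in l -> M t.2) ->
  exists l', [/\ forall t, t \in l' -> M t.2 /\ t.1 != 0,
    uniq [seq t.2 | t <- l']
    & \sum_(t <- l) iota t.1 * laurent x t.2
      = \sum_(t <- l') iota t.1 * laurent x t.2].
Proof.
elim: l => [|[c m] l IHl] lM; first by exists [::].
have [|l' [l'M l'u e]] := IHl.
  by move=> t tl; apply: lM; rewrite inE tl orbT.
have Mm : M m by apply: (lM (c, m)); rewrite mem_head.
rewrite big_cons {}e /=.
have [c0|c0] := eqVneq c 0.
  by exists l'; split=> //; rewrite c0 rmorph0 mul0r add0r.
have [/mapP [[c' m'] ml' /= mm']|ml'] := boolP (m \in [seq t.2 | t <- l']); last first.
  exists ((c, m) :: l'); split=> [t||]; last by rewrite big_cons.
    by rewrite inE => /orP [/eqP -> //|/l'M].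
  by rewrite /= ml'.
subst m'; rewrite (perm_big _ (perm_to_rem ml')) big_cons /= addrA -mulrDl -rmorphD.
have ul : uniq (m :: [seq t.2 | t <- rem (c', m) l']).
  by rewrite -(perm_uniq (perm_map snd (perm_to_rem ml'))).
have remM t : t \in rem (c', m) l' -> M t.2 /\ t.1 != 0.
  by move/mem_rem/l'M.
have [cc|cc] := eqVneq (c + c') 0.
  exists (rem (c', m) l'); split=> //; first by move: ul => /andP [].
  by rewrite cc rmorph0 mul0r add0r.
exists ((c + c', m) :: rem (c', m) l'); split=> [t||]; rewrite ?big_cons //.
by rewrite inE => /orP [/eqP ->|/remM].
Qed.

(** Invertibility of [val_mx x] gives distinct monomials distinct values, so nothing cancels at the
    lowest one: v (f) is the value of a monomial present in f, and [V] converts this value back into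
    its exponent. *)
Lemma val_span x V (M : 'rV[int]_6 -> Prop) f : (forall j, x j != 0) ->
  val_mx x *m V = 1%:M -> in_span x M f -> f != 0 -> M (v f *m V).
Proof.
move=> x0 WV [l /(span_collect x) [l' [l'M l'u ->]] ->] {l f}.
suff : forall l : seq (F * 'rV[int]_6), uniq [seq t.2 | t <- l] ->
    (forall t, t \in l -> t.1 != 0) -> l != [::] ->
    \sum_(t <- l) iota t.1 * laurent x t.2 != 0 /\
    v (\sum_(t <- l) iota t.1 * laurent x t.2) *m V \in [seq t.2 | t <- l].
  move=> main s0; have l'0 : l' != [::].
    by apply: contraNneq s0 => ->; rewrite big_nil.
  by have [_ /mapP [t /l'M [Mt _] ->]] :=
    main l' l'u (fun t tl => (l'M t tl).2) l'0.
have val_term t : t.1 != 0 -> iota t.1 * laurent x t.2 != 0 /\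
    v (iota t.1 * laurent x t.2) *m V = t.2.
  move=> t0; have i0 : iota t.1 != 0 by rewrite fmorph_eq0.
  split; first by rewrite mulf_neq0 ?laurent_neq0.
  rewrite (val_mul vP) ?laurent_neq0 // (val_const vP) // add0r val_laurent //.
  by rewrite -mulmxA WV mulmx1.
elim=> // t l IHl ul l0 _; have [n1 e1] := val_term t (l0 _ (mem_head _ _)).
case: l => [|t' l] in IHl ul l0 *; first by rewrite big_seq1 e1 /= mem_head.
move: ul; rewrite [map _ _]/= cons_uniq => /andP [tl ul].
have [|n2 e2] := IHl ul _ isT; first by move=> u ul'; apply: l0; rewrite inE ul' orbT.
rewrite big_cons; set g := \sum_(_ <- _) _ in n2 e2 *.
have vne : v (iota t.1 * laurent x t.2) != v g.
  by apply: contra tl => /eqP e; rewrite -e1 e.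
have [n3 [e|e]] := val_neq_add n1 n2 vne; split=> //; rewrite e ?e1 ?mem_head //.
by rewrite inE e2 orbT.
Qed.

End ValuationTheory.

(** * Density of the points with complex coordinates *)

Section Digits.
Variable B : nat.

Lemma digits_lt n (m : nat -> nat) : (forall i, (m i < B)%N) ->
  (\sum_(i < n) m i * B ^ i < B ^ n)%N.
Proof.
move=> mB; elim: n => [|n IHn]; first by rewrite big_ord0.
rewrite big_ord_recr /= expnS.
apply: (@leq_trans (B ^ n + m n * B ^ n)); first by rewrite ltn_add2r.
by rewrite -mulSn leq_mul2r mB orbT.
Qed.

Lemma digits_inj n (m m' : nat -> nat) :
  (forall i, (m i < B)%N) -> (forall i, (m' i < B)%N) ->
  (\sum_(i < n) m i * B ^ i = \sum_(i < n) m' i * B ^ i)%N ->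
  forall i, (i < n)%N -> m i = m' i.
Proof.
move=> mB m'B; elim: n => // n IHn; rewrite !big_ord_recr /= => e.
have lt1 := digits_lt n mB; have lt2 := digits_lt n m'B.
have B0 : (0 < B ^ n)%N by apply: leq_ltn_trans lt1.
have emn : m n = m' n.
  have := congr1 (divn^~ (B ^ n)%N) e.
  by rewrite !divnDMl // !(divn_small lt1) !(divn_small lt2).
move: e; rewrite emn => /addIn /IHn IH i.
by rewrite ltnS leq_eqVlt => /orP [/eqP ->|/IH].
Qed.

End Digits.

(* Kronecker substitution of the powers t^(B^i) for the variables reduces the
   claim to polynomials in one variable. *)
Lemma mpoly_vanishing (C : numDomainType) n (P : mpoly n C) :
  (forall c : 'I_n -> C, meval c P = 0) -> P = 0.
Proof.
move=> P0; pose B := msize P.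
pose dig (m : multinom n) i := if @idP (i < n)%N is ReflectT h then m (Ordinal h) else 0%N.
have digE m (i : 'I_n) : dig m i = m i.
  rewrite /dig; case: {-}_ / idP => [h|]; last by rewrite ltn_ord.
  by congr (m _); apply: val_inj.
have dig_lt m : m \in msupp P -> forall i, (dig m i < B)%N.
  move=> mP i; have lt := msize_mdeg_lt mP; rewrite /dig.
  case: {-}_ / idP => [h|_]; last exact: leq_ltn_trans lt.
  by apply: leq_ltn_trans lt; rewrite mdegE (bigD1 (Ordinal h)) //= leq_addr.
pose code m := (\sum_(i < n) dig m i * B ^ i)%N.
have code_inj m m' : m \in msupp P -> m' \in msupp P -> code m = code m' -> m = m'.
  move=> mP m'P /(digits_inj (dig_lt _ mP) (dig_lt _ m'P)) e.
  by apply/mnmP => i; rewrite -!digE e.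
pose Q := \sum_(m <- msupp P) mcoeff m P *: 'X^(code m).
have Qt t : Q.[t] = 0.
  rewrite -(P0 (fun i => t ^+ (B ^ i))) mevalE horner_sum; apply: eq_bigr => m _.
  rewrite hornerZ hornerXn; congr (_ * _).
  rewrite /code expr_sum; apply: eq_bigr => i _.
  by rewrite digE mulnC exprM.
have {Qt} Q0 : Q = 0.
  apply/eqP/negPn/negP => Qn0.
  pose rs := [seq i%:R : C | i <- iota 0 (size Q)].
  suff : (size rs < size Q)%N by rewrite size_map size_iota ltnn.
  apply: max_poly_roots => //; first by apply/allP => t _; rewrite rootE Qt.
  by rewrite map_inj_uniq ?iota_uniq // => i j /eqP; rewrite eqr_nat => /eqP.
apply/mpolyP => m; rewrite mcoeff0.
apply/eqP/negPn/negP; rewrite -mcoeff_msupp => mP.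
have := congr1 (fun q : {poly C} => q`_(code m)) Q0.
rewrite coef0 coef_sum (bigD1_seq m) ?msupp_uniq //= big_seq_cond big1 ?addr0.
  by rewrite coefZ coefXn eqxx mulr1; apply/eqP; rewrite -mcoeff_msupp.
move=> m' /andP [m'P ne]; rewrite coefZ coefXn.
case: eqP => [/esym/code_inj e|]; last by rewrite mulr0.
by rewrite e ?eqxx // in ne.
Qed.

Section Density.
Variables (C : numFieldType) (K : fieldType) (d : nat).
Variables (emb : {rmorphism mpoly d C -> K}) (a : mpoly d C).
Hypotheses (emb_inj : injective emb) (a0 : a != 0).

(* h is a rational function with poles in {a = 0}, of values phi. *)
Definition has_values (h : K) (phi : ('I_d -> C) -> C) : Prop :=
  exists N (H : mpoly d C), h * emb a ^+ N = emb H /\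
    forall c, meval c a != 0 -> phi c * meval c a ^+ N = meval c H.

Lemma emb_eq0 p : (emb p == 0) = (p == 0).
Proof. by rewrite -(inj_eq emb_inj) rmorph0. Qed.

Lemma has_values_const c : has_values (emb (mpolyC d c)) (fun=> c).
Proof.
by exists 0%N, (mpolyC d c); rewrite expr0 mulr1; split=> // x _; rewrite mulr1 mevalC.
Qed.

Lemma has_valuesD h h' phi phi' : has_values h phi -> has_values h' phi' ->
  has_values (h + h') (fun c => phi c + phi' c).
Proof.
move=> [N [H [e v]]] [N' [H' [e' v']]].
exists (N + N')%N, (H * a ^+ N' + H' * a ^+ N); split.
  by rewrite rmorphD !rmorphM !rmorphXn -e -e' /= exprD; ring.
by move=> c ac; rewrite mevalD !mevalM !rmorphXn -v // -v' //= exprD; ring.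
Qed.

Lemma has_valuesM h h' phi phi' : has_values h phi -> has_values h' phi' ->
  has_values (h * h') (fun c => phi c * phi' c).
Proof.
move=> [N [H [e v]]] [N' [H' [e' v']]].
exists (N + N')%N, (H * H'); split.
  by rewrite rmorphM -e -e' exprD; ring.
by move=> c ac; rewrite mevalM -v // -v' //= exprD; ring.
Qed.

Lemma has_values_eq h phi psi : (forall c, meval c a != 0 -> phi c = psi c) ->
  has_values h phi -> has_values h psi.
Proof. by move=> e [N [H [? v]]]; exists N, H; split=> // c ac; rewrite -e // v. Qed.

Lemma has_values_poly (p : mpoly d C) : has_values (emb p) (fun c => meval c p).
Proof. by exists 0%N, p; rewrite expr0 mulr1; split=> // c _; rewrite expr0 mulr1. Qed.

Lemma has_values_frac (p q r : mpoly d C) : q * r = a ->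
  has_values (emb p / emb q) (fun c => meval c p / meval c q).
Proof.
move=> qr; exists 1%N, (p * r); rewrite !expr1 -qr; split.
  have q0 : emb q != 0.
    by rewrite emb_eq0; apply: contraNneq a0; rewrite -qr => ->; rewrite mul0r.
  by rewrite !rmorphM /=; field.
move=> c; rewrite mevalM mulf_eq0 negb_or => /andP [q0 _].
by rewrite expr1 !mevalM; field.
Qed.

Lemma has_values_mmap n (h : 'I_n -> K) phi (F : mpoly n C) :
  (forall i, has_values (h i) (phi i)) ->
  has_values (mmap (emb \o @mpolyC d C) h F) (fun c => meval (phi^~ c) F).
Proof.
move=> hv; rewrite /mmap.
apply: (@has_values_eq _ (fun c => \sum_(m <- msupp F)
    mcoeff m F * mmap1 (phi^~ c) m)) => [c _|]; first by [].
elim: (msupp F) => [|m l IHl].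
  apply: (@has_values_eq _ (fun=> 0)) => [c _|]; first by rewrite big_nil.
  rewrite big_nil -(rmorph0 (emb \o @mpolyC d C)); exact: has_values_const.
apply: has_values_eq => [c _|]; first by rewrite big_cons.
rewrite big_cons; apply: has_valuesD IHl; apply: has_valuesM.
  exact: has_values_const.
rewrite /mmap1; elim: (index_enum _) => [|i s IHs].
  apply: (@has_values_eq _ (fun=> 1)) => [c _|]; first by rewrite big_nil.
  by rewrite big_nil -(rmorph1 (emb \o @mpolyC d C)); apply: has_values_const.
apply: has_values_eq => [c _|]; first by rewrite big_cons.
rewrite big_cons; apply: has_valuesM IHs.
elim: (m i) => [|k IHk].
  apply: (@has_values_eq _ (fun=> 1)) => [c _|]; first by rewrite expr0.
  by rewrite expr0 -(rmorph1 (emb \o @mpolyC d C)); apply: has_values_const.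
apply: has_values_eq => [c _|]; first by rewrite exprS.
by rewrite exprS; apply: has_valuesM.
Qed.

(** Multiplying the difference by one more factor [a] makes it vanish at every complex point, also
    where [a] is zero, so that [mpoly_vanishing] applies. *)
Lemma has_values_inj h h' phi : has_values h phi -> has_values h' phi -> h = h'.
Proof.
move=> [N [H [e v]]] [N' [H' [e' v']]].
have a0' : emb a != 0 by rewrite emb_eq0.
have : (H * a ^+ N' - H' * a ^+ N) * a = 0.
  apply: mpoly_vanishing => c; rewrite mevalM mevalB !mevalM !rmorphXn /=.
  have [->|ac] := eqVneq (meval c a) 0; first by rewrite mulr0.
  by rewrite -v // -v' // mulrAC subrr mul0r.
move/eqP; rewrite mulf_eq0 (negPf a0) orbF subr_eq0 => /eqP /(congr1 emb).
rewrite !rmorphM !rmorphXn -e -e' /= -mulrA -mulrA [X in _ = _ * X]mulrC.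
by apply: mulIf; rewrite mulf_neq0 ?expf_neq0.
Qed.

End Density.

(** * Facets of a polytope given by irredundant inequalities *)

Section Facets.
Variable R : realType.
Implicit Types (g x : 'rV[R]_6) (u : 'cV[R]_6).

Lemma pairingD g g' u : pairing (g + g') u = pairing g u + pairing g' u.
Proof. by rewrite /pairing mulmxDl mxE. Qed.

Lemma pairingZ t g u : pairing (t *: g) u = t * pairing g u.
Proof. by rewrite /pairing -scalemxAl mxE. Qed.

Lemma pairingB g g' u : pairing (g - g') u = pairing g u - pairing g' u.
Proof. by rewrite /pairing mulmxBl !mxE. Qed.

Lemma pairing0 u : pairing 0 u = 0 :> R.
Proof. by rewrite /pairing mul0mx mxE. Qed.

Lemma pairing_sum (I : Type) (r : seq I) (f : I -> 'rV[R]_6) u :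
  pairing (\sum_(i <- r) f i) u = \sum_(i <- r) pairing (f i) u.
Proof. by rewrite /pairing mulmx_suml summxE. Qed.

Lemma pairingZr g u (t : R) : pairing g (t *: u) = t * pairing g u.
Proof. by rewrite /pairing -scalemxAr mxE. Qed.

Lemma pairing_row m (V : 'M[R]_(m, 6)) u i : pairing (row i V) u = (V *m u) i 0.
Proof. by rewrite /pairing -row_mul mxE. Qed.

Lemma small_multiple (I : eqType) (s : seq I) (a b : I -> R) :
  (forall k, k \in s -> 0 < a k) ->
  exists2 t : R, 0 < t & forall k, k \in s -> 0 < a k + t * b k.
Proof.
elim: s => [|k s IHs] a0; first by exists 1.
have [|t t0 tP] := IHs; first by move=> l ls; apply: a0; rewrite inE ls orbT.
have ak := a0 k (mem_head _ _).
exists (Num.min t (a k / (2 * (`|b k| + 1)))).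
  by rewrite lt_min t0 divr_gt0 // mulr_gt0 // ltr_wpDl.
set t' := Num.min _ _ => l; rewrite inE => /orP [/eqP ->|ls].
  have t'0 : 0 < t' by rewrite lt_min t0 divr_gt0 // mulr_gt0 // ltr_wpDl.
  have : t' * (2 * (`|b k| + 1)) <= a k.
    by rewrite -ler_pdivlMr ?mulr_gt0 ?ltr_wpDl // ge_min lexx orbT.
  have := ler_norm (- b k); rewrite normrN => bk.
  have : t' * (- b k) <= t' * `|b k| by rewrite ler_pM2l.
  nra.
have : t' <= t by rewrite ge_min lexx.
have t'0 : 0 < t' by rewrite lt_min t0 divr_gt0 // mulr_gt0 // ltr_wpDl.
have := tP l ls; have : 0 < a l by apply: a0; rewrite inE ls orbT.
by case: (leP 0 (b l)) => bl al tl tt; nra.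
Qed.

Lemma has_dim_le (S : set 'rV[R]_6) d d' : has_dim S d -> has_dim S d' -> (d <= d')%N.
Proof.
move=> [x [V [Vf Sx SxV _]]] [x' [V' [V'f _ _ SV']]].
rewrite -(eqP Vf) -(eqP V'f); apply: mxrankS; apply/row_subP => i.
have -> : row i V = (x + row i V - x') - (x - x').
  by apply/rowP => k; rewrite !mxE; ring.
by rewrite addmx_sub ?eqmx_opp ?SV'.
Qed.

Lemma has_dim_uniq (S : set 'rV[R]_6) d d' : has_dim S d -> has_dim S d' -> d = d'.
Proof. by move=> h h'; apply/eqP; rewrite eqn_leq (has_dim_le h h') (has_dim_le h' h). Qed.

Section Polytope.
Variables (n : nat) (N : 'M[int]_(6, n)) (b : 'I_n -> R).
Variables (z : 'rV[R]_6) (p : 'I_n -> 'rV[R]_6).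
Local Notation u j := (int_col R (col j N)).
Local Notation P := [set g : 'rV[R]_6 | forall j, b j <= pairing g (u j)].
Local Notation face j := [set g : 'rV[R]_6 | P g /\ pairing g (u j) = b j].
Hypothesis z_interior : forall j, b j < pairing z (u j).
Hypothesis p_face : forall j, pairing (p j) (u j) = b j.
Hypothesis p_strict : forall j l, l != j -> b l < pairing (p j) (u l).
Hypothesis unit_entry : forall j, exists i, `|N i j|%N = 1%N.

Lemma normal_neq0 j : u j != 0.
Proof.
have [i Nij] := unit_entry j; apply/eqP => /matrixP /(_ i 0) /eqP.
by rewrite !mxE intr_eq0 -absz_eq0 Nij.
Qed.

(** Finitely many strict inequalities survive a small step; a single [t] serves all rows of [V]. *)
Lemma strict_in_directions (x : 'rV[R]_6) (A : {pred 'I_n}) m (V : 'M[R]_(m, 6)) :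
  (forall j, j \in A -> b j < pairing x (u j)) ->
  exists2 t : R, 0 < t & forall i j, j \in A ->
    b j <= pairing (x + t *: row i V) (u j).
Proof.
move=> xA.
have [|t t0 tP] := @small_multiple _ (enum [pred ij : 'I_m * 'I_n | ij.2 \in A])
    (fun ij => pairing x (u ij.2) - b ij.2)
    (fun ij => pairing (row ij.1 V) (u ij.2)).
  by move=> ij; rewrite mem_enum inE subr_gt0 => /xA.
exists t => // i j jA; have := tP (i, j); rewrite mem_enum inE => /(_ jA) /=.
rewrite pairingD pairingZ; lra.
Qed.

Lemma polytope_has_dim : has_dim P 6.
Proof.
have [|t t0 tP] := @strict_in_directions z predT 6 1%:M; first by move=> j _.
exists z, (t *: 1%:M); split.
- by rewrite /row_free mxrank_scale_nz ?lt0r_neq0 // mxrank1.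
- by move=> j; apply/ltW.
- by move=> i j; rewrite linearZ; apply: tP.
- by move=> x _; rewrite eqmx_scale ?lt0r_neq0 // submx1.
Qed.

Lemma witness_in_polytope j : P (p j).
Proof.
by move=> l; have [->|lj] := eqVneq l j; rewrite ?p_face //; apply/ltW/p_strict.
Qed.

Lemma rank_normal (v : 'cV[R]_6) : v != 0 -> \rank v = 1%N.
Proof.
move=> v0; apply/eqP; rewrite eqn_leq rank_leq_col lt0n mxrank_eq0.
exact: v0.
Qed.

Lemma face_has_dim j : has_dim (face j) 5.
Proof.
have r : \rank (kermx (u j)) = 5%N by rewrite mxrank_ker rank_normal ?normal_neq0.
pose V : 'M[R]_(5, 6) := castmx (r, erefl 6%N) (row_base (kermx (u j))).
have VE : (V :=: kermx (u j))%MS.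
  by apply: eqmx_trans (eq_row_base _); apply: eqmx_cast.
have Vu : V *m u j = 0 by apply/sub_kermxP; rewrite VE.
have Vfree : row_free V by rewrite /row_free VE r.
have [|t t0 tP] := @strict_in_directions (p j) (predC1 j) _ V.
  by move=> l; rewrite inE; apply: p_strict.
have on_face i : pairing (p j + t *: row i V) (u j) = b j.
  by rewrite pairingD pairingZ pairing_row Vu mxE mulr0 addr0 p_face.
exists (p j), (t *: V); split.
- by rewrite /row_free mxrank_scale_nz ?lt0r_neq0.
- by split; [exact: witness_in_polytope|exact: p_face].
- move=> i; rewrite linearZ /=; split=> // l.
  by have [->|lj] := eqVneq l j; [rewrite on_face|apply: tP].
- move=> x [_ xj]; rewrite eqmx_scale ?lt0r_neq0 // VE; apply/sub_kermxP.
  apply/matrixP => i k; rewrite !ord1 [RHS]mxE.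
  by rewrite -[LHS]/(pairing (x - p j) (u j)) pairingB xj p_face subrr.
Qed.

Lemma face_exposed j : exposes P (u j) (b j) (face j).
Proof. by split=> // x; apply. Qed.

Lemma face_facet j : facet P (face j).
Proof.
split; first by exists (u j), (b j); apply: face_exposed.
by exists 5%N; split; [exact: polytope_has_dim|exact: face_has_dim].
Qed.

Lemma proportional_normals (V : 'M[R]_(5, 6)) (v w : 'cV[R]_6) :
  row_free V -> V *m v = 0 -> V *m w = 0 -> w != 0 -> exists t, v = t *: w.
Proof.
move=> Vf Vv Vw w0.
have ker (y : 'cV[R]_6) : V *m y = 0 -> (y^T <= kermx V^T)%MS.
  by move=> Vy; apply/sub_kermxP; rewrite -trmx_mul Vy trmx0.
have rk : \rank (kermx V^T) = 1%N by rewrite mxrank_ker mxrank_tr (eqP Vf).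
have rw : \rank w^T = 1%N by rewrite mxrank_tr rank_normal.
have : (v^T <= w^T)%MS.
  have [_ /esym] := mxrank_leqif_sup (ker _ Vw).
  by rewrite rk rw eqxx => /idP; apply: submx_trans; apply: ker.
by case/sub_rVP => t e; exists t; apply: trmx_inj; rewrite linearZ.
Qed.

(* A point of F in general position lies in the relative interior of F; if no
   inequality of P were tight there, the functional v would be constant near
   an interior minimum. *)
Lemma facet_classification F v c : exposes P v c F ->
  (exists d, has_dim P d.+1 /\ has_dim F d) ->
  exists j t, [/\ F = face j, 0 < t & v = t *: u j].
Proof.
move=> [vc FE] [d [Pd Fd]].
have d5 : d = 5%N by have [] := has_dim_uniq Pd polytope_has_dim.
subst d; have [y [V [Vf Fy FyV _]]] := Fd.
have v0 : v != 0.
  apply/eqP => v0; suff FP : F = P by have := Fd; rewrite FP => /(has_dim_uniq Pd).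
  have xv0 x : pairing x v = 0 by rewrite v0 /pairing mulmx0 mxE.
  have c0 : c = 0 by move: Fy; rewrite FE => -[_ <-].
  by rewrite FE; apply/seteqP; split=> [x []//|x Px]; split=> //; rewrite xv0 c0.
pose q i : 'rV[R]_6 := if unlift ord0 i is Some k then y + row k V else y.
have Fq (i : 'I_6) : F (q i) by rewrite /q; case: unliftP => [k _|_].
have Pq i : P (q i) by have := Fq i; rewrite FE => -[].
have qc i : pairing (q i) v = c by have := Fq i; rewrite FE => -[].
have [/existsP [j /forallP qj]|no_tight] :=
    boolP [exists j, forall i, pairing (q i) (u j) == b j]; last first.
  pose qb := 6%:R^-1 *: \sum_i q i.
  have q_strict j : b j < pairing qb (u j).
    rewrite pairingZ pairing_sum mulrC ltr_pdivlMr // mulr_natr.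
    have -> : b j *+ 6 = \sum_(i < 6) b j by rewrite sumr_const card_ord.
    move: no_tight; rewrite negb_exists => /forallP /(_ j).
    rewrite negb_forall => /existsP [i qij].
    rewrite (bigD1 i) //= [ltRHS](bigD1 i) //=; apply: ltr_leD.
      by rewrite lt_neqAle eq_sym qij; apply: Pq.
    by apply: ler_sum => l _; apply: Pq.
  have qbc : pairing qb v = c.
    rewrite pairingZ pairing_sum (eq_bigr (fun=> c)) // sumr_const card_ord.
    by rewrite -[c *+ _]mulr_natl mulrA mulVf ?mul1r // pnatr_eq0.
  clearbody qb.
  (* The directions are plus and minus the unit vectors: [v] attains its minimum [c] at the interior
     point [qb], so it decreases along none of them and must be zero. *)
  have [|t t0 tP] := @strict_in_directions qb predT _ (col_mx 1%:M (- 1%:M)).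
    by move=> j _.
  exfalso; move/eqP: v0; apply; apply/colP => k; rewrite [RHS]mxE.
  have := vc _ (fun j => tP (lshift 6 k) j isT).
  have := vc _ (fun j => tP (rshift 6 k) j isT).
  rewrite !pairingD !pairingZ !pairing_row qbc mul_col_mx col_mxEu col_mxEd.
  rewrite mul1mx mulNmx mul1mx mxE.
  rewrite mulrN -{1}[c]addr0 lerD2l oppr_ge0 pmulr_rle0 //.
  rewrite -{1}[c]addr0 lerD2l pmulr_rge0 // => le1 le2.
  by apply/eqP; rewrite eq_le le1 le2.
have q0 : q ord0 = y by rewrite /q unlift_none.
have qS k : q (lift ord0 k) = y + row k V by rewrite /q liftK.
have perp w r : (forall i, pairing (q i) w = r) -> V *m w = 0.
  move=> qw; apply/colP => k; rewrite -pairing_row mxE.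
  have := qw (lift ord0 k); have := qw ord0; rewrite qS q0 pairingD => ->.
  by rewrite -{2}[r]addr0 => /addrI.
have Vv := perp v c qc.
have Vu := perp (u j) (b j) (fun i => eqP (qj i)).
have [t vE] := proportional_normals Vf Vv Vu (normal_neq0 j).
have t0 : t != 0 by apply: contraNneq v0 => t0; rewrite vE t0 scale0r.
have cE : c = t * b j by rewrite -(qc ord0) vE pairingZr (eqP (qj ord0)).
have tpos : 0 < t.
  rewrite lt0r t0 /=; have := vc z (fun l => ltW (z_interior l)).
  rewrite vE pairingZr cE; have := z_interior j => zj.
  rewrite -subr_ge0 -mulrBr pmulr_lge0 //.
  by rewrite subr_gt0.
exists j, t; split=> //; rewrite FE; apply/seteqP; split=> x [Px xE]; split=> //.
  by move: xE; rewrite vE pairingZr cE => /(mulfI t0).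
by rewrite vE pairingZr xE cE.
Qed.

Lemma face_inj j l : face j = face l -> j = l.
Proof.
move=> e; have : face l (p j) by rewrite -e; split; [exact: witness_in_polytope|exact: p_face].
case=> _ pl; apply/eqP; rewrite eq_sym; apply: contraT => lj.
by have := p_strict lj; rewrite pl ltxx.
Qed.

(** An entry 1 or -1 of the column shows that [t] is the absolute value of an entry of [w], hence an
    integer; it then divides all entries of [w], and primitivity leaves t = 1. *)
Lemma primitive_multiple (w : 'cV[int]_6) j (t : R) : primitive w -> 0 < t ->
  int_col R w = t *: u j -> w = col j N.
Proof.
move=> wprim t0 /matrixP e.
have [i Nij] := unit_entry j.
have wE k : (w k 0)%:~R = t * (N k j)%:~R :> R.
  by have := e k 0; rewrite !mxE.
have tE : t = `|w i ord0|%N%:R.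
  have := congr1 Num.norm (wE i); rewrite normrM (gtr0_norm t0).
  by rewrite -!intr_norm -!abszE Nij mulr1 => <-.
have {}wE k : w k 0 = (`|w i ord0|%N)%:Z * N k j.
  by apply/eqP; rewrite -(eqr_int R) intrM; apply/eqP; rewrite wE tE.
have : (`|w i ord0| %| \big[gcdn/0]_k `|w k ord0|)%N.
  by apply/dvdn_biggcdP => k _; rewrite [w k _]wE abszM dvdn_mulr.
rewrite (wprim : _ = _) dvdn1 => /eqP w1; apply/matrixP => k l.
by rewrite !ord1 wE w1 mul1r mxE.
Qed.

Lemma column_primitive j : primitive (col j N).
Proof.
have [i Nij] := unit_entry j; rewrite /primitive.
have : (\big[gcdn/0]_k `|col j N k ord0| %| `|col j N i ord0|)%N.
  by rewrite (bigD1 i) //= dvdn_gcdl.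
by rewrite [col j N i _]mxE Nij dvdn1 => /eqP.
Qed.

Lemma face_normal j : facet_normal P (face j) (col j N).
Proof.
split; [exact: face_facet|exact: column_primitive|].
by exists (b j); apply: face_exposed.
Qed.

Lemma columns_of_inequalities : columns_are_facet_normals P N.
Proof.
split=> [w|F [[v [c vF]] dims]].
  split=> [[F [[_ dims] wprim [c wF]]]|[j ->]]; last first.
    by exists (face j); apply: face_normal.
  have [j [t [_ t0 wE]]] := facet_classification wF dims.
  by exists j; apply: primitive_multiple wE.
have [j [t [FE _ _]]] := facet_classification vF dims; subst F.
exists j; split; first exact: face_normal.
move=> l [_ _ [c' lF]].
have [l' [t' [/face_inj jl' t'0 lE]]] := facet_classification lF dims; subst l'.
have {}lE := primitive_multiple (column_primitive l) t'0 lE.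
(* By [lE] the columns j and l coincide, so for distinct indices the two witness points would give
   both b j < b l and b l < b j. *)
apply/eqP; apply: contraT => jl.
have := p_strict jl; rewrite -lE p_face => lt1.
have := @p_strict j l; rewrite eq_sym => /(_ jl).
by rewrite lE p_face => /(lt_trans lt1); rewrite ltxx.
Qed.

End Polytope.
End Facets.

(** * Flag minors and sections *)

Section FlagMinors.

Definition low6 (S : nzRingType) (a b c d e f : S) : 'M[S]_4 :=
  \matrix_(i, j) nth 0 (nth [::] [:: [:: 1; 0; 0; 0]; [:: a; 1; 0; 0];
                                    [:: b; c; 1; 0]; [:: d; e; f; 1]] i) j.

Definition low (S : nzRingType) (u : 'I_6 -> S) : 'M[S]_4 :=
  low6 (u (inord 0)) (u (inord 1)) (u (inord 2)) (u (inord 3)) (u (inord 4)) (u (inord 5)).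

Definition flag_rows : seq (seq nat) :=
  [:: [:: 2]; [:: 3]; [:: 1; 3]; [:: 1; 4]; [:: 2; 3]; [:: 2; 4]; [:: 1; 2; 4];
      [:: 1; 3; 4]; [::]; [:: 2; 3; 4]; [:: 3; 4]; [:: 4]; [:: 1]; [:: 1; 2];
      [:: 1; 2; 3]]%N.

(* The flag minors, except that number 8 is the only cluster variable which is
   not one: D_2 D_134 - D_1 D_234. *)
Definition flagvar (S : comNzRingType) (p : nat) (x : 'M[S]_4) : S :=
  let D I := minor I (iota 1 (size I)) x in
  if p == 8%N then D [:: 2] * D [:: 1; 3; 4] - D [:: 1] * D [:: 2; 3; 4]
  else D (nth [::] flag_rows p).

Definition flag_deg (p : nat) : seq nat :=
  nth [::] [:: [:: 1; 0; 0]; [:: 1; 0; 0]; [:: 0; 1; 0]; [:: 0; 1; 0];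
    [:: 0; 1; 0]; [:: 0; 1; 0]; [:: 0; 0; 1]; [:: 0; 0; 1]; [:: 1; 0; 1];
    [:: 0; 0; 1]; [:: 0; 1; 0]; [:: 1; 0; 0]; [:: 1; 0; 0]; [:: 0; 1; 0];
    [:: 0; 0; 1]]%N p.

Section Ring.
Variable S : comNzRingType.
Implicit Types x : 'M[S]_4.
Local Notation entry x i j := (x (inord i%N.-1) (inord j%N.-1)).

Lemma det2 (A : 'M[S]_2) :
  \det A = A ord0 ord0 * A ord_max ord_max - A ord0 ord_max * A ord_max ord0.
Proof.
rewrite (expand_det_row _ ord0) !big_ord_recl big_ord0 /cofactor !det_mx11 !mxE /=.
have -> : lift ord0 ord0 = ord_max :> 'I_2 by apply: val_inj.
have -> : lift ord_max ord0 = ord0 :> 'I_2 by apply: val_inj.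
by rewrite /=; ring.
Qed.

Lemma minor1 x i k : minor [:: i] [:: k] x = entry x i k.
Proof. by rewrite /minor /= det_mx11 !mxE. Qed.

Lemma minor2 x i j k l : minor [:: i; j] [:: k; l] x =
  entry x i k * entry x j l - entry x i l * entry x j k.
Proof. by rewrite /minor /= det2 !mxE. Qed.

Lemma minor3 x i1 i2 i3 k1 k2 k3 : minor [:: i1; i2; i3] [:: k1; k2; k3] x =
  entry x i1 k1 * (entry x i2 k2 * entry x i3 k3 - entry x i2 k3 * entry x i3 k2)
  - entry x i1 k2 * (entry x i2 k1 * entry x i3 k3 - entry x i2 k3 * entry x i3 k1)
  + entry x i1 k3 * (entry x i2 k1 * entry x i3 k2 - entry x i2 k2 * entry x i3 k1).
Proof.
rewrite /minor /= (expand_det_row _ ord0) !big_ord_recl big_ord0 /cofactor.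
by rewrite !det2 !mxE /=; ring.
Qed.

Definition flagvars_of (a b c d e f : S) : seq S :=
  [:: a; b; c; e; a * c - b; a * e - d; f; c * f - e; b * f - d;
      a * (c * f - e) - (b * f - d); b * e - c * d; d; 1; 1; 1].

Lemma flagvar_low6 (a b c d e f : S) p : (p < 15)%N ->
  flagvar p (low6 a b c d e f) = nth 0 (flagvars_of a b c d e f) p.
Proof.
case: p => [|[|[|[|[|[|[|[|[|[|[|[|[|[|[|//]]]]]]]]]]]]]]] _;
  rewrite /flagvar /= ?minor1 ?minor2 ?minor3 !mxE !inordK //=; ring.
Qed.

Lemma det_low6 (a b c d e f : S) : \det (low6 a b c d e f) = 1.
Proof.
rewrite det_trig => [|].
  by rewrite !big_ord_recl big_ord0 !mxE /= !mulr1.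
by apply/is_trig_mxP => -[[|[|[|[|//]]]] ?] [[|[|[|[|//]]]] ?]; rewrite !mxE.
Qed.

End Ring.

Lemma flagvar_map (S T : comNzRingType) (f : {rmorphism S -> T}) p (x : 'M[S]_4) :
  f (flagvar p x) = flagvar p (map_mx f x).
Proof.
have fminor I K : f (minor I K x) = minor I K (map_mx f x).
  rewrite /minor -det_map_mx; congr (\det _).
  by apply/matrixP => i j; rewrite !mxE.
by rewrite /flagvar; case: eqP => _; rewrite ?rmorphB ?rmorphM !fminor.
Qed.

End FlagMinors.

(** * Monomials in flag minors as sections of the line bundle *)

Section Sections.
Variable R : realType.
Local Notation C := R[i].

Lemma generic_lowerE : generic_lower R = low (@coordU R).
Proof.
apply/matrixP => i j; rewrite !mxE -(inj_eq val_inj).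
by case: i j => [[|[|[|[|//]]]] ?] [[|[|[|[|//]]]] ?].
Qed.

Lemma generic_flagvar p : (p < 15)%N -> flagvar p (generic_lower R) =
  nth 0 (flagvars_of (coordU R (inord 0)) (coordU R (inord 1)) (coordU R (inord 2))
    (coordU R (inord 3)) (coordU R (inord 4)) (coordU R (inord 5))) p.
Proof. by move=> hp; rewrite generic_lowerE flagvar_low6. Qed.

Lemma tau_generic : tau (generic_lower R) = 1.
Proof.
rewrite /tau 3?big_ltn // big_geq //=.
have f12 := @generic_flagvar 12 isT; have f13 := @generic_flagvar 13 isT.
have f14 := @generic_flagvar 14 isT; rewrite /flagvar /= in f12 f13 f14.
by rewrite f12 f13 f14 !expr1n !mulr1.
Qed.

Lemma section_ratioE k F : section_ratio k F =
  mmap (@constU R) (fun i => mxvec (generic_lower R) 0 i) F.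
Proof. by rewrite /section_ratio tau_generic expr1n divr1. Qed.

(** The first m columns of g b involve only the first m columns of g, through the leading m x m
    block of b, whose determinant is the character varpi_m. *)
Lemma minor_mul_upper (I : seq nat) (g b : 'M[C]_4) : (size I <= 4)%N ->
  is_trig_mx b^T ->
  minor I (iota 1 (size I)) (g *m b)
    = varpi (size I) b * minor I (iota 1 (size I)) g.
Proof.
move=> I4 /is_trig_mxP bT; set m := size I.
have b0 (i j : 'I_4) : (j < i)%N -> b i j = 0 by move=> /bT; rewrite mxE.
pose B : 'M[C]_m := \matrix_(i, j) b (widen_ord I4 i) (widen_ord I4 j).
have colE (j : 'I_m) : inord (nth 0%N (iota 1 m) j).-1 = widen_ord I4 j :> 'I_4.
  by apply: val_inj; rewrite nth_iota //= inordK // (leq_trans (ltn_ord j)).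
have -> : varpi m b = \det B.
  rewrite -det_tr det_trig; last first.
    by apply/is_trig_mxP => i j lij; rewrite !mxE b0.
  rewrite /varpi (big_ord_narrow I4).
  by apply: eq_bigr => i _; rewrite !mxE.
rewrite mulrC /minor -det_mulmx; congr (\det _).
apply/matrixP => i j; rewrite !mxE (bigID (fun k : 'I_4 => (k < m)%N)) /=.
rewrite [X in _ + X]big1 ?addr0 => [|k]; last first.
  rewrite -leqNgt => mk; rewrite colE b0 ?mulr0 //=.
  exact: leq_trans (ltn_ord j) mk.
rewrite (big_ord_narrow I4); apply: eq_bigr => k _; rewrite !mxE.
by rewrite !colE.
Qed.

Lemma flagvar_mul_upper p (g b : 'M[C]_4) : (p < 15)%N -> is_trig_mx b^T ->
  flagvar p (g *m b)
    = (\prod_(l < 3) varpi l.+1 b ^+ nth 0%N (flag_deg p) l) * flagvar p g.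
Proof.
move=> hp bT; rewrite !big_ord_recl big_ord0 mulr1.
move: hp; case: p => [|[|[|[|[|[|[|[|[|[|[|[|[|[|[|//]]]]]]]]]]]]]]] _;
  rewrite /flagvar /= /bump /= !minor_mul_upper //=; ring.
Qed.

Definition Xmx : 'M[matpoly R]_4 :=
  \matrix_(i, j) mpolyX _ (mnm1 (mxvec_index i j)).

Lemma mmap_Xmx (T : comNzRingType) (f : {rmorphism C -> T}) (x : 'M[T]_4) p :
  mmap f (fun i => mxvec x 0 i) (flagvar p Xmx) = flagvar p x.
Proof.
rewrite [LHS](flagvar_map (mmap f (fun i => mxvec x 0 i) : {rmorphism _ -> _})) /=.
congr (flagvar p _).
by apply/matrixP => i j; rewrite !mxE /= mmapX mmap1U mxvecE.
Qed.

Lemma at_mx_flagvar p (g : 'M[C]_4) : at_mx (flagvar p Xmx) g = flagvar p g.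
Proof. exact: mmap_Xmx. Qed.

Definition flag_monomial (e : seq (nat * nat)) : matpoly R :=
  \prod_(t <- e) flagvar t.1 Xmx ^+ t.2.

Lemma at_mx_monomial e (g : 'M[C]_4) :
  at_mx (flag_monomial e) g = \prod_(t <- e) flagvar t.1 g ^+ t.2.
Proof.
rewrite /at_mx rmorph_prod; apply: eq_bigr => t _.
by rewrite rmorphXn /= [meval _ _]at_mx_flagvar.
Qed.

Lemma section_ratio_monomial k e :
  section_ratio k (flag_monomial e)
    = \prod_(t <- e) flagvar t.1 (generic_lower R) ^+ t.2.
Proof.
rewrite section_ratioE rmorph_prod; apply: eq_bigr => t _.
by rewrite rmorphXn /= mmap_Xmx.
Qed.

Lemma monomial_nonzero_section k e : all (fun t => t.1 < 15)%N e ->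
  (forall l, (l < 3)%N -> \sum_(t <- e) t.2 * nth 0 (flag_deg t.1) l = k.*2)%N ->
  nonzero_section k (flag_monomial e).
Proof.
move=> /allP e15 ek; split=> [g b _ [_ bT]|].
  rewrite !at_mx_monomial.
  have -> : \prod_(t <- e) flagvar t.1 (g *m b) ^+ t.2 = \prod_(t <- e)
      ((\prod_(l < 3) varpi l.+1 b ^+ (nth 0%N (flag_deg t.1) l * t.2))
       * flagvar t.1 g ^+ t.2).
    apply: eq_big_seq => t /e15 t15; rewrite flagvar_mul_upper // exprMn.
    by rewrite -prodrXl; congr (_ * _); apply: eq_bigr => l _; rewrite exprM.
  rewrite big_split exchange_big /=; congr (_ * _).
  rewrite /lambda -prodrXl big_add1 big_mkord; apply: eq_bigr => l _.
  rewrite -expr_sum; under eq_bigr => t _ do rewrite mulnC.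
  by rewrite ek // -exprM mul2n.
(* The lower triangular Pascal matrix, at which all fifteen variables take values among 1, 2, 3. *)
exists (low6 1 1 2 1 3 3); first exact: det_low6.
rewrite at_mx_monomial prodf_seq_neq0; apply/allP => -[p n] /e15 /= p15.
rewrite expf_neq0 // flagvar_low6 //.
have small (x : C) (m : nat) : x = m.+1%:R -> x != 0.
  by move=> ->; rewrite pnatr_eq0.
by case: p p15 => [|[|[|[|[|[|[|[|[|[|[|[|[|[|[|//]]]]]]]]]]]]]]] _ /=;
  solve [apply: (small _ 0%N); ring|apply: (small _ 1%N); ring|apply: (small _ 2%N); ring].
Qed.

End Sections.

(** * Factorization through the opposite cell *)

Section OppositeCell.
Variable F : fieldType.
Variables a b c d e f : F.
Local Notation D p := (nth 0 (flagvars_of a b c d e f) p).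
Hypotheses (d0 : D 11 != 0) (D34 : D 10 != 0) (D234 : D 9 != 0).

(* The points u of U^- with nonzero minors D_4, D_34, D_234 are those in
   w0 U^- B, by the LU decomposition of the matrix u with its rows reversed. *)
Definition opposite_mx : 'M[F]_4 :=
  \matrix_(i, j) low6 (D 1 / D 11) (D 0 / D 11) (D 5 / D 10)
                      (1 / D 11) (D 3 / D 10) (D 7 / D 9) (rev_ord i) j.

(** The leading products of its diagonal are D_4, - D_34, - D_234 and 1: minors of the last rows of
    u, with the signs caused by reversing the rows. *)
Definition opposite_upper : 'M[F]_4 :=
  \matrix_(i, j) nth 0 (nth [::] [::
    [:: d; e; f; 1];
    [:: 0; - (D 10 / D 11); - (D 8 / D 11); - (b / D 11)];
    [:: 0; 0; D 9 / D 10; D 4 / D 10];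
    [:: 0; 0; 0; - (D 9)^-1]] i) j.

Lemma opposite_factorization : low6 a b c d e f = opposite_mx *m opposite_upper.
Proof.
move: d0 D34 D234 => /= ? ? ?.
apply/matrixP => -[[|[|[|[|//]]]] ?] [[|[|[|[|//]]]] ?];
  rewrite !mxE !big_ord_recl big_ord0 !mxE /=; field; by do ?[apply/andP; split].
Qed.

Lemma opposite_upper_trig : is_trig_mx opposite_upper^T.
Proof.
by apply/is_trig_mxP => -[[|[|[|[|//]]]] ?] [[|[|[|[|//]]]] ?]; rewrite !mxE.
Qed.

Lemma det_opposite_upper : \det opposite_upper = 1.
Proof.
move: d0 D34 D234 => /= ? ? ?.
rewrite -det_tr (det_trig opposite_upper_trig) !big_ord_recl big_ord0 !mxE /=.
by field; do ?[apply/andP; split].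
Qed.

Lemma det_opposite_mx : \det opposite_mx = 1.
Proof.
have := congr1 (fun A => \det A) opposite_factorization.
by rewrite /= det_low6 det_mulmx det_opposite_upper mulr1.
Qed.

End OppositeCell.

Definition opposite (F : fieldType) (u : 'I_6 -> F) : 'M[F]_4 :=
  opposite_mx (u (inord 0)) (u (inord 1)) (u (inord 2)) (u (inord 3)) (u (inord 4))
    (u (inord 5)).

(** The restriction of [flagvar] to U^- as an explicit polynomial in the six coordinates, over any
    ring: the same formula serves polynomials, complex points and the function field. *)
Definition flag_at (S : comNzRingType) (u : 'I_6 -> S) (p : nat) : S :=
  nth 0 (flagvars_of (u (inord 0)) (u (inord 1)) (u (inord 2)) (u (inord 3))
    (u (inord 4)) (u (inord 5))) p.

Lemma flag_at_map (S T : comNzRingType) (f : {rmorphism S -> T}) u p :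
  f (flag_at u p) = flag_at (f \o u) p.
Proof.
case: p => [|[|[|[|[|[|[|[|[|[|[|[|[|[|[|p]]]]]]]]]]]]]]];
  rewrite /flag_at /= ?(rmorphB, rmorphM, rmorph1) //.
by rewrite !nth_default ?rmorph0.
Qed.

(** * Matrix entries on the two cells as functions of complex points *)

Section OppositeValues.
Variables (C : numFieldType) (K : fieldType) (emb : {rmorphism mpoly 6 C -> K}).
Hypothesis emb_inj : injective emb.
Let X (i : 'I_6) : mpoly 6 C := mpolyX C (mnm1 i).

Definition opposite_denom : mpoly 6 C := flag_at X 9 * flag_at X 10 * flag_at X 11.

Lemma meval_flag_at c p : meval c (flag_at X p) = flag_at c p.
Proof.
by rewrite [LHS](flag_at_map (meval c : {rmorphism _ -> _})) /flag_at /= !mevalXU.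
Qed.

Lemma meval_opposite_denom c :
  meval c opposite_denom = flag_at c 9 * flag_at c 10 * flag_at c 11.
Proof. by rewrite !mevalM !meval_flag_at. Qed.

Lemma opposite_denom_neq0 : opposite_denom != 0.
Proof.
(* The coordinates of the Pascal matrix, where D_4, D_34 and D_234 are all 1. *)
pose c (i : 'I_6) : C := nth 0 [:: 1; 1; 2; 1; 3; 3] i.
have e : meval c opposite_denom = 1.
  by rewrite meval_opposite_denom /flag_at /= /c !inordK //=; ring.
by apply: contraNneq (oner_neq0 C) => a0; rewrite -e a0 meval0.
Qed.

Local Notation hv := (has_values emb opposite_denom).

Lemma has_values0 : hv 0 (fun=> 0).
Proof. by have := has_values_const emb opposite_denom 0; rewrite mpolyC0 rmorph0. Qed.

Lemma has_values1 : hv 1 (fun=> 1).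
Proof. by have := has_values_const emb opposite_denom 1; rewrite mpolyC1 rmorph1. Qed.

Lemma flag_has_values p : hv (flag_at (emb \o X) p) (fun c => flag_at c p).
Proof.
rewrite -flag_at_map.
apply: has_values_eq (has_values_poly _ _ _) => c _; exact: meval_flag_at.
Qed.

Lemma ratio_has_values p q r : flag_at X q * r = opposite_denom ->
  hv (flag_at (emb \o X) p / flag_at (emb \o X) q) (fun c => flag_at c p / flag_at c q).
Proof.
move=> qr; rewrite -!flag_at_map.
apply: has_values_eq (has_values_frac emb_inj opposite_denom_neq0 _ qr) => c _.
by rewrite !meval_flag_at.
Qed.

Lemma low_has_values r s : hv (low (emb \o X) r s) (fun c => low c r s).
Proof.
have hv0 := has_values0; have hv1 := has_values1.
have h p := flag_has_values p.
case: r s => [[|[|[|[|//]]]] ?] [[|[|[|[|//]]]] ?];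
  rewrite mxE /=; (apply: has_values_eq => [c _|]; [by rewrite mxE|]) => //=.
- exact: (h 0%N).
- exact: (h 1%N).
- exact: (h 2%N).
- exact: (h 11%N).
- exact: (h 3%N).
- exact: (h 6%N).
Qed.

Lemma opposite_has_values r s : hv (opposite (emb \o X) r s) (fun c => opposite c r s).
Proof.
have hv0 := has_values0; have hv1 := has_values1.
have h11 p : hv (flag_at (emb \o X) p / flag_at (emb \o X) 11)
    (fun c => flag_at c p / flag_at c 11).
  by apply: (@ratio_has_values _ _ (flag_at X 9 * flag_at X 10)); rewrite mulrC.
have h10 p : hv (flag_at (emb \o X) p / flag_at (emb \o X) 10)
    (fun c => flag_at c p / flag_at c 10).
  by apply: (@ratio_has_values _ _ (flag_at X 9 * flag_at X 11)); rewrite mulrCA mulrA.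
have h9 p : hv (flag_at (emb \o X) p / flag_at (emb \o X) 9)
    (fun c => flag_at c p / flag_at c 9).
  by apply: (@ratio_has_values _ _ (flag_at X 10 * flag_at X 11)); rewrite mulrA.
case: r s => [[|[|[|[|//]]]] ?] [[|[|[|[|//]]]] ?];
  rewrite !mxE /=; (apply: has_values_eq => [c _|]; [by rewrite !mxE|]) => //=.
- exact: (h11 12%N).
- exact: (h10 3%N).
- exact: (h9 7%N).
- exact: (h11 0%N).
- exact: (h10 5%N).
- exact: (h11 1%N).
Qed.

End OppositeValues.

Section SectionsOnOppositeCell.
Variable R : realType.
Local Notation C := R[i].

(* The square kills the signs of the diagonal entries of opposite_upper. *)
Lemma section_opposite_point k (F : matpoly R) (c : 'I_6 -> C) : is_section k F ->
  flag_at c 9 * flag_at c 10 * flag_at c 11 != 0 ->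
  at_mx F (low c)
    = (flag_at c 9 * flag_at c 10 * flag_at c 11) ^+ k.*2 * at_mx F (opposite c).
Proof.
move=> Fk; rewrite !mulf_eq0 !negb_or => /andP [/andP [D9 D10] D11].
rewrite /low (opposite_factorization D11 D10 D9) Fk; last first.
- by split; [exact: det_opposite_upper|exact: opposite_upper_trig].
- exact: det_opposite_mx.
congr (_ * _); rewrite -mul2n exprM; congr (_ ^+ k).
have varpiE l (b : 'M[C]_4) :
    varpi l b = \prod_(j < 4) (if (j < l)%N then b j j else 1).
  exact: big_mkcond.
rewrite /lambda 3?big_ltn // big_geq // mulr1 !varpiE.
rewrite !big_ord_recl !big_ord0 /= !mxE /=.
move: D9 D10 D11; rewrite /flag_at /= => D9 D10 D11; field.
by do ?[apply/andP; split].
Qed.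

(** The equivariance of F is known at complex points only. Both sides take the same values wherever
    D_4 D_34 D_234 does not vanish, which identifies them in the function field. *)
Lemma section_ratio_opposite k (F : matpoly R) : is_section k F ->
  section_ratio k F =
  (flag_at (@coordU R) 9 * flag_at (@coordU R) 10 * flag_at (@coordU R) 11) ^+ k.*2
  * mmap (@constU R) (fun i => mxvec (opposite (@coordU R)) 0 i) F.
Proof.
move=> Fk; rewrite section_ratioE generic_lowerE.
pose emb : {rmorphism mpoly 6 C -> KGB R} := @tofrac (mpoly 6 C).
have emb_inj : injective emb by move=> p q /eqP; rewrite tofrac_eq => /eqP.
have a0 := @opposite_denom_neq0 C.
apply: (has_values_inj emb_inj a0 (phi := fun c => at_mx F (low c))).
  apply: (has_values_mmap (phi := fun i c => mxvec (low c) 0 i)) => // i.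
  case/mxvec_indexP: i => r s; rewrite mxvecE.
  apply: has_values_eq (low_has_values emb r s) => c _.
  by rewrite mxvecE.
apply: (has_values_eq (phi := fun c =>
  (flag_at c 9 * flag_at c 10 * flag_at c 11) ^+ k.*2 * at_mx F (opposite c))).
  by move=> c; rewrite meval_opposite_denom => /(section_opposite_point Fk) ->.
apply: has_valuesM.
  pose P : mpoly 6 C := opposite_denom C ^+ k.*2.
  have := has_values_poly emb (opposite_denom C) P.
  rewrite /P rmorphXn /= !rmorphM /= !flag_at_map.
  by apply: has_values_eq => c _; rewrite rmorphXn /= meval_opposite_denom.
apply: (has_values_mmap (phi := fun i c => mxvec (opposite c) 0 i)) => // i.
case/mxvec_indexP: i => r s; rewrite mxvecE.
apply: has_values_eq (opposite_has_values emb_inj r s) => c _.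
by rewrite mxvecE.
Qed.

End SectionsOnOppositeCell.

(** * Decision trees for affine forms *)

Section IntegerRows.

Definition rowz (m : seq int) : 'rV[int]_6 := \row_j nth 0 m j.

Definition sumz (s : seq int) : int := foldr +%R 0 s.

Lemma sumzE n (f : nat -> int) : \sum_(k < n) f k = sumz [seq f k | k <- iota 0 n].
Proof.
rewrite -(big_mkord xpredT f) /index_iota subn0 /sumz.
by elim: (iota 0 n) => [|k s IHs]; rewrite ?big_nil // big_cons IHs.
Qed.

Definition dotz n (v w : seq int) : int := sumz [seq nth 0 v k * nth 0 w k | k <- iota 0 n].

Definition colz (A : seq (seq int)) j : seq int := [seq nth 0 r j | r <- A].

Lemma nth_colz A j k : nth 0 (colz A j) k = nth 0 (nth [::] A k) j.
Proof.
have [kA|Ak] := ltnP k (size A); first by rewrite (nth_map [::]).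
by rewrite !nth_default ?nth_nil // ?size_map // nth_default.
Qed.

Definition inverse_rows (A B : seq (seq int)) : bool :=
  all (fun i => all (fun j =>
    dotz 6 (nth [::] A i) (colz B j) == (i == j)%:R) (iota 0 6)) (iota 0 6).

Lemma inverse_rowsP A B : inverse_rows A B ->
  mx_of_rows 6 6 A *m mx_of_rows 6 6 B = 1%:M.
Proof.
have io (i : 'I_6) : (i : nat) \in iota 0 6 by rewrite mem_iota /= ltn_ord.
move=> /allP AB; apply/matrixP => i j; rewrite !mxE.
have /allP /(_ _ (io j)) /eqP <- := AB _ (io i).
rewrite /dotz -(sumzE 6 (fun k => nth 0 (nth [::] A i) k * nth 0 (colz B j) k)).
by apply: eq_bigr => k _; rewrite !mxE nth_colz.
Qed.

End IntegerRows.

(* Affine forms on R^6, given by the constant followed by the coefficients. *)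
Section AffineForms.
Variable R : realType.

Definition evalf (f : seq int) (g : 'rV[R]_6) : R :=
  (nth 0 f 0)%:~R + \sum_(i < 6) (nth 0 f i.+1)%:~R * g 0 i.

Definition addf (f h : seq int) : seq int := mkseq (fun i => nth 0 f i + nth 0 h i) 7.

Definition scalef (c : int) (f : seq int) : seq int := mkseq (fun i => c * nth 0 f i) 7.

#[local] Arguments addf : simpl never.
#[local] Arguments scalef : simpl never.

Lemma evalf_add f h g : evalf (addf f h) g = evalf f g + evalf h g.
Proof.
rewrite /evalf /addf nth_mkseq // rmorphD addrACA -big_split /=; congr (_ + _).
by apply: eq_bigr => -[[|[|[|[|[|[|//]]]]]] ?] _ /=; rewrite rmorphD mulrDl.
Qed.

Lemma evalf_scale c f g : evalf (scalef c f) g = c%:~R * evalf f g.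
Proof.
rewrite /evalf /scalef nth_mkseq // rmorphM mulrDr mulr_sumr; congr (_ + _).
by apply: eq_bigr => -[[|[|[|[|[|[|//]]]]]] ?] _ /=; rewrite rmorphM mulrA.
Qed.

Lemma evalf_zero g : evalf [:: 0; 0; 0; 0; 0; 0; 0] g = 0.
Proof.
by rewrite /evalf big1 ?addr0 // => -[[|[|[|[|[|[|//]]]]]] ?] _ /=; rewrite mul0r.
Qed.

Definition combf (ctx : seq (seq int)) (cert : seq nat) : seq int :=
  foldr (fun cf h => addf (scalef (Posz cf.1) cf.2) h) [:: 0; 0; 0; 0; 0; 0; 0] (zip cert ctx).

Lemma combf_ge0 ctx cert g : (forall f, f \in ctx -> 0 <= evalf f g) ->
  0 <= evalf (combf ctx cert) g.
Proof.
rewrite /combf; elim: ctx cert => [|f ctx IH] [|c cert] ctx0 /=;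
  rewrite ?evalf_zero //.
rewrite evalf_add evalf_scale addr_ge0 ?mulr_ge0 ?ler0z //.
  by apply: ctx0; rewrite mem_head.
by apply: IH => h hc; apply: ctx0; rewrite inE hc orbT.
Qed.

(* A binary decision tree on the signs of affine forms. At a leaf the cone of
   the given chart contains the current region: each of its defining forms is
   known to be nonnegative, or is the combination of known ones with the
   coefficients of one of the certificates. *)
Inductive fan_cover :=
  FanLeaf of nat & seq (seq nat) | FanSplit of seq int & fan_cover & fan_cover.

Fixpoint fan_cover_ok (forms : nat -> seq (seq int)) (ctx : seq (seq int))
    (t : fan_cover) : bool :=
  match t with
  | FanLeaf x certs => (x < 14)%N && all (fun f => (f \in ctx) ||
      has (fun cert => combf ctx cert == f) certs) (forms x)
  | FanSplit f t1 t2 =>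
    fan_cover_ok forms (f :: ctx) t1 && fan_cover_ok forms (scalef (-1) f :: ctx) t2
  end.

Lemma fan_cover_okP forms ctx t g : fan_cover_ok forms ctx t ->
  (forall f, f \in ctx -> 0 <= evalf f g) ->
  exists2 x, (x < 14)%N & forall f, f \in forms x -> 0 <= evalf f g.
Proof.
elim: t ctx => [x certs|f t1 IH1 t2 IH2] ctx /=.
  move=> /andP [x14 /allP ok] ctx0; exists x => // f /ok /orP [/ctx0 //|/hasP [c _ /eqP <-]].
  exact: combf_ge0.
move=> /andP [ok1 ok2] ctx0; have [f0|f0] := leP 0 (evalf f g).
  by apply: IH1 ok1 _ => h; rewrite inE => /orP [/eqP ->|/ctx0].
apply: IH2 ok2 _ => h; rewrite inE => /orP [/eqP ->|/ctx0] //.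
by rewrite evalf_scale mulrN1z mulNr mul1r oppr_ge0 ltW.
Qed.

End AffineForms.

(** * Upper and lower bounds from one chart *)

Section ClosureInequalities.
Variable R : realType.
Implicit Types (S : set 'rV[R]_6) (x y : 'rV[R]_6).

Lemma pairingE x (u : 'cV[R]_6) : pairing x u = \sum_i x 0 i * u i 0.
Proof. by rewrite /pairing mxE. Qed.

Lemma closure_ge S (u : 'cV[R]_6) c : (forall x, S x -> c <= pairing x u) ->
  forall x, closure S x -> c <= pairing x u.
Proof.
move=> Sc x clx; rewrite leNgt; apply/negP => xc.
pose T := \sum_i `|u i 0|.
have T0 : 0 < T + 1 by rewrite ltr_wpDl // sumr_ge0.
pose eps := (c - pairing x u) / (T + 1).
have eps0 : 0 < eps by rewrite divr_gt0 // subr_gt0.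
have [y [Sy xy]] := clx _ (nbhsx_ballx x eps eps0).
have := Sc y Sy; rewrite leNgt => /negP; apply.
rewrite -subr_gt0 (_ : c - _ = (c - pairing x u) - (pairing y u - pairing x u)); last by ring.
rewrite subr_gt0 !pairingE -sumrB; apply: le_lt_trans (_ : eps * T < _).
  rewrite /T mulr_sumr; apply: ler_sum => i _; rewrite -mulrBl.
  apply: le_trans (ler_norm _) _; rewrite normrM ler_wpM2r // distrC.
  by case: xy => _ /(_ 0 i) /ltW.
have -> : c - \sum_i x 0 i * u i 0 = eps * (T + 1).
  by rewrite mulfVK ?lt0r_neq0 // pairingE.
by rewrite ltr_pM2l // ltrDl.
Qed.

Lemma closure_approx S x (y : nat -> 'rV[R]_6) (c : R) :
  (forall n, S (y n)) -> (forall n j, `|x 0 j - y n 0 j| <= c / n.+1%:R) ->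
  closure S x.
Proof.
move=> Sy xy B /nbhs_ballP [eps /= eps0 epsB].
have [n nP] : exists n : nat, c / n.+1%:R < eps.
  exists (Num.truncn (c / eps)); rewrite ltr_pdivrMr // mulrC -ltr_pdivrMr //.
  exact: truncnS_gt.
exists (y n); split=> //; apply: epsB; split=> // i j; rewrite ord1.
exact: le_lt_trans (xy n j) nP.
Qed.

End ClosureInequalities.

(** * Exponents and degrees as affine forms in the value *)

Section Forms.

(** With [V] inverse to the matrix of values of a cluster, this is the exponent of the j-th variable
    in the Laurent monomial of value g. *)
Definition col_form (V : seq (seq int)) j : seq int := 0 :: colz V j.

(** The slack 2 - deg for one fundamental weight, deg being the degree of the Laurent monomial of
    value g; 2 is the coefficient of that weight in lambda. *)
Definition deg_form (V : seq (seq int)) (bc : seq nat) l : seq int :=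
  2 :: [seq - dotz 6 r [seq (nth 0%N (flag_deg p) l)%:Z | p <- bc] | r <- V].

Definition upper_forms V bc : seq (seq int) :=
  [seq col_form V j | j <- iota 3 3] ++ [seq deg_form V bc l | l <- iota 0 3].

(** Nonnegative mutable exponents are added to the upper bounds: the cone where the monomial is a
    genuine cluster monomial of admissible degree. *)
Definition chart_forms V bc : seq (seq int) :=
  [seq col_form V j | j <- iota 0 3] ++ upper_forms V bc.

(** Degrees satisfy an inequality rather than an equality because the factors D_[i], equal to 1 on
    U^-, are dropped from the expansions. *)
Definition exponents_ok (bc : seq nat) (p : nat) (ex : seq (seq int)) : bool :=
  all (fun m : seq int => all (fun j => 0 <= nth 0 m j) (iota 3 3) &&
    all (fun l => dotz 6 m [seq (nth 0%N (flag_deg q) l)%:Z | q <- bc]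
      <= (nth 0%N (flag_deg p) l)%:Z) (iota 0 3)) ex.

(** For positive [k], [k] times the affine form at g / k: homogenizing keeps the test on values of
    sections of the k-th power integral. *)
Definition evalz (k : nat) (f : seq int) (g : 'rV[int]_6) : int :=
  k%:Z * nth 0 f 0 + \sum_(i < 6) nth 0 f i.+1 * g 0 i.

Lemma evalz_col k V j (g : 'rV[int]_6) (j6 : (j < 6)%N) :
  evalz k (col_form V j) g = (g *m mx_of_rows 6 6 V) 0 (Ordinal j6).
Proof.
rewrite /evalz mulr0 add0r mxE; apply: eq_bigr => i _.
by rewrite mxE /= nth_colz mulrC.
Qed.

Lemma evalz_deg k V bc l (g : 'rV[int]_6) : size bc = 6%N -> size V = 6%N ->
  evalz k (deg_form V bc l) g = k.*2%:Z -
    \sum_j (g *m mx_of_rows 6 6 V) 0 j * (nth 0%N (flag_deg (nth 0%N bc j)) l)%:Z.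
Proof.
move=> sbc sV; rewrite /evalz /= -muln2 PoszM -sumrN; congr (_ + _).
under [RHS]eq_bigr => j _ do rewrite mxE mulr_suml -sumrN.
rewrite exchange_big /=; apply: eq_bigr => i _.
rewrite (nth_map [::]) ?sV // /dotz.
rewrite -(sumzE 6 (fun k => nth 0 (nth [::] V i) k
   * nth 0 [seq (nth 0%N (flag_deg p) l)%:Z | p <- bc] k)).
rewrite mulNr mulr_suml -sumrN; apply: eq_bigr => j _.
by rewrite mxE (nth_map 0%N) ?sbc //; ring.
Qed.

End Forms.

(** * Upper bounds from the Laurent expansions in one cluster *)

Section Charts.
Variables (F K : fieldType) (iota : {rmorphism F -> K}) (le : rel 'rV[int]_6).
Variable v : K -> 'rV[int]_6.
Hypothesis le_total : total le.
Hypothesis vP : is_valuation iota le v.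
Variable u : 'I_6 -> K.
Local Notation D p := (flag_at u p).
Hypothesis D_neq0 : forall p, (p < 15)%N -> D p != 0.

Variables (bc : seq nat) (W V : seq (seq int)) (ex : nat -> seq (seq int)).
Hypothesis size_bc : size bc = 6%N.
Hypothesis size_V : size V = 6%N.
Hypothesis bc_lt : all (fun p => p < 15)%N bc.
Hypothesis bc_frozen : drop 3 bc = [:: 9; 10; 11]%N.
Local Notation x := (fun j : 'I_6 => D (nth 0%N bc j)).
Hypothesis valW : forall j : 'I_6, v (x j) = row j (mx_of_rows 6 6 W).
Hypothesis WV : inverse_rows W V.
Hypothesis expansions : forall p, p \in [:: 0; 1; 2; 3; 5; 6; 7]%N ->
  exponents_ok bc p (ex p) /\ D p = \sum_(m <- ex p) laurent x (rowz m).

(* Regularity of f on U^- bounds below the frozen exponents of f in the chart;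
   regularity of f / (D_4 D_34 D_234)^(2 k) on the opposite cell bounds the
   degrees above. *)
Definition frozen_nonneg (m : 'rV[int]_6) := forall j : 'I_6, (2 < j)%N -> 0 <= m 0 j.

Definition deg_row l (m : 'rV[int]_6) : int :=
  \sum_j m 0 j * (nth 0%N (flag_deg (nth 0%N bc j)) l)%:Z.

Definition deg_nonpos (m : 'rV[int]_6) := forall l, (l < 3)%N -> deg_row l m <= 0.

Lemma deg_rowD l m m' : deg_row l (m + m') = deg_row l m + deg_row l m'.
Proof. by rewrite -big_split; apply: eq_bigr => j _; rewrite mxE mulrDl. Qed.

Lemma deg_rowZ l c m : deg_row l (c *: m) = c * deg_row l m.
Proof. by rewrite /deg_row mulr_sumr; apply: eq_bigr => i _; rewrite mxE mulrA. Qed.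

Lemma frozen_nonnegD m m' : frozen_nonneg m -> frozen_nonneg m' -> frozen_nonneg (m + m').
Proof. by move=> h h' j j2; rewrite mxE addr_ge0 ?h ?h'. Qed.

Lemma deg_nonposD m m' : deg_nonpos m -> deg_nonpos m' -> deg_nonpos (m + m').
Proof. by move=> h h' l l3; rewrite deg_rowD -[0]addr0 lerD ?h ?h'. Qed.

Lemma frozen_nonneg0 : frozen_nonneg 0.
Proof. by move=> j _; rewrite mxE. Qed.

Lemma deg_row0 l : deg_row l 0 = 0.
Proof. by rewrite /deg_row big1 // => j _; rewrite mxE mul0r. Qed.

Lemma deg_nonpos0 : deg_nonpos 0.
Proof. by move=> l _; rewrite deg_row0. Qed.

Lemma deg_row_rowz l m : deg_row l (rowz m) =
  dotz 6 m [seq (nth 0%N (flag_deg q) l)%:Z | q <- bc].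
Proof.
rewrite /dotz -(sumzE 6 (fun k => nth 0 m k
   * nth 0 [seq (nth 0%N (flag_deg p) l)%:Z | p <- bc] k)).
by apply: eq_bigr => j _; rewrite mxE (nth_map 0%N) ?size_bc.
Qed.

Lemma deg_row_delta l j : deg_row l (delta_mx 0 j) =
  (nth 0%N (flag_deg (nth 0%N bc j)) l)%:Z.
Proof.
rewrite /deg_row (bigD1 j) //= big1 ?addr0 => [|i ij]; first by rewrite mxE !eqxx mul1r.
by rewrite mxE (negPf ij) andbF mul0r.
Qed.

Lemma x_neq0 j : x j != 0.
Proof. by rewrite D_neq0 // (all_nthP 0%N bc_lt) // size_bc. Qed.

Lemma laurent_delta (y : 'I_6 -> K) j (z : int) : laurent y (z *: delta_mx 0 j) = y j ^ z.
Proof.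
rewrite /laurent (bigD1 j) //= big1 ?mulr1 => [|i ij]; first by rewrite !mxE !eqxx mulr1.
by rewrite !mxE (negPf ij) andbF mulr0 expr0z.
Qed.

Lemma in_span_laurent1 (M : 'rV[int]_6 -> Prop) m : M m -> in_span iota x M (laurent x m).
Proof. by move=> Mm; rewrite -[laurent _ _]mul1r -(rmorph1 iota); apply: in_span_laurent. Qed.

Lemma in_span1 (M : 'rV[int]_6 -> Prop) : M 0 -> in_span iota x M 1.
Proof. by move=> M0; rewrite -(laurent0 x); apply: in_span_laurent1. Qed.

Lemma in_span_sumlaurent (M : 'rV[int]_6 -> Prop) (s : seq (seq int)) (f : seq int -> 'rV[int]_6) :
  (forall m, m \in s -> M (f m)) -> in_span iota x M (\sum_(m <- s) laurent x (f m)).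
Proof.
move=> sM; rewrite big_seq; elim/big_ind: _ => [|f1 f2|m /sM Mm].
- exact: in_span0.
- exact: in_spanD.
- exact: in_span_laurent1.
Qed.

Lemma D_in_span p : p \in [:: 0; 1; 2; 3; 5; 6; 7]%N ->
  in_span iota x frozen_nonneg (D p).
Proof.
move=> pP; have [/allP ok ->] := expansions pP; apply: in_span_sumlaurent => m /ok.
case/andP => /allP m0 _ j j2; rewrite mxE; apply: m0.
by rewrite mem_iota j2 /= ltn_ord.
Qed.

Lemma frozenE j : (2 < j)%N -> (j < 6)%N -> nth 0%N bc j = (j + 6)%N.
Proof.
rewrite -(cat_take_drop 3 bc) bc_frozen nth_cat size_take size_bc /=.
by case: j => [|[|[|[|[|[|j]]]]]].
Qed.

Lemma ratio_in_span p (j : 'I_6) : p \in [:: 0; 1; 2; 3; 5; 6; 7]%N -> (2 < j)%N ->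
  flag_deg p = flag_deg (j + 6) -> in_span iota x deg_nonpos (D p / D (j + 6)).
Proof.
move=> pP j2 dp; have [/allP ok ->] := expansions pP.
rewrite -(frozenE j2) // -[(D (nth _ _ _))^-1](laurent_delta x j (-1)) mulr_suml.
under eq_bigr => m _ do rewrite -(laurentD _ _ x_neq0).
apply: in_span_sumlaurent => m /ok /andP [_ /allP dm] l l3.
rewrite deg_rowD deg_row_rowz deg_rowZ deg_row_delta mulN1r subr_le0 frozenE //.
rewrite -dp; apply: dm.
by rewrite mem_iota.
Qed.

Lemma low_in_span r s : in_span iota x frozen_nonneg (low u r s).
Proof.
have h1 := in_span1 frozen_nonneg0; have h0 := in_span0 iota x frozen_nonneg.
have D11 : in_span iota x frozen_nonneg (D 11).
  rewrite (_ : D 11 = laurent x (1 *: delta_mx 0 (inord 5))).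
    by apply: in_span_laurent1 => j _; rewrite !mxE mulr_ge0.
  by rewrite laurent_delta expr1z inordK // frozenE.
case: r s => [[|[|[|[|//]]]] ?] [[|[|[|[|//]]]] ?]; rewrite mxE //=;
 [exact: (@D_in_span 0)|exact: (@D_in_span 1)|exact: (@D_in_span 2)
 |exact: (@D_in_span 3)|exact: (@D_in_span 6)].
Qed.

Lemma opposite_in_span r s : in_span iota x deg_nonpos (opposite u r s).
Proof.
have h1 := in_span1 deg_nonpos0; have h0 := in_span0 iota x deg_nonpos.
have hr p q : (2 < q < 6)%N -> p \in [:: 0; 1; 2; 3; 5; 6; 7]%N ->
    flag_deg p = flag_deg (q + 6) -> in_span iota x deg_nonpos (D p / D (q + 6)).
  by move=> /andP [q2 q6] pP dp; apply: (@ratio_in_span p (Ordinal q6)).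
have D11 : in_span iota x deg_nonpos (1 / D 11).
  rewrite (_ : 1 / D 11 = laurent x (-1 *: delta_mx 0 (inord 5))).
    by apply: in_span_laurent1 => l _; rewrite deg_rowZ deg_row_delta mulN1r oppr_le0.
  by rewrite laurent_delta mul1r inordK // frozenE.
case: r s => [[|[|[|[|//]]]] ?] [[|[|[|[|//]]]] ?]; rewrite !mxE //=.
- exact: (@hr 3 4).
- exact: (@hr 7 3).
- exact: (@hr 0 5).
- exact: (@hr 5 4).
- exact: (@hr 1 5).
Qed.

Lemma val_upper_forms k n (P : mpoly n F) (f : K) (hl ho : 'I_n -> K) :
  (forall i, exists r s, hl i = low u r s) -> f = mmap iota hl P ->
  (forall i, exists r s, ho i = opposite u r s) ->
  f = (D 9 * D 10 * D 11) ^+ k.*2 * mmap iota ho P ->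
  f != 0 ->
  forall h, h \in upper_forms V bc -> 0 <= evalz k h (v f).
Proof.
have WV1 := inverse_rowsP WV.
have vWV : val_mx v x *m mx_of_rows 6 6 V = 1%:M.
  by rewrite -WV1; congr (_ *m _); apply/row_matrixP => j; rewrite rowK valW.
move=> hlP f1 hoP f2 f0 h; rewrite mem_cat => /orP [/mapP [j]|/mapP [l]].
  rewrite mem_iota => /andP [j2 j6] ->.
  rewrite (@evalz_col _ _ j) //.
  have : in_span iota x frozen_nonneg f.
    rewrite f1; apply: in_span_mmap; first exact: x_neq0.
    - exact: frozen_nonnegD.
    - exact: frozen_nonneg0.
    - by move=> i; have [r [s ->]] := hlP i; apply: low_in_span.
  by move=> sp; apply: (val_span le_total vP x_neq0 vWV sp f0).
rewrite mem_iota => /= l3 ->; rewrite evalz_deg //.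
set g := mmap _ _ _ in f2.
have g0 : g != 0 by apply: contraNneq f0 => g0; rewrite f2 g0 mulr0.
have : in_span iota x deg_nonpos g.
  apply: in_span_mmap; first exact: x_neq0.
  - exact: deg_nonposD.
  - exact: deg_nonpos0.
  - by move=> i; have [r [s ->]] := hoP i; apply: opposite_in_span.
move=> sp; have deg_g := val_span le_total vP x_neq0 vWV sp g0 _ l3.
have vD (j : 'I_6) : (2 < j)%N -> v (D (j + 6)) *m mx_of_rows 6 6 V = delta_mx 0 j.
  by move=> j2; rewrite -(frozenE j2) // valW -row_mul WV1 rowE mulmx1.
have [D9 D10 D11] : [/\ D 9 != 0, D 10 != 0 & D 11 != 0] by rewrite !D_neq0.
have vf : v f *m mx_of_rows 6 6 V = k.*2%:Z *: (delta_mx 0 (inord 3) + delta_mx 0 (inord 4)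
    + delta_mx 0 (inord 5)) + v g *m mx_of_rows 6 6 V.
  rewrite f2 (val_mul vP) ?expf_neq0 ?mulf_neq0 // exprnP (valXz vP) ?mulf_neq0 //.
  rewrite !(val_mul vP) ?mulf_neq0 // mulmxDl -scaler_int -scalemxAl !mulmxDl.
  have := vD (inord 3); have := vD (inord 4); have := vD (inord 5).
  by rewrite !inordK // => /(_ isT) -> /(_ isT) -> /(_ isT) ->; rewrite intz.
rewrite -/(deg_row l _) vf deg_rowD subr_ge0.
have -> : deg_row l (k.*2%:Z *: (delta_mx 0 (inord 3) + delta_mx 0 (inord 4)
    + delta_mx 0 (inord 5))) = k.*2%:Z.
  rewrite deg_rowZ !deg_rowD !deg_row_delta !inordK // !frozenE //.
  by case: l l3 {deg_g} => [|[|[|//]]] _; rewrite mulr1.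
by rewrite gerDl.
Qed.

End Charts.

(** * Values of the cluster variables *)

Section ExchangeRelations.

(* (p, q, M1, M2): the variables p and q are exchanged, their product being
   the sum of the products over M1 and M2 (the minors D_[i] are omitted). *)
Definition exchange_relations : seq (nat * nat * seq nat * seq nat) :=
  [:: (0, 2, [:: 1], [:: 4]);
      (0, 3, [:: 11], [:: 5]);
      (0, 7, [:: 8], [:: 9]);
      (1, 3, [:: 2; 11], [:: 10]);
      (1, 5, [:: 4; 11], [:: 0; 10]);
      (2, 6, [:: 3], [:: 7]);
      (3, 8, [:: 6; 10], [:: 7; 11]);
      (4, 6, [:: 5], [:: 9]);
      (4, 8, [:: 0; 10], [:: 1; 9]);
      (5, 2, [:: 10], [:: 3; 4]);
      (5, 8, [:: 0; 6; 10], [:: 9; 11]);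
      (6, 1, [:: 8], [:: 11]);
      (7, 4, [:: 2; 9], [:: 10]);
      (7, 5, [:: 3; 9], [:: 6; 10]);
      (8, 2, [:: 1; 7], [:: 10])]%N.

Lemma exchange_relationsP (S : comNzRingType) (u : 'I_6 -> S) t :
  t \in exchange_relations ->
  flag_at u t.1.1.1 * flag_at u t.1.1.2
    = \prod_(r <- t.1.2) flag_at u r + \prod_(r <- t.2) flag_at u r.
Proof.
rewrite !inE; do 14?[case/orP]; move=> /eqP ->;
  rewrite /= !big_cons !big_nil /flag_at /=; ring.
Qed.

End ExchangeRelations.

Section Values.
Variables (F K : fieldType) (iota : {rmorphism F -> K}) (le : rel 'rV[int]_6).
Variable v : K -> 'rV[int]_6.
Hypothesis vP : is_valuation iota le v.
Variable ee : seq (seq int).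
Hypothesis le_exch : forall a a', exch_le (mx_of_rows 3 6 ee) a a' -> le a' a.
Variable u : 'I_6 -> K.
Local Notation D p := (flag_at u p).
Hypothesis D_neq0 : forall p, (p < 15)%N -> D p != 0.

Definition addv (a b : seq int) : seq int := mkseq (fun i => nth 0 a i + nth 0 b i) 6.
Definition subv (a b : seq int) : seq int := mkseq (fun i => nth 0 a i - nth 0 b i) 6.
Definition sumv (vals : seq (seq int)) (M : seq nat) : seq int :=
  foldr (fun r a => addv (nth [::] vals r) a) [::] M.

Lemma rowz_mkseq f : rowz (mkseq f 6) = \row_j f j.
Proof. by apply/rowP => j; rewrite !mxE nth_mkseq. Qed.

Lemma rowz_addv a b : rowz (addv a b) = rowz a + rowz b.
Proof. by rewrite rowz_mkseq; apply/rowP => j; rewrite !mxE. Qed.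

Lemma rowz_subv a b : rowz (subv a b) = rowz a - rowz b.
Proof. by rewrite rowz_mkseq; apply/rowP => j; rewrite !mxE. Qed.

Lemma rowz_nil : rowz [::] = 0.
Proof. by apply/rowP => j; rewrite !mxE nth_nil. Qed.

(** The empty list, with which [set_nth] pads, marks a value not yet computed; a computed one has
    six entries. *)
Definition known (vals : seq (seq int)) p := (p < 15)%N && (nth [::] vals p != [::]).

(* A value_step (i, b1, b2, w) uses the i-th exchange relation to compute the value
   of one variable (the second one if b1) from that of the other; the leading
   monomial on the right is M1 (M2 if b2), and w expresses the difference of the
   two values in terms of the rows of the exchange matrix. *)
Definition value_step := (nat * bool * bool * seq int)%type.

Definition step_data (s : value_step) : nat * nat * seq nat * seq nat :=
  let: (i, b1, b2, _) := s in
  let: (p, q, M1, M2) := nth (0%N, 0%N, [::], [::]) exchange_relations i in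
  (if b1 then q else p, if b1 then p else q, if b2 then M2 else M1, if b2 then M1 else M2).

Definition step_ok (vals : seq (seq int)) (s : value_step) : bool :=
  let: (p, q, M1, M2) := step_data s in
  let w := s.2 in
  [&& (s.1.1.1 < size exchange_relations)%N, (p < 15)%N, known vals q, all (known vals) M1,
      all (known vals) M2, all (fun z => 0 <= z) w,
      subv (sumv vals M2) (sumv vals M1) == mkseq (fun j => dotz 3 w (colz ee j)) 6
    & subv (sumv vals M2) (sumv vals M1) != mkseq (fun=> 0) 6].

Definition do_step (vals : seq (seq int)) (s : value_step) : seq (seq int) :=
  let: (p, q, M1, M2) := step_data s in
  set_nth [::] vals p (subv (sumv vals M1) (nth [::] vals q)).

Fixpoint run_steps vals ss := if ss is s :: ss' then run_steps (do_step vals s) ss' else vals.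

Fixpoint steps_ok vals ss :=
  if ss is s :: ss' then step_ok vals s && steps_ok (do_step vals s) ss' else true.

Definition values_ok (vals : seq (seq int)) :=
  forall p, known vals p -> v (D p) = rowz (nth [::] vals p).

Lemma val_monomial vals M : values_ok vals -> all (known vals) M ->
  \prod_(r <- M) D r != 0 /\ v (\prod_(r <- M) D r) = rowz (sumv vals M).
Proof.
move=> ok; elim: M => [|r M IHM] /=.
  by rewrite big_nil oner_neq0 (val_one vP) rowz_nil.
move=> /andP [kr /IHM [n0 e]]; rewrite big_cons.
have Dr : D r != 0 by rewrite D_neq0 //; case/andP: kr.
by split; rewrite ?mulf_neq0 // (val_mul vP) // ok // e rowz_addv.
Qed.

Lemma step_data_relation s : (s.1.1.1 < size exchange_relations)%N ->
  let: (p, q, M1, M2) := step_data s in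
  D p * D q = \prod_(r <- M1) D r + \prod_(r <- M2) D r.
Proof.
case: s => [[[i b1] b2] w] i_lt; rewrite /step_data.
move: (exchange_relationsP u (mem_nth (0%N, 0%N, [::], [::]) i_lt)) => {i_lt}.
case: (nth _ _ _) => [[[p q] M1] M2] /=.
case: b1; case: b2 => e.
- by rewrite mulrC addrC; exact: e.
- by rewrite mulrC; exact: e.
- by rewrite addrC; exact: e.
- exact: e.
Qed.

(** Adding a nonnegative combination of rows of the exchange matrix can only raise a value, whatever
    the adapted order. As the difference of the two monomials is also nonzero, the first one is
    strictly lower and determines the value of the product. *)
Lemma do_step_ok vals s : step_ok vals s -> values_ok vals -> values_ok (do_step vals s).
Proof.
rewrite /step_ok /do_step; case e: (step_data s) => [[[p q] M1] M2].
case/and5P => i_lt p15 kq k1 /and4P [k2 w0 dM dM0] ok p'.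
have := step_data_relation i_lt; rewrite e => rel.
rewrite /known nth_set_nth /=; have [->|_] := eqVneq p' p => /andP [p'15 kp']; last first.
  by apply: ok; rewrite /known p'15.
have [n1 v1] := val_monomial ok k1; have [n2 v2] := val_monomial ok k2.
have Dq : D q != 0 by rewrite D_neq0 //; case/andP: kq.
have Dp := D_neq0 p15.
have d12 : rowz (sumv vals M2) - rowz (sumv vals M1) =
    \row_j dotz 3 s.2 (colz ee j).
  by rewrite -rowz_subv (eqP dM) rowz_mkseq.
have lev : le (v (\prod_(r <- M1) D r)) (v (\prod_(r <- M2) D r)).
  rewrite v1 v2; apply: le_exch; exists (\row_i nth 0 s.2 i); split.
    move=> i; rewrite mxE; have [lt|ge] := ltnP i (size s.2).
      by apply: (all_nthP 0 w0).
    by rewrite nth_default.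
  apply/eqP; rewrite -subr_eq0 opprD addrA d12 subr_eq0; apply/eqP/rowP => j.
  rewrite !mxE /dotz -(sumzE 3 (fun k => nth 0 s.2 k * nth 0 (colz ee j) k)).
  by apply: eq_bigr => i _; rewrite !mxE nth_colz.
have vne : v (\prod_(r <- M1) D r) != v (\prod_(r <- M2) D r).
  apply: contra dM0; rewrite v1 v2 eq_sym -subr_eq0 d12 => /eqP /rowP d0.
  rewrite (eqP dM) /mkseq; apply/eqP/eq_in_map => j; rewrite mem_iota => j6.
  by have := d0 (Ordinal j6); rewrite !mxE.
have [_ vs] := val_add vP n1 n2 vne lev.
rewrite rowz_subv -v1 -vs -rel (val_mul vP) //.
by rewrite (ok q kq) addrK.
Qed.

Lemma run_steps_ok vals ss : steps_ok vals ss -> values_ok vals ->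
  values_ok (run_steps vals ss).
Proof.
elim: ss vals => //= s ss IH vals /andP [ok1 ok2] ok.
by apply: IH => //; apply: do_step_ok.
Qed.

End Values.

(** * The field generated by the image of a ring *)

Section Quotients.
Variables (A : nzRingType) (K : fieldType) (phi : {rmorphism A -> K}).

Definition is_quotient (f : K) := exists P Q, phi Q != 0 /\ f = phi P / phi Q.

Lemma quotient_image P : is_quotient (phi P).
Proof. by exists P, 1; rewrite rmorph1 oner_neq0 divr1. Qed.

Lemma quotientD f g : is_quotient f -> is_quotient g -> is_quotient (f + g).
Proof.
move=> [P [Q [Q0 ->]]] [P' [Q' [Q'0 ->]]]; exists (P * Q' + P' * Q), (Q * Q').
by rewrite rmorphD !rmorphM mulf_neq0 //= addf_div.
Qed.

Lemma quotientM f g : is_quotient f -> is_quotient g -> is_quotient (f * g).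
Proof.
move=> [P [Q [Q0 ->]]] [P' [Q' [Q'0 ->]]]; exists (P * P'), (Q * Q').
by rewrite !rmorphM mulf_neq0 //= mulf_div.
Qed.

Lemma quotient0 : is_quotient 0.
Proof. by have := quotient_image 0; rewrite rmorph0. Qed.

Lemma quotient1 : is_quotient 1.
Proof. by have := quotient_image 1; rewrite rmorph1. Qed.

Lemma quotientV f : is_quotient f -> is_quotient f^-1.
Proof.
move=> [P [Q [Q0 ->]]]; have [P0|P0] := eqVneq (phi P) 0.
  by rewrite P0 mul0r invr0; apply: quotient0.
by exists Q, P; rewrite invf_div.
Qed.

Lemma quotient_sum (I : Type) (r : seq I) f : (forall i, is_quotient (f i)) ->
  is_quotient (\sum_(i <- r) f i).
Proof.
by move=> fq; elim/big_ind: _ => // [|f1 f2]; [exact: quotient0|exact: quotientD].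
Qed.

Lemma quotient_prod (I : Type) (r : seq I) f : (forall i, is_quotient (f i)) ->
  is_quotient (\prod_(i <- r) f i).
Proof.
by move=> fq; elim/big_ind: _ => // [|f1 f2]; [exact: quotient1|exact: quotientM].
Qed.

Lemma quotientXn f n : is_quotient f -> is_quotient (f ^+ n).
Proof.
move=> fq; elim: n => [|n IHn]; first by rewrite expr0; apply: quotient1.
by rewrite exprS; apply: quotientM.
Qed.

Lemma quotient_laurent x m : (forall j, is_quotient (x j)) -> is_quotient (laurent x m).
Proof.
move=> xq; apply: quotient_prod => j; case: (m 0 j) => n; first exact: quotientXn.
by rewrite NegzE -exprnN; apply/quotientV/quotientXn.
Qed.

Lemma quotient_of_fractions (k : fieldType) (emb : {rmorphism mpoly 6 k -> K}) :
  (forall c, is_quotient (emb (mpolyC 6 c))) ->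
  (forall j, is_quotient (emb (mpolyX k (mnm1 j)))) ->
  forall n d, is_quotient (emb n / emb d).
Proof.
move=> cq uq n d; have pq p : is_quotient (emb p).
  rewrite (mpolyE p) rmorph_sum; apply: quotient_sum => m.
  rewrite -mul_mpolyC rmorphM; apply: quotientM; first exact: cq.
  rewrite mpolyXE_id rmorph_prod; apply: quotient_prod => j.
  by rewrite rmorphXn; apply: quotientXn; apply: uq.
by apply: quotientM; [exact: pq|apply/quotientV/pq].
Qed.

End Quotients.

Section SeedCoordinates.
Variable R : realType.
Local Notation C := R[i].
Local Notation D p := (flag_at (@coordU R) p).

Lemma frac_repr (A : idomainType) (f : {fraction A}) :
  exists n d, d != 0 /\ f = tofrac n / tofrac d.
Proof.
elim/quotW: f => x; exists (frac x).1, (frac x).2.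
have x0 := denom_ratioP x; split=> //.
have d0 : tofrac (frac x).2 != 0 by rewrite tofrac_eq0.
apply: (mulIf d0); rewrite mulfVK //; unlock FracField.tofrac.
rewrite -[LHS]FracField.pi_mul; apply/eqmodP; rewrite /= FracField.equivfE /FracField.mulf.
by rewrite !numden_Ratio ?oner_neq0 ?mulf_neq0 ?oner_neq0 // !mulr1 mulrC.
Qed.

Lemma rmorph_mmap (A B T : comNzRingType) n (f : {rmorphism B -> T})
    (g : {rmorphism A -> B}) (h : 'I_n -> B) (P : mpoly n A) :
  f (mmap g h P) = mmap (f \o g) (f \o h) P.
Proof.
rewrite /mmap rmorph_sum; apply: eq_bigr => m _; rewrite rmorphM; congr (_ * _).
by rewrite /mmap1 rmorph_prod; apply: eq_bigr => j _; rewrite rmorphXn.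
Qed.

Definition represents (s : seed R) (bc : seq nat) (ee : seq (seq int)) : Prop :=
  (forall j : 'I_6, cvar s j = D (nth 0%N bc j)) /\ exch s = mx_of_rows 3 6 ee.

Lemma D_tofrac p : D p = tofrac (flag_at (fun i => mpolyX C (mnm1 i)) p).
Proof.
pose f : {rmorphism mpoly 6 C -> KGB R} := @tofrac (mpoly 6 C).
by rewrite -[RHS]/(f _) flag_at_map.
Qed.

Lemma D_neq0 p : (p < 15)%N -> D p != 0.
Proof.
move=> p15; rewrite D_tofrac tofrac_eq0.
pose c (i : 'I_6) : C := nth 0 [:: 1; 1; 2; 1; 3; 3] i.
have nz (x : C) (m : nat) : x = m.+1%:R -> x != 0 by move=> ->; rewrite pnatr_eq0.
have : flag_at c p != 0.
  case: p p15 => [|[|[|[|[|[|[|[|[|[|[|[|[|[|[|//]]]]]]]]]]]]]]] _;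
  rewrite /flag_at /= /c ?inordK //=;
  solve [apply: (nz _ 0%N); ring|apply: (nz _ 1%N); ring|apply: (nz _ 2%N); ring].
by apply: contraNneq => e; rewrite -meval_flag_at e meval0.
Qed.

(** A relation P between the cluster variables becomes the zero polynomial in the coordinates of
    U^-. Since every point with nonzero entries is a value of the cluster, P vanishes on the torus,
    and P times the product of all variables vanishes everywhere. *)
Lemma seed_free s bc ee : represents s bc ee ->
  (forall y : 'I_6 -> C, (forall j, y j != 0) ->
    exists x : 'I_6 -> C, forall j : 'I_6, flag_at x (nth 0%N bc j) = y j) ->
  forall P, at_vars s P = 0 -> P = 0.
Proof.
move=> [sD _] solve_y P P0.
pose X i := mpolyX C (@mnm1 6 i).
pose H : mpoly 6 C := mmap (@mpolyC 6 C) (fun j : 'I_6 => flag_at X (nth 0%N bc j)) P.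
pose emb : {rmorphism mpoly 6 C -> KGB R} := @tofrac (mpoly 6 C).
have H0 : H = 0.
  apply/eqP; rewrite -tofrac_eq0 -[tofrac H]/(emb H) rmorph_mmap -P0.
  by apply/eqP; congr (mmap _ _ P); apply/funext => j /=; rewrite sD D_tofrac.
have : P * \prod_j X j = 0.
  apply: mpoly_vanishing => y; rewrite mevalM rmorph_prod /=.
  have [/forallP y0|] := boolP [forall j, y j != 0].
    have [x xy] := solve_y y y0.
    suff -> : meval y P = 0 by rewrite mul0r.
    transitivity (meval x H); last by rewrite H0 meval0.
    rewrite /H [RHS](rmorph_mmap (meval x : {rmorphism _ -> _})).
    have -> : y = meval x \o (fun j : 'I_6 => flag_at X (nth 0%N bc j)).
      by apply/funext => j /=; rewrite meval_flag_at xy.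
    by congr (mmap _ _ P); apply/funext => c /=; rewrite mevalC.
  rewrite negb_forall => /existsP [j /negPn /eqP yj].
  by rewrite (bigD1 j) //= mevalXU yj mul0r mulr0.
move/eqP; rewrite mulf_eq0 => /orP [/eqP //|].
rewrite prodf_seq_eq0 => /hasP [j _ /= /eqP Xj].
have := congr1 (mcoeff (mnm1 j)) Xj.
by rewrite mcoeffX eqxx mcoeff0 => /eqP; rewrite oner_eq0.
Qed.

(** The coordinates of U^- are D_2, D_3, D_13, D_4, D_14, D_124; D_4 is frozen, hence in the
    cluster, and the others have Laurent expansions in it. *)
Lemma seed_generate s bc ee (ex : nat -> seq (seq int)) : represents s bc ee ->
  drop 3 bc = [:: 9; 10; 11]%N ->
  (forall p, p \in [:: 0; 1; 2; 3; 6]%N ->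
    D p = \sum_(m <- ex p) laurent (fun j : 'I_6 => D (nth 0%N bc j)) (rowz m)) ->
  forall f, exists P Q, at_vars s Q != 0 /\ f = at_vars s P / at_vars s Q.
Proof.
move=> [sD _] bc3 De f; have [n [d [_ ->]]] := frac_repr f.
pose phi := at_vars_rmorphism s.
have cq j : is_quotient phi (cvar s j).
  by have := quotient_image phi (mpolyX _ (mnm1 j)); rewrite /phi /= mmapX mmap1U.
have Dq p : p \in [:: 0; 1; 2; 3; 6]%N -> is_quotient phi (D p).
  move=> /De ->; apply: quotient_sum => m; apply: quotient_laurent => j.
  by rewrite -sD.
have D11 : is_quotient phi (D 11).
  have := cq (inord 5); rewrite sD inordK //.
  by rewrite -[nth 0%N bc 5]/(nth 0%N bc (3 + 2)%N) -nth_drop bc3.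
apply: (@quotient_of_fractions _ _ phi _ (@tofrac (mpoly 6 C))) => [c|].
  by have := quotient_image phi (mpolyC 6 c); rewrite /phi /= mmapC.
move=> j; rewrite -[is_quotient _ _]/(is_quotient phi (coordU R j)).
rewrite -(inord_val j).
case: j => -[|[|[|[|[|[|//]]]]]] j6.
- exact: (Dq 0%N).
- exact: (Dq 1%N).
- exact: (Dq 2%N).
- exact: D11.
- exact: (Dq 3%N).
- exact: (Dq 6%N).
Qed.

End SeedCoordinates.

(** * The fourteen charts *)

Section ChartInverses.

Definition minor2z (A : seq (seq int)) i j k l : int :=
  nth 0 (nth [::] A i) k * nth 0 (nth [::] A j) l
  - nth 0 (nth [::] A i) l * nth 0 (nth [::] A j) k.

(* The inverse of a matrix [G B; 0 1] with 3 x 3 blocks and det G = 1 or -1. *)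
Definition inverse_of (A : seq (seq int)) : seq (seq int) :=
  let det := nth 0 (nth [::] A 0) 0 * minor2z A 1 2 1 2
    - nth 0 (nth [::] A 0) 1 * minor2z A 1 2 0 2
    + nth 0 (nth [::] A 0) 2 * minor2z A 1 2 0 1 in
  let others i := nth [::] [:: [:: 1; 2]; [:: 0; 2]; [:: 0; 1]]%N i in
  let sg i j : int := if odd (i + j) then -1 else 1 in
  let H := mkseq (fun i => mkseq (fun j => det * sg i j *
    minor2z A (nth 0%N (others j) 0) (nth 0%N (others j) 1)
              (nth 0%N (others i) 0) (nth 0%N (others i) 1)) 3) 3 in
  mkseq (fun i => mkseq (fun j =>
    if (i < 3)%N then
      if (j < 3)%N then nth 0 (nth [::] H i) j
      else - dotz 3 (nth [::] H i) (colz A j)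
    else (i == j)%:R) 6) 6.

(** Numbers 0 to 5 are the clusters of t_1 to t_6 and number 6 is that of t_0. Laurent expansions
    are tabulated for the first ten, which suffice for all facet inequalities; the covering by cones
    uses all fourteen. *)
Definition charts : seq (seq nat) :=
  [:: [:: 0; 8; 1];
      [:: 0; 8; 6];
      [:: 7; 8; 6];
      [:: 7; 8; 1];
      [:: 3; 4; 5];
      [:: 2; 4; 3];
      [:: 0; 4; 1];
      [:: 6; 0; 5];
      [:: 2; 7; 1];
      [:: 6; 7; 3];
      [:: 0; 4; 5];
      [:: 7; 3; 2];
      [:: 5; 3; 6];
      [:: 2; 1; 4]]%N.

Definition chart c : seq nat := nth [::] charts c ++ [:: 9; 10; 11]%N.

Lemma chartP c : (c < 14)%N ->
  [/\ size (chart c) = 6%N, all (fun p => p < 15)%N (chart c)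
    & drop 3 (chart c) = [:: 9; 10; 11]%N].
Proof. by do 14?[case: c => [//|c]]. Qed.

Lemma chart_uniq c : (c < 14)%N -> uniq (chart c).
Proof. by do 14?[case: c => [//|c]]. Qed.

Lemma chart_lt12 c : (c < 14)%N -> all (fun p => p < 12)%N (chart c).
Proof. by do 14?[case: c => [//|c]]. Qed.

End ChartInverses.

(** * Lower bound from the cluster monomials of one chart *)

Section ConeOfChart.
Variable R : realType.
Local Notation D p := (flag_at (@coordU R) p).
Variables (le : rel 'rV[int]_6) (v : KGB R -> 'rV[int]_6).
Hypothesis vP : is_valuation (@constU R) le v.
Variables (bc : seq nat) (W V : seq (seq int)).
Hypothesis size_bc : size bc = 6%N.
Hypothesis size_V : size V = 6%N.
Hypothesis bc_lt : all (fun p => p < 15)%N bc.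
Hypothesis valW : forall j : 'I_6, v (D (nth 0%N bc j)) = row j (mx_of_rows 6 6 W).
Hypothesis VW : inverse_rows V W.

Lemma evalf_col_form (g : 'rV[R]_6) (j : 'I_6) :
  evalf (col_form V j) g = (g *m map_mx intr (mx_of_rows 6 6 V)) 0 j.
Proof.
rewrite /evalf add0r mxE; apply: eq_bigr => i _.
by rewrite !mxE /= nth_colz mulrC.
Qed.

Lemma evalf_deg_form l (g : 'rV[R]_6) :
  evalf (deg_form V bc l) g = 2 - \sum_(j < 6) evalf (col_form V j) g
    * (nth 0%N (flag_deg (nth 0%N bc j)) l)%:R.
Proof.
rewrite /evalf /=; congr (_ + _); rewrite -sumrN.
under [RHS]eq_bigr => j _ do rewrite add0r mulr_suml -sumrN.
rewrite exchange_big /=; apply: eq_bigr => i _.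
rewrite (nth_map [::]) ?size_V // /dotz.
rewrite -(sumzE 6 (fun k => nth 0 (nth [::] V i) k
   * nth 0 [seq (nth 0%N (flag_deg p) l)%:Z | p <- bc] k)).
rewrite rmorphN rmorph_sum mulNr mulr_suml -sumrN; apply: eq_bigr => j _.
rewrite (nth_map 0%N) ?size_bc // rmorphM nth_colz /= -pmulrn.
by ring.
Qed.

(* The point g is approximated by the values of the monomials in the chart
   with exponents the integral parts of n times the coordinates of g. *)
Lemma cone_in_NObody (g : 'rV[R]_6) :
  (forall h, h \in chart_forms V bc -> 0 <= evalf h g) -> NObody v g.
Proof.
move=> g0; pose c (j : nat) := evalf (col_form V j) g.
have c_ge0 j : (j < 6)%N -> 0 <= c j.
  move=> j6; apply: g0; rewrite !mem_cat; have [j3|j3] := ltnP j 3.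
    by rewrite map_f // mem_iota.
  by rewrite [X in _ || (X || _)]map_f ?orbT // mem_iota j3.
have deg_le2 l : (l < 3)%N ->
    \sum_(j < 6) c j * (nth 0%N (flag_deg (nth 0%N bc j)) l)%:R <= 2.
  move=> l3; rewrite -subr_ge0 -evalf_deg_form; apply: g0.
  by rewrite !mem_cat [X in _ || (_ || X)]map_f ?orbT // mem_iota.
pose e (N j : nat) : nat := Num.truncn (N%:R * c j).
have e_le N j : (j < 6)%N -> (e N j)%:R <= N%:R * c j.
  by move=> j6; rewrite truncn_le mulr_ge0 ?c_ge0.
pose S N l := (\sum_(j < 6) e N j * nth 0 (flag_deg (nth 0 bc j)) l)%N.
have S_le N l : (l < 3)%N -> (S N l <= N.*2)%N.
  move=> l3; rewrite -(ler_nat R) /S natr_sum -muln2 natrM.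
  apply: le_trans (ler_wpM2l (ler0n _ N) (deg_le2 l l3)).
  rewrite mulr_sumr; apply: ler_sum => j _; rewrite natrM mulrA.
  by rewrite ler_wpM2r ?e_le.
(* Powers of the D_[i] supply the missing degree, so that the monomial is a section of the N-th
   power; being 1 on U^-, they do not affect its value. *)
pose mon N := [seq (nth 0%N bc j, e N j) | j <- iota 0 6]
  ++ [seq (12 + l, N.*2 - S N l)%N | l <- iota 0 3].
have mon_section N : nonzero_section N (flag_monomial R (mon N)).
  apply: monomial_nonzero_section => [|l l3].
    rewrite all_cat; apply/andP; split; last by [].
    apply/allP => t /mapP [j]; rewrite mem_iota => /= j6 ->.
    by rewrite (all_nthP 0%N bc_lt) ?size_bc.
  rewrite big_cat !big_map /=.
  have -> : (\sum_(j <- [:: 0; 1; 2; 3; 4; 5])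
      e N j * nth 0 (flag_deg (nth 0 bc j)) l = S N l)%N.
    by rewrite /S !big_ord_recl big_ord0 !big_cons big_nil.
  rewrite !big_cons big_nil.
  by have := S_le N l l3; case: l l3 => [|[|[|//]]] _ le2;
    rewrite /flag_deg /= ?muln0 ?muln1 ?addn0 ?add0n subnKC.
pose m N : 'rV[int]_6 := \row_j (e N j)%:Z.
have mon_val N k : v (section_ratio k (flag_monomial R (mon N)))
    = m N *m mx_of_rows 6 6 W.
  rewrite section_ratio_monomial big_cat !big_map.
  have DE p : (p < 15)%N -> flagvar p (generic_lower R) = D p.
    exact: generic_flagvar.
  have -> : \prod_(l <- iota 0 3) flagvar (12 + l, N.*2 - S N l)%N.1 (generic_lower R)
      ^+ (12 + l, N.*2 - S N l)%N.2 = 1.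
    by rewrite !big_cons big_nil /= !DE // !expr1n !mulr1.
  rewrite Monoid.mulm1; have -> : mx_of_rows 6 6 W = val_mx v (fun j : 'I_6 => D (nth 0%N bc j)).
    by apply/row_matrixP => j; rewrite rowK valW.
  have x0 (j : 'I_6) : D (nth 0%N bc j) != 0.
    by apply: D_neq0; rewrite (all_nthP 0%N bc_lt) ?size_bc.
  rewrite -(val_laurent vP _ x0); congr v.
  rewrite -[iota 0 6]/(index_iota 0 6) big_mkord; apply: eq_bigr => j _.
  by rewrite mxE -exprnP DE // (all_nthP 0%N bc_lt) ?size_bc.
(* Taking integral parts changes each of the six exponents by at most 1, so after division by n + 1
   the error is at most B / (n + 1). *)
pose B := \sum_(j < 6) \sum_(k < 6) `|(mx_of_rows 6 6 W j k)%:~R : R|.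
apply: (@closure_approx _ _ _ (fun n => n.+1%:R^-1 *: int_row R (m n.+1 *m mx_of_rows 6 6 W)) B).
  by move=> n; exists n.+1, (flag_monomial R (mon n.+1)); split; rewrite // mon_val.
move=> n k.
have gE : g = (\row_j c j) *m map_mx intr (mx_of_rows 6 6 W).
  have -> : \row_j c j = g *m map_mx intr (mx_of_rows 6 6 V).
    by apply/rowP => j; rewrite mxE -evalf_col_form.
  by rewrite -mulmxA -map_mxM (inverse_rowsP VW) map_mx1 mulmx1.
rewrite {1}gE !mxE rmorph_sum mulr_sumr -sumrB.
apply: le_trans (ler_norm_sum _ _ _) _; rewrite /B mulr_suml; apply: ler_sum => j _.
rewrite mulr_suml (bigD1 k) //= -[leLHS]addr0; apply: lerD; last first.
  by apply: sumr_ge0 => i _; rewrite mulr_ge0 // invr_ge0 ler0n.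
rewrite !mxE rmorphM /= -pmulrn mulrA -mulrBl normrM mulrC ler_wpM2l //.
have N0 : 0 < n.+1%:R :> R by rewrite ltr0n.
rewrite -[leRHS]mul1r ler_pdivlMr // -{2}(gtr0_norm N0) -normrM mulrBl.
rewrite mulrAC mulVf ?lt0r_neq0 // mul1r.
have /andP [le1 lt1] : (e n.+1 j)%:R <= n.+1%:R * c j < (e n.+1 j).+1%:R.
  by apply: truncn_itv; rewrite mulr_ge0 ?c_ge0.
rewrite ger0_norm mulrC ?subr_ge0 // lerBlDl.
by rewrite natr1; apply: ltW.
Qed.

End ConeOfChart.

(** * Newton-Okounkov bodies from certificates *)

Section Description.

(** The constant undoes the translation: for the column u the form is 1 + <g - (0, 0, 0, 1, 1, 1),
    u>. *)
Definition facet_form (rows : seq (seq int)) j : seq int :=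
  (1 - (nth 0 (colz rows j) 3 + nth 0 (colz rows j) 4 + nth 0 (colz rows j) 5))
  :: colz rows j.

Definition facet_forms n rows : seq (seq int) := [seq facet_form rows j | j <- iota 0 n].

Definition unit_values (bc : seq nat) : seq (seq int) :=
  foldr (fun j vals => set_nth [::] vals (nth 0%N bc j) (mkseq (fun k => (k == j)%:R) 6))
    [::] (iota 0 6).

Definition rows_of (vals : seq (seq int)) (bc : seq nat) := [seq nth [::] vals p | p <- bc].

(* The point w.2 / w.1 is on the j-th facet only. *)
Definition witness_ok n rows j (w : nat * seq int) : bool :=
  (0 < w.1)%N && all (fun l =>
    let z := (w.1)%:Z * nth 0 (facet_form rows l) 0 + dotz 6 (colz rows l) w.2 in
    if l == j then z == 0 else 0 < z) (iota 0 n).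

(** The fourth conjunct recognizes each facet inequality as an upper bound from one of the ten
    charts with expansions; the sixth covers the polytope by the cones of all charts. The fifth says
    that 0 satisfies the inequalities, which takes care of the default value of [vseed]. *)
Definition checks bc ee steps cov wit n rows : bool :=
  let vals := run_steps (unit_values bc) steps in
  let W c := rows_of vals (chart c) in
  let V c := inverse_of (W c) in
  [&& steps_ok ee (unit_values bc) steps,
      all (known vals) (iota 0 12),
      all (fun c => inverse_rows (W c) (V c) && inverse_rows (V c) (W c)) (iota 0 14),
      all (fun h => has (fun c => h \in upper_forms (V c) (chart c)) (iota 0 10))
        (facet_forms n rows),
      all (fun h => 0 <= nth 0 h 0) (facet_forms n rows),
      fan_cover_ok (fun c => chart_forms (V c) (chart c)) (facet_forms n rows) cov,
      all (fun j => has (fun i => absz (nth 0 (colz rows j) i) == 1%N) (iota 0 6)) (iota 0 n)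
    & all (fun j => witness_ok n rows j (nth (0%N, [::]) wit j)) (iota 0 n)].

Variable R : realType.
Local Notation C := R[i].
Local Notation D p := (flag_at (@coordU R) p).
Local Notation u rows n j := (int_col R (col j (mx_of_rows 6 n rows))).

Definition facet_bound rows j : R := - (nth 0 (facet_form rows j) 0)%:~R.

Lemma evalf_facet n rows (j : 'I_n) (g : 'rV[R]_6) :
  evalf (facet_form rows j) g = pairing g (u rows n j) - facet_bound rows j.
Proof.
rewrite /evalf /facet_bound opprK addrC pairingE; congr (_ + _).
by apply: eq_bigr => i _; rewrite !mxE [nth _ _ _.+1]nth_colz mulrC.
Qed.

Lemma evalf_scaled f k (w : 'rV[int]_6) : (0 < k)%N ->
  evalf f (k%:R^-1 *: int_row R w) = k%:R^-1 * (evalz k f w)%:~R.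
Proof.
move=> k0; have k0' : k%:R != 0 :> R by rewrite pnatr_eq0 -lt0n.
rewrite /evalf /evalz rmorphD rmorphM mulrDr mulrA /= -pmulrn mulVf // mul1r.
congr (_ + _); rewrite rmorph_sum mulr_sumr; apply: eq_bigr => i _.
by rewrite rmorphM !mxE mulrCA.
Qed.

(** No quotient of nonzero elements equals 0, so [xget] returns its default pair (0, 0). *)
Lemma vseed0 (s : seed R) le : vseed s le 0 = 0.
Proof.
rewrite /vseed; case: xgetP => [[P Q] _ [P0 Q0 /esym /eqP]|_] /=; last by rewrite subrr.
by rewrite mulf_eq0 invr_eq0 (negPf P0) (negPf Q0).
Qed.

Lemma unit_values_ok (s : seed R) le bc :
  size bc = 6%N -> uniq bc -> (forall j : 'I_6, vseed s le (D (nth 0%N bc j)) = delta_mx 0 j) ->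
  values_ok (vseed s le) (@coordU R) (unit_values bc).
Proof.
move=> sbc ubc bcv p /andP [_]; rewrite /unit_values.
have : {subset iota 0 6 <= iota 0 6} by [].
elim: {1 3 4}(iota 0 6) => [|j l IH] /= sub; first by rewrite nth_nil.
rewrite nth_set_nth /=; have [-> _|_] := eqVneq p; last first.
  by apply: IH => k kl; apply: sub; rewrite inE kl orbT.
have j6 : (j < 6)%N.
  by have : j \in iota 0 6 := sub j (mem_head _ _); rewrite mem_iota.
rewrite (bcv (Ordinal j6)) rowz_mkseq; apply/rowP => k.
by rewrite !mxE eqxx.
Qed.

Variables (s : seed R) (le : rel 'rV[int]_6).
Variables (b : nat) (ee : seq (seq int)) (steps : seq value_step) (cov : fan_cover).
Variables (wit : seq (nat * seq int)) (n : nat) (rows : seq (seq int)).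
Variable ex : nat -> nat -> seq (seq int).
Hypothesis expansions : forall (K : fieldType) (x : 'I_6 -> K) c p, (c < 10)%N ->
  (forall p, (p < 15)%N -> flag_at x p != 0) ->
  p \in [:: 0; 1; 2; 3; 5; 6; 7]%N ->
  flag_at x p = \sum_(m <- ex c p)
    laurent (fun j : 'I_6 => flag_at x (nth 0%N (chart c) j)) (rowz m).
Hypothesis expansions_ok : forall c p, (c < 10)%N -> p \in [:: 0; 1; 2; 3; 5; 6; 7]%N ->
  exponents_ok (chart c) p (ex c p).
Hypothesis b_lt : (b < 10)%N.
Hypothesis s_rep : represents s (chart b) ee.
Hypothesis s_solve : forall y : 'I_6 -> C, (forall j, y j != 0) ->
  exists x : 'I_6 -> C, forall j : 'I_6, flag_at x (nth 0%N (chart b) j) = y j.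
Hypothesis le_adapted : adapted_order (exch s) le.
Hypothesis checked : checks (chart b) ee steps cov wit n rows.

Local Notation v := (vseed s le).
Local Notation N := (mx_of_rows 6 n rows).
Local Notation vals := (run_steps (unit_values (chart b)) steps).
Local Notation W c := (rows_of vals (chart c)).
Local Notation V c := (inverse_of (W c)).

Let s_free : forall P, at_vars s P = 0 -> P = 0 := seed_free s_rep s_solve.

Lemma seed_vars_generate f : exists P Q, at_vars s Q != 0 /\ f = at_vars s P / at_vars s Q.
Proof.
have b14 : (b < 14)%N by apply: ltn_trans b_lt _.
have [_ _ b3] := chartP b14.
apply: (seed_generate s_rep b3 (ex := ex b)) => p pP.
apply: (expansions b_lt (@D_neq0 R)).
by move: pP; rewrite !inE => /or4P [/eqP ->|/eqP ->|/eqP ->|/orP [] /eqP ->].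
Qed.

Lemma seed_valuation : is_valuation (@constU R) le v.
Proof. exact: vseed_valuation le_adapted s_free seed_vars_generate. Qed.

Lemma seed_values : values_ok v (@coordU R) vals.
Proof.
have b14 : (b < 14)%N by apply: ltn_trans b_lt _.
have [sb _ _] := chartP b14.
have [sD sE] := s_rep.
apply: (run_steps_ok seed_valuation (ee := ee)).
- by case: le_adapted => _ _ _ _; rewrite sE.
- exact: D_neq0.
- by case/and5P: checked.
apply: unit_values_ok => [||j]; [exact: sb|exact: chart_uniq|].
rewrite -sD; apply: vseed_cvar; [exact: le_adapted|exact: s_free].
Qed.

Lemma chart_values c (j : 'I_6) : (c < 14)%N ->
  v (D (nth 0%N (chart c) j)) = row j (mx_of_rows 6 6 (W c)).
Proof.
move=> c14; have [sc _ _] := chartP c14.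
have cp : (nth 0%N (chart c) j < 12)%N.
  by apply: (all_nthP 0%N (chart_lt12 c14)); rewrite sc.
have /and3P [_ /allP kn _] := checked.
rewrite seed_values; last by apply: kn; rewrite mem_iota.
by apply/rowP => k; rewrite !mxE (nth_map 0%N) ?sc.
Qed.

Lemma chart_inverse c : (c < 14)%N -> inverse_rows (W c) (V c) && inverse_rows (V c) (W c).
Proof.
by move=> c14; have /and4P [_ _ /allP inv _] := checked; apply: inv; rewrite mem_iota.
Qed.

Definition described_set : set 'rV[R]_6 :=
  [set g | forall j : 'I_n, facet_bound rows j <= pairing g (u rows n j)].

Lemma facet_form_in (j : 'I_n) : facet_form rows j \in facet_forms n rows.
Proof. by apply: map_f; rewrite mem_iota /= add0n. Qed.

Lemma described_setP g :
  described_set g <-> forall h, h \in facet_forms n rows -> 0 <= evalf h g.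
Proof.
split=> [Pg h /mapP [j]|h0 j].
  rewrite mem_iota => /= jn ->; rewrite (evalf_facet rows (Ordinal jn)) subr_ge0.
  exact: Pg.
by rewrite -subr_ge0 -evalf_facet; apply/h0/facet_form_in.
Qed.

Lemma value_in_described k F : is_section k F -> forall h, h \in facet_forms n rows ->
  0 <= evalz k h (v (section_ratio k F)).
Proof.
move=> Fk h hP; have [-> |f0] := eqVneq (section_ratio k F) 0.
  (* The default value 0 satisfies every inequality because the constants are nonnegative, so it
     need not be shown that a nonzero section has a nonzero restriction to U^-. *)
  rewrite vseed0 /evalz big1 ?addr0; last by move=> i _; rewrite mxE mulr0.
  have /and5P [_ _ _ _ /andP [/allP c0 _]] := checked.
  by rewrite mulr_ge0 // c0.
have /and4P [_ _ _ /andP [/allP up _]] := checked.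
have /hasP [c] := up h hP; rewrite mem_iota => /= c10 hc.
have c14 : (c < 14)%N by apply: ltn_trans c10 _.
have [sc cl c3] := chartP c14; have /andP [WV VW] := chart_inverse c14.
have le_total : total le by case: le_adapted.
have hl (M : 'M[KGB R]_4) (i : 'I_(4 * 4)) : exists r t, mxvec M 0 i = M r t.
  by case/mxvec_indexP: i => r t; exists r, t; rewrite mxvecE.
apply: (val_upper_forms le_total seed_valuation (@D_neq0 R) sc _ cl c3 _ WV _
  (hl (low (@coordU R))) _ (hl (opposite (@coordU R))) _ f0 hc) => //.
- by move=> j; apply: chart_values.
- move=> p pP; split; first exact: expansions_ok.
  exact: (expansions c10 (@D_neq0 R) pP).
- by rewrite section_ratioE generic_lowerE.
- exact: section_ratio_opposite.
Qed.

Lemma DeltaE : Delta s le = described_set.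
Proof.
apply/seteqP; split=> g.
  move=> gD j; apply: closure_ge gD => x [k [F [k0 [Fk _] ->]]].
  rewrite -subr_ge0 -evalf_facet evalf_scaled // mulr_ge0 ?invr_ge0 ?ler0n //.
  by rewrite ler0z; apply/value_in_described/facet_form_in.
move=> /described_setP g0.
have /and5P [_ _ _ _ /and3P [_ covP _]] := checked.
have [c c14 cg] := fan_cover_okP covP g0.
have [sc cl c3] := chartP c14; have /andP [WV VW] := chart_inverse c14.
apply: (cone_in_NObody seed_valuation sc _ cl _ VW cg); first by rewrite size_mkseq.
by move=> j; apply: chart_values.
Qed.

Definition translation : 'rV[int]_6 := rowz [:: 0; 0; 0; -1; -1; -1].

Lemma pairing_translation (j : 'I_n) : pairing (int_row R translation) (u rows n j) = -1 - facet_bound rows j.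
Proof.
rewrite /facet_bound opprK pairingE !big_ord_recl big_ord0 !mxE /=.
rewrite !nth_colz !rmorphB !rmorphD /= !rmorph0 !rmorphN !rmorph1.
by ring.
Qed.

Lemma described : described_by (Delta s le) N.
Proof.
rewrite DeltaE; split.
  exists translation; apply/seteqP; split=> [_ [g Pg <-] j|x Nx].
    by rewrite pairingD pairing_translation; have := Pg j; lra.
  exists (x - int_row R translation); last by rewrite subrK.
  by move=> j; rewrite pairingB pairing_translation; have := Nx j; lra.
have /and5P [_ _ _ _ /and3P [_ _ /andP [/allP units /allP wits]]] := checked.
have io (j : 'I_n) : (j : nat) \in iota 0 n by rewrite mem_iota /=.
pose w (j : 'I_n) := nth (0%N, [::]) wit j.
pose p (j : 'I_n) : 'rV[R]_6 := (w j).1%:R^-1 *: int_row R (rowz (w j).2).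
have w_pos j : (0 < (w j).1)%N by have /andP [] := wits _ (io j).
have evalp j l : evalf (facet_form rows l) (p j) = (w j).1%:R^-1 *
    ((w j).1%:Z * nth 0 (facet_form rows l) 0 + dotz 6 (colz rows l) (w j).2)%:~R.
  rewrite evalf_scaled //; congr (_ * _%:~R); rewrite /evalz; congr (_ + _).
  rewrite /dotz -(sumzE 6 (fun k => nth 0 (colz rows l) k * nth 0 (w j).2 k)).
  by apply: eq_bigr => k _; rewrite mxE.
have inv_pos j : 0 < (w j).1%:R^-1 :> R by rewrite invr_gt0 ltr0n.
apply: (@columns_of_inequalities R n N (fun j => facet_bound rows j) (- int_row R translation) p).
(* At the interior point (0, 0, 0, 1, 1, 1) every facet form equals 1. *)
- move=> j; rewrite -[- _]sub0r pairingB pairing0 pairing_translation; lra.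
- move=> j; apply/eqP; rewrite -subr_eq0 -evalf_facet evalp.
  have /andP [_ /allP /(_ _ (io j))] := wits _ (io j).
  by rewrite eqxx => /eqP ->; rewrite mulr0.
- move=> j l lj; rewrite -subr_gt0 -evalf_facet evalp pmulr_rgt0 // ltr0z.
  have /andP [_ /allP /(_ _ (io l))] := wits _ (io j).
  by rewrite -[_ == _]/(l == j) (negPf lj).
- move=> j; have := units _ (io j); case/hasP => i.
  rewrite mem_iota => /= i6 /eqP e; exists (Ordinal i6).
  by rewrite mxE -nth_colz.
Qed.

End Description.

(** * Laurent expansions *)

Section Expansions.

(** The flag minors, other than D_4, that occur as entries of [low] or, other than D_1, as
    numerators in [opposite_mx]. *)
Definition expanded : seq nat := [:: 0; 1; 2; 3; 5; 6; 7]%N.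

(* Exponents of the Laurent expansions in the charts 0 to 9 of the variables
   listed in expanded; all the coefficients are 1. *)
Definition expansion_table : seq (seq (seq (seq int))) := [::
  [:: [:: [:: 1; 0; 0; 0; 0; 0]];
      [:: [:: 0; 0; 1; 0; 0; 0]];
      [:: [:: 0; - 1; 0; 0; 1; 0]; [:: - 1; 0; 1; 0; 0; 0]; [:: - 1; - 1; 1; 1; 0; 0]];
      [:: [:: 0; 0; - 1; 0; 1; 0]; [:: 0; - 1; - 1; 0; 1; 1]; [:: - 1; 0; 0; 0; 0; 1];
          [:: - 1; - 1; 0; 1; 0; 1]];
      [:: [:: 1; 0; - 1; 0; 1; 0]; [:: 1; - 1; - 1; 0; 1; 1]; [:: 0; - 1; 0; 1; 0; 1]];
      [:: [:: 0; 1; - 1; 0; 0; 0]; [:: 0; 0; - 1; 0; 0; 1]];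
      [:: [:: - 1; 1; 0; 0; 0; 0]; [:: - 1; 0; 0; 1; 0; 0]]];
  [:: [:: [:: 1; 0; 0; 0; 0; 0]];
      [:: [:: 0; 1; - 1; 0; 0; 0]; [:: 0; 0; - 1; 0; 0; 1]];
      [:: [:: 0; - 1; 0; 0; 1; 0]; [:: - 1; 1; - 1; 0; 0; 0]; [:: - 1; 0; - 1; 1; 0; 0];
          [:: - 1; 0; - 1; 0; 0; 1]; [:: - 1; - 1; - 1; 1; 0; 1]];
      [:: [:: 0; - 1; 1; 0; 1; 0]; [:: - 1; 0; 0; 0; 0; 1]; [:: - 1; - 1; 0; 1; 0; 1]];
      [:: [:: 1; - 1; 1; 0; 1; 0]; [:: 0; - 1; 0; 1; 0; 1]];
      [:: [:: 0; 0; 1; 0; 0; 0]];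
      [:: [:: - 1; 1; 0; 0; 0; 0]; [:: - 1; 0; 0; 1; 0; 0]]];
  [:: [:: [:: - 1; 1; 0; 0; 0; 0]; [:: - 1; 0; 0; 1; 0; 0]];
      [:: [:: 0; 1; - 1; 0; 0; 0]; [:: 0; 0; - 1; 0; 0; 1]];
      [:: [:: 1; 0; - 1; 0; 0; 0]; [:: 1; - 1; - 1; 0; 0; 1]; [:: 0; - 1; 0; 0; 1; 0]];
      [:: [:: 1; - 1; 0; 0; 0; 1]; [:: 0; - 1; 1; 0; 1; 0]];
      [:: [:: 0; - 1; 0; 1; 0; 1]; [:: - 1; 0; 1; 0; 1; 0]; [:: - 1; - 1; 1; 1; 1; 0]];
      [:: [:: 0; 0; 1; 0; 0; 0]];
      [:: [:: 1; 0; 0; 0; 0; 0]]];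
  [:: [:: [:: - 1; 1; 0; 0; 0; 0]; [:: - 1; 0; 0; 1; 0; 0]];
      [:: [:: 0; 0; 1; 0; 0; 0]];
      [:: [:: 1; - 1; 1; 0; 0; 0]; [:: 0; - 1; 0; 0; 1; 0]];
      [:: [:: 1; - 1; 0; 0; 0; 1]; [:: 0; 0; - 1; 0; 1; 0]; [:: 0; - 1; - 1; 0; 1; 1]];
      [:: [:: 0; - 1; 0; 1; 0; 1]; [:: - 1; 1; - 1; 0; 1; 0]; [:: - 1; 0; - 1; 1; 1; 0];
          [:: - 1; 0; - 1; 0; 1; 1]; [:: - 1; - 1; - 1; 1; 1; 1]];
      [:: [:: 0; 1; - 1; 0; 0; 0]; [:: 0; 0; - 1; 0; 0; 1]];
      [:: [:: 1; 0; 0; 0; 0; 0]]];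
  [:: [:: [:: - 1; 0; 1; 0; 0; 0]; [:: - 1; 0; 0; 0; 0; 1]];
      [:: [:: 0; 1; - 1; 0; 0; 1]; [:: - 1; 0; 0; 0; 1; 0]; [:: - 1; 0; - 1; 0; 1; 1]];
      [:: [:: 1; 1; - 1; 0; 0; 0]; [:: 0; 0; - 1; 0; 1; 0]];
      [:: [:: 1; 0; 0; 0; 0; 0]];
      [:: [:: 0; 0; 1; 0; 0; 0]];
      [:: [:: 0; - 1; 1; 0; 0; 0]; [:: 0; - 1; 0; 1; 0; 0]];
      [:: [:: 1; 0; - 1; 1; 0; 0]; [:: 0; - 1; 0; 0; 1; 0]; [:: 0; - 1; - 1; 1; 1; 0]]];
  [:: [:: [:: 0; 0; - 1; 0; 0; 1]; [:: - 1; 1; 0; 0; 0; 0]; [:: - 1; 0; - 1; 0; 1; 0]];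
      [:: [:: 1; 0; - 1; 0; 0; 1]; [:: 0; 0; - 1; 0; 1; 0]];
      [:: [:: 1; 0; 0; 0; 0; 0]];
      [:: [:: 0; 0; 1; 0; 0; 0]];
      [:: [:: - 1; 1; 1; 0; 0; 0]; [:: - 1; 0; 0; 0; 1; 0]];
      [:: [:: 0; - 1; 0; 1; 0; 0]; [:: - 1; 0; 1; 0; 0; 0]; [:: - 1; - 1; 0; 0; 1; 0]];
      [:: [:: 1; - 1; 0; 1; 0; 0]; [:: 0; - 1; 0; 0; 1; 0]]];
  [:: [:: [:: 1; 0; 0; 0; 0; 0]];
      [:: [:: 0; 0; 1; 0; 0; 0]];
      [:: [:: - 1; 1; 0; 0; 0; 0]; [:: - 1; 0; 1; 0; 0; 0]];
      [:: [:: 0; 0; - 1; 0; 1; 0]; [:: - 1; 1; - 1; 0; 0; 1]; [:: - 1; 0; 0; 0; 0; 1]];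
      [:: [:: 1; 0; - 1; 0; 1; 0]; [:: 0; 1; - 1; 0; 0; 1]];
      [:: [:: 1; - 1; - 1; 0; 1; 0]; [:: 0; 0; - 1; 0; 0; 1]; [:: 0; - 1; 0; 1; 0; 0]];
      [:: [:: 0; - 1; 0; 0; 1; 0]; [:: - 1; 0; 0; 1; 0; 0]; [:: - 1; - 1; 1; 1; 0; 0]]];
  [:: [:: [:: 0; 1; 0; 0; 0; 0]];
      [:: [:: 0; 1; - 1; 0; 1; 0]; [:: - 1; 0; 0; 0; 0; 1]; [:: - 1; 0; - 1; 1; 0; 1]];
      [:: [:: 0; 0; - 1; 0; 1; 0]; [:: - 1; - 1; 1; 0; 0; 0]; [:: - 1; - 1; 0; 1; 0; 0];
          [:: - 1; - 1; 0; 0; 0; 1]; [:: - 1; - 1; - 1; 1; 0; 1]];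
      [:: [:: 0; - 1; 1; 0; 0; 0]; [:: 0; - 1; 0; 0; 0; 1]];
      [:: [:: 0; 0; 1; 0; 0; 0]];
      [:: [:: 1; 0; 0; 0; 0; 0]];
      [:: [:: 1; 0; - 1; 0; 1; 0]; [:: 0; - 1; 0; 1; 0; 0]; [:: 0; - 1; - 1; 1; 0; 1]]];
  [:: [:: [:: 0; - 1; 0; 1; 0; 0]; [:: - 1; 0; 1; 0; 0; 0]; [:: - 1; - 1; 0; 0; 1; 0]];
      [:: [:: 0; 0; 1; 0; 0; 0]];
      [:: [:: 1; 0; 0; 0; 0; 0]];
      [:: [:: 1; 0; - 1; 0; 0; 1]; [:: 0; 0; - 1; 0; 1; 0]];
      [:: [:: 1; - 1; - 1; 1; 0; 1]; [:: 0; - 1; - 1; 1; 1; 0];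
          [:: 0; - 1; - 1; 0; 1; 1]; [:: - 1; 0; 0; 0; 1; 0]; [:: - 1; - 1; - 1; 0; 2; 0]];
      [:: [:: 0; 0; - 1; 0; 0; 1]; [:: - 1; 1; 0; 0; 0; 0]; [:: - 1; 0; - 1; 0; 1; 0]];
      [:: [:: 0; 1; 0; 0; 0; 0]]];
  [:: [:: [:: 1; - 1; - 1; 0; 1; 0]; [:: 0; 0; - 1; 0; 0; 1]; [:: 0; - 1; 0; 1; 0; 0]];
      [:: [:: 0; 0; - 1; 0; 1; 0]; [:: - 1; 1; - 1; 0; 0; 1]; [:: - 1; 0; 0; 0; 0; 1]];
      [:: [:: - 1; 1; 0; 0; 0; 0]; [:: - 1; 0; 1; 0; 0; 0]];
      [:: [:: 0; 0; 1; 0; 0; 0]];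
      [:: [:: 1; - 1; 0; 0; 1; 0]; [:: 0; - 1; 1; 1; 0; 0]];
      [:: [:: 1; 0; 0; 0; 0; 0]];
      [:: [:: 0; 1; 0; 0; 0; 0]]]].

Definition expansion c p : seq (seq int) :=
  nth [::] (nth [::] expansion_table c) (index p expanded).

Lemma expansion_ok c p : (c < 10)%N -> p \in expanded ->
  exponents_ok (chart c) p (expansion c p).
Proof.
move=> c10 pP.
have /allP /(_ c) : all (fun c => all (fun p =>
    exponents_ok (chart c) p (expansion c p)) expanded) (iota 0 10) by vm_compute.
by rewrite mem_iota => /(_ c10) /allP /(_ p pP).
Qed.

Section Field.
Variables (K : fieldType).

Lemma laurent_rowzE (y : nat -> K) m : laurent (fun j : 'I_6 => y j) (rowz m) =
  y 0%N ^ nth 0 m 0 * (y 1%N ^ nth 0 m 1 * (y 2%N ^ nth 0 m 2 * (y 3%N ^ nth 0 m 3 *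
  (y 4%N ^ nth 0 m 4 * y 5%N ^ nth 0 m 5)))).
Proof. by rewrite /laurent !big_ord_recl big_ord0 !mxE mulr1. Qed.

Variable x : 'I_6 -> K.
Hypothesis x_neq0 : forall p, (p < 15)%N -> flag_at x p != 0.

Definition expands c p := flag_at x p = \sum_(m <- expansion c p)
  laurent (fun j : 'I_6 => flag_at x (nth 0%N (chart c) j)) (rowz m).

Local Ltac expand_tac :=
  rewrite /expands (eq_bigr _ (fun m _ =>
    laurent_rowzE (fun j => flag_at x (nth 0%N (chart _) j)) m));
  rewrite /expansion /= ?big_cons big_nil /exprz /= ?expr0 ?expr1 /flag_at /=;
  have := x_neq0 (isT : 0 < 15)%N; have := x_neq0 (isT : 1 < 15)%N;
  have := x_neq0 (isT : 2 < 15)%N; have := x_neq0 (isT : 3 < 15)%N;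
  have := x_neq0 (isT : 4 < 15)%N; have := x_neq0 (isT : 5 < 15)%N;
  have := x_neq0 (isT : 6 < 15)%N; have := x_neq0 (isT : 7 < 15)%N;
  have := x_neq0 (isT : 8 < 15)%N; have := x_neq0 (isT : 9 < 15)%N;
  have := x_neq0 (isT : 10 < 15)%N; have := x_neq0 (isT : 11 < 15)%N;
  rewrite /flag_at /=;
  move: (x (inord 0)) (x (inord 1)) (x (inord 2)) (x (inord 3)) (x (inord 4)) (x (inord 5));
  move=> a b c d e f ? ? ? ? ? ? ? ? ? ? ? ?; field; by do ?[apply/andP; split].

Lemma expands0 p : p \in expanded -> expands 0 p.
Proof. by rewrite !inE; do 6?[case/orP]; move=> /eqP ->; expand_tac. Qed.

Lemma expands1 p : p \in expanded -> expands 1 p.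
Proof. by rewrite !inE; do 6?[case/orP]; move=> /eqP ->; expand_tac. Qed.

Lemma expands2 p : p \in expanded -> expands 2 p.
Proof. by rewrite !inE; do 6?[case/orP]; move=> /eqP ->; expand_tac. Qed.

Lemma expands3 p : p \in expanded -> expands 3 p.
Proof. by rewrite !inE; do 6?[case/orP]; move=> /eqP ->; expand_tac. Qed.

Lemma expands4 p : p \in expanded -> expands 4 p.
Proof. by rewrite !inE; do 6?[case/orP]; move=> /eqP ->; expand_tac. Qed.

Lemma expands5 p : p \in expanded -> expands 5 p.
Proof. by rewrite !inE; do 6?[case/orP]; move=> /eqP ->; expand_tac. Qed.

Lemma expands6 p : p \in expanded -> expands 6 p.
Proof. by rewrite !inE; do 6?[case/orP]; move=> /eqP ->; expand_tac. Qed.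

Lemma expands7 p : p \in expanded -> expands 7 p.
Proof. by rewrite !inE; do 6?[case/orP]; move=> /eqP ->; expand_tac. Qed.

Lemma expands8 p : p \in expanded -> expands 8 p.
Proof. by rewrite !inE; do 6?[case/orP]; move=> /eqP ->; expand_tac. Qed.

Lemma expands9 p : p \in expanded -> expands 9 p.
Proof. by rewrite !inE; do 6?[case/orP]; move=> /eqP ->; expand_tac. Qed.

Lemma expandsP c p : (c < 10)%N -> p \in expanded -> expands c p.
Proof.
case: c => [|[|[|[|[|[|[|[|[|[|//]]]]]]]]]] _.
- exact: expands0.
- exact: expands1.
- exact: expands2.
- exact: expands3.
- exact: expands4.
- exact: expands5.
- exact: expands6.
- exact: expands7.
- exact: expands8.
- exact: expands9.
Qed.

End Field.
End Expansions.

Section Solutions.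
Variable K : fieldType.

Lemma chart_solvable c (y : 'I_6 -> K) : (c < 6)%N -> (forall j, y j != 0) ->
  exists x : 'I_6 -> K, forall j : 'I_6, flag_at x (nth 0%N (chart c) j) = y j.
Proof.
move=> c6 y0; pose L p := \sum_(m <- expansion c p) laurent y (rowz m).
exists (fun i : 'I_6 => nth 0 [:: L 0; L 1; L 2; y (inord 5); L 3; L 6]%N i).
have yE (i : 'I_6) : y i = y (inord i) by rewrite inord_val.
have LE p : L p = \sum_(m <- expansion c p)
    (y (inord 0) ^ nth 0 m 0 * (y (inord 1) ^ nth 0 m 1 * (y (inord 2) ^ nth 0 m 2 *
    (y (inord 3) ^ nth 0 m 3 * (y (inord 4) ^ nth 0 m 4 * y (inord 5) ^ nth 0 m 5))))).
  apply: eq_bigr => m _; rewrite -(laurent_rowzE (fun j => y (inord j))).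
  by apply: eq_bigr => i _; rewrite -yE.
move=> j; rewrite [RHS]yE /flag_at !inordK //= !LE /expansion.
move: (y0 (inord 0)) (y0 (inord 1)) (y0 (inord 2)) (y0 (inord 3)) (y0 (inord 4)) (y0 (inord 5)).
case: c c6 {L LE} => [|[|[|[|[|[|//]]]]]] _; case: j => [[|[|[|[|[|[|//]]]]]] ?];
  rewrite /= ?big_cons ?big_nil /exprz /= ?expr0 ?expr1;
  move: (y (inord 0)) (y (inord 1)) (y (inord 2)) (y (inord 3)) (y (inord 4)) (y (inord 5));
  move=> y0' y1 y2 y3 y4 y5 ? ? ? ? ? ?; (try by []); field; by do ?[apply/andP; split].
Qed.

End Solutions.

(** * Mutation of seeds given by explicit data *)

Section Mutations.

Definition pos_part (z : int) : nat := if z is Posz n then n else 0%N.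

Definition mutate_rows k (ee : seq (seq int)) : seq (seq int) :=
  let e i j := nth 0 (nth [::] ee i) j in
  mkseq (fun i => mkseq (fun j => if (i == k) || (j == k) then - e i j
    else e i j + Num.sg (e i k) * posp (e i k * e k j)) 6) 3.

(** Natural exponents keep the exchange relations polynomial, hence provable by [ring] over any
    commutative ring. *)
Definition monomial_at (S : comNzRingType) (x : 'I_6 -> S) (bc : seq nat) (r : seq int) : S :=
  \prod_(j < 6) flag_at x (nth 0%N bc j) ^+ pos_part (nth 0 r j).

Definition exchanged (S : comNzRingType) (x : 'I_6 -> S) bc (r : seq int) p q : Prop :=
  flag_at x p * flag_at x q
    = monomial_at x bc r + monomial_at x bc [seq - z | z <- r].

Variable R : realType.
Local Notation u := (@coordU R).

Lemma exprz_posp (K : fieldType) (a : K) z : a ^ posp z = a ^+ pos_part z.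
Proof. by case: z => n //; rewrite /posp max_l. Qed.

Lemma mutate_represents k (s : seed R) bc ee q : (k < 3)%N -> size bc = 6%N ->
  all (fun p => p < 15)%N bc -> all (fun r => size r == 6%N) ee -> size ee = 3%N ->
  exchanged u bc (nth [::] ee k) (nth 0%N bc k) q ->
  represents s bc ee -> represents (mu k.+1 s) (set_nth 0%N bc k q) (mutate_rows k ee).
Proof.
move=> k3 sbc bc_lt /allP rows6 see exch_q [sD sE]; rewrite /mu /=; split=> [i|]; last first.
  apply/matrixP => i j; rewrite !mxE !sE !mxE !nth_mkseq //=.
  by rewrite -val_eqE -[j == _]val_eqE /= inordK.
rewrite /= nth_set_nth /= -val_eqE /= inordK //; case: eqP => [ik|_]; last exact: sD.
have Dk : flag_at u (nth 0%N bc k) != 0.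
  by apply: D_neq0; apply: (all_nthP 0%N bc_lt); rewrite sbc (ltn_trans k3).
have kk : nat_of_ord (inord k : 'I_3) = k by rewrite inordK.
have r6 : size (nth [::] ee k) = 6%N by apply/eqP/rows6/mem_nth; rewrite see.
have e1 : \prod_j cvar s j ^ posp (exch s (inord k) j) = monomial_at u bc (nth [::] ee k).
  by apply: eq_bigr => j _; rewrite sE mxE kk sD exprz_posp.
have e2 : \prod_j cvar s j ^ posp (- exch s (inord k) j)
    = monomial_at u bc [seq - z | z <- nth [::] ee k].
  by apply: eq_bigr => j _; rewrite sE mxE kk sD exprz_posp (nth_map 0) ?r6.
rewrite sD ik e1 e2 -[X in _ * X]exch_q.
by rewrite mulKf.
Qed.

Definition t0_rows : seq (seq int) :=
  [:: [:: 0; -1; 1; 0; 0; 0]; [:: 1; 0; -1; -1; 1; 0]; [:: -1; 1; 0; 0; -1; 1]].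

Lemma t0_represents : represents (t0 R) [:: 0; 4; 1; 9; 10; 11]%N t0_rows.
Proof.
split=> // -[[|[|[|[|[|[|//]]]]]] ?] /=.
- exact: (@generic_flagvar R 0).
- exact: (@generic_flagvar R 4).
- exact: (@generic_flagvar R 1).
- exact: (@generic_flagvar R 9).
- exact: (@generic_flagvar R 10).
- exact: (@generic_flagvar R 11).
Qed.

End Mutations.

(** * The seeds and their certificates *)

Section Seeds.

Variable R : realType.

Local Ltac exchange_tac :=
  rewrite /exchanged /monomial_at !big_ord_recl !big_ord0 /= /flag_at /=; ring.

Definition t1_rows : seq (seq int) :=
  [:: [:: 0; 1; 0; - 1; 0; 0]; [:: - 1; 0; 1; 1; - 1; 0]; [:: 0; - 1; 0; 0; 0; 1]].

Definition t2_rows : seq (seq int) :=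
  [:: [:: 0; 1; 0; - 1; 0; 0]; [:: - 1; 0; - 1; 1; - 1; 1]; [:: 0; 1; 0; 0; 0; - 1]].

Definition t3_rows : seq (seq int) :=
  [:: [:: 0; - 1; 0; 1; 0; 0]; [:: 1; 0; - 1; 0; - 1; 1]; [:: 0; 1; 0; 0; 0; - 1]].

Definition t4_rows : seq (seq int) :=
  [:: [:: 0; - 1; 0; 1; 0; 0]; [:: 1; 0; 1; 0; - 1; 0]; [:: 0; - 1; 0; 0; 0; 1]].

Definition t7_rows : seq (seq int) :=
  [:: [:: 0; 0; - 1; 0; 0; 1]; [:: 0; 0; 1; - 1; 0; 0]; [:: 1; - 1; 0; 0; 1; - 1]].

Definition t5_rows : seq (seq int) :=
  [:: [:: 0; 0; 1; 0; 0; - 1]; [:: 0; 0; 1; - 1; 0; 0]; [:: - 1; - 1; 0; 0; 1; 0]].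

Definition t8_rows : seq (seq int) :=
  [:: [:: 0; 1; - 1; 0; 0; 0]; [:: - 1; 0; 0; - 1; 1; 0]; [:: 1; 0; 0; 0; - 1; 1]].

Definition t6_rows : seq (seq int) :=
  [:: [:: 0; 1; 1; 0; - 1; 0]; [:: - 1; 0; 0; - 1; 1; 0]; [:: - 1; 0; 0; 0; 1; - 1]].

Lemma t1_exchange (S : comNzRingType) (x : 'I_6 -> S) :
  exchanged x [:: 0; 4; 1; 9; 10; 11]%N [:: 1; 0; - 1; - 1; 1; 0] 4 8.
Proof. by exchange_tac. Qed.

Lemma t1_represents : represents (t1 R) [:: 0; 8; 1; 9; 10; 11]%N t1_rows.
Proof.
have -> : t1_rows = mutate_rows 1 t0_rows by vm_compute.
exact: (@mutate_represents R 1 _ [:: 0; 4; 1; 9; 10; 11]%N t0_rows 8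
  isT erefl isT isT erefl (t1_exchange _) (t0_represents R)).
Qed.

Lemma t2_exchange (S : comNzRingType) (x : 'I_6 -> S) :
  exchanged x [:: 0; 8; 1; 9; 10; 11]%N [:: 0; - 1; 0; 0; 0; 1] 1 6.
Proof. by exchange_tac. Qed.

Lemma t2_represents : represents (t2 R) [:: 0; 8; 6; 9; 10; 11]%N t2_rows.
Proof.
have -> : t2_rows = mutate_rows 2 t1_rows by vm_compute.
exact: (@mutate_represents R 2 _ [:: 0; 8; 1; 9; 10; 11]%N t1_rows 6
  isT erefl isT isT erefl (t2_exchange _) t1_represents).
Qed.

Lemma t3_exchange (S : comNzRingType) (x : 'I_6 -> S) :
  exchanged x [:: 0; 8; 6; 9; 10; 11]%N [:: 0; 1; 0; - 1; 0; 0] 0 7.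
Proof. by exchange_tac. Qed.

Lemma t3_represents : represents (t3 R) [:: 7; 8; 6; 9; 10; 11]%N t3_rows.
Proof.
have -> : t3_rows = mutate_rows 0 t2_rows by vm_compute.
exact: (@mutate_represents R 0 _ [:: 0; 8; 6; 9; 10; 11]%N t2_rows 7
  isT erefl isT isT erefl (t3_exchange _) t2_represents).
Qed.

Lemma t4_exchange (S : comNzRingType) (x : 'I_6 -> S) :
  exchanged x [:: 0; 8; 1; 9; 10; 11]%N [:: 0; 1; 0; - 1; 0; 0] 0 7.
Proof. by exchange_tac. Qed.

Lemma t4_represents : represents (t4 R) [:: 7; 8; 1; 9; 10; 11]%N t4_rows.
Proof.
have -> : t4_rows = mutate_rows 0 t1_rows by vm_compute.
exact: (@mutate_represents R 0 _ [:: 0; 8; 1; 9; 10; 11]%N t1_rows 7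
  isT erefl isT isT erefl (t4_exchange _) t1_represents).
Qed.

Lemma t7_exchange (S : comNzRingType) (x : 'I_6 -> S) :
  exchanged x [:: 0; 4; 1; 9; 10; 11]%N [:: - 1; 1; 0; 0; - 1; 1] 1 5.
Proof. by exchange_tac. Qed.

Lemma t7_represents : represents (t7 R) [:: 0; 4; 5; 9; 10; 11]%N t7_rows.
Proof.
have -> : t7_rows = mutate_rows 2 t0_rows by vm_compute.
exact: (@mutate_represents R 2 _ [:: 0; 4; 1; 9; 10; 11]%N t0_rows 5
  isT erefl isT isT erefl (t7_exchange _) (t0_represents R)).
Qed.

Lemma t5_exchange (S : comNzRingType) (x : 'I_6 -> S) :
  exchanged x [:: 0; 4; 5; 9; 10; 11]%N [:: 0; 0; - 1; 0; 0; 1] 0 3.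
Proof. by exchange_tac. Qed.

Lemma t5_represents : represents (t5 R) [:: 3; 4; 5; 9; 10; 11]%N t5_rows.
Proof.
have -> : t5_rows = mutate_rows 0 t7_rows by vm_compute.
exact: (@mutate_represents R 0 _ [:: 0; 4; 5; 9; 10; 11]%N t7_rows 3
  isT erefl isT isT erefl (t5_exchange _) t7_represents).
Qed.

Lemma t8_exchange (S : comNzRingType) (x : 'I_6 -> S) :
  exchanged x [:: 0; 4; 1; 9; 10; 11]%N [:: 0; - 1; 1; 0; 0; 0] 0 2.
Proof. by exchange_tac. Qed.

Lemma t8_represents : represents (t8 R) [:: 2; 4; 1; 9; 10; 11]%N t8_rows.
Proof.
have -> : t8_rows = mutate_rows 0 t0_rows by vm_compute.
exact: (@mutate_represents R 0 _ [:: 0; 4; 1; 9; 10; 11]%N t0_rows 2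
  isT erefl isT isT erefl (t8_exchange _) (t0_represents R)).
Qed.

Lemma t6_exchange (S : comNzRingType) (x : 'I_6 -> S) :
  exchanged x [:: 2; 4; 1; 9; 10; 11]%N [:: 1; 0; 0; 0; - 1; 1] 1 3.
Proof. by exchange_tac. Qed.

Lemma t6_represents : represents (t6 R) [:: 2; 4; 3; 9; 10; 11]%N t6_rows.
Proof.
have -> : t6_rows = mutate_rows 2 t8_rows by vm_compute.
exact: (@mutate_represents R 2 _ [:: 2; 4; 1; 9; 10; 11]%N t8_rows 3
  isT erefl isT isT erefl (t6_exchange _) t8_represents).
Qed.

End Seeds.

(** * Numerical certificates for the six seeds *)

Section Certificates.

(** Each of the six lists has one step for every mutable variable outside the cluster of the
    seed. *)
Definition t1_steps : seq value_step := [::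
  (2%N, true, true, [:: 1; 0; 0]);
  (8%N, false, false, [:: 0; 1; 0]);
  (11%N, false, false, [:: 0; 0; 1]);
  (14%N, true, true, [:: 0; 1; 0]);
  (4%N, true, true, [:: 0; 0; 1]);
  (3%N, true, true, [:: 0; 0; 1])].

Definition t1_cover : fan_cover :=
FanSplit [:: 0; 0; 1; 0; 0; 0; 0]
 (FanSplit [:: 0; 0; 1; 1; 0; 0; 0]
 (FanSplit [:: 0; 0; 0; 1; 0; 0; 0]
 (FanSplit [:: 0; 1; 0; 0; 0; 0; 0]
 (FanLeaf 0 [::]) (FanLeaf 3 [::])) (FanSplit [:: 0; 1; 0; 0; 0; 0; 0]
 (FanLeaf 1 [::]) (FanLeaf 2 [::]))) (FanSplit [:: 0; - 1; - 1; - 1; 0; 0; 0]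
 (FanSplit [:: 0; 1; 0; 0; 0; 0; 0]
 (FanLeaf 12 [::]) (FanLeaf 9 [::])) (FanLeaf 7 [::]))) (FanSplit [:: 0; 0; 0; 1; 0; 0; 0]
 (FanSplit [:: 0; 1; 0; 0; 0; 0; 0]
 (FanSplit [:: 0; 1; 1; 0; 0; 0; 0]
 (FanLeaf 6 [::]) (FanLeaf 13 [::])) (FanLeaf 8 [::])) (FanSplit [:: 0; 1; 1; 0; 0; 0; 0]
 (FanSplit [:: 0; - 1; - 1; - 1; 0; 0; 0]
 (FanLeaf 4 [::]) (FanLeaf 10 [::])) (FanSplit [:: 0; 1; 0; 0; 0; 0; 0]
 (FanLeaf 5 [::]) (FanLeaf 11 [::])))).

(** A common denominator and the numerators of a point in the relative interior of each facet,
    before translation. *)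
Definition t1_witnesses : seq (nat * seq int) := [::
  (1%N, [:: - 1; 0; 0; 1; 1; 1]);
  (3%N, [:: 2; - 2; 2; 4; 2; 2]);
  (1%N, [:: 0; 0; - 1; 1; 1; 1]);
  (3%N, [:: 2; 2; - 2; 0; 2; 2]);
  (3%N, [:: 0; 2; 0; 2; 0; 2]);
  (1%N, [:: 1; 0; 0; 1; 1; 0]);
  (1%N, [:: 1; 0; 0; 1; 1; 1]);
  (2%N, [:: - 1; 1; 1; 2; 2; 2]);
  (1%N, [:: 0; 1; - 1; 1; 1; 1]);
  (3%N, [:: 0; - 2; 2; 4; 4; 4]);
  (3%N, [:: 0; - 2; 2; 6; 4; 2]);
  (1%N, [:: 0; - 1; 0; 1; 2; 1]);
  (3%N, [:: 0; 0; - 2; 4; 4; 6])].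

Definition t2_steps : seq value_step := [::
  (2%N, true, true, [:: 1; 0; 0]);
  (10%N, false, false, [:: 0; 1; 0]);
  (11%N, true, true, [:: 0; 0; 1]);
  (6%N, false, false, [:: 0; 1; 0]);
  (7%N, false, false, [:: 0; 1; 1]);
  (5%N, false, false, [:: 0; 1; 1])].

Definition t2_cover : fan_cover :=
FanSplit [:: 0; 0; 0; - 1; 0; 0; 0]
 (FanSplit [:: 0; 0; 1; 0; 0; 0; 0]
 (FanSplit [:: 0; 1; 0; 0; 0; 0; 0]
 (FanLeaf 0 [::]) (FanLeaf 3 [::])) (FanSplit [:: 0; - 1; - 1; 0; 0; 0; 0]
 (FanSplit [:: 0; 1; 0; 0; 0; 0; 0]
 (FanLeaf 13 [::]) (FanLeaf 8 [::])) (FanLeaf 6 [::]))) (FanSplit [:: 0; 0; - 1; - 1; 0; 0; 0]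
 (FanSplit [:: 0; 1; 1; 1; 0; 0; 0]
 (FanSplit [:: 0; - 1; - 1; 0; 0; 0; 0]
 (FanLeaf 4 [::]) (FanLeaf 10 [::])) (FanSplit [:: 0; 1; 0; 0; 0; 0; 0]
 (FanLeaf 5 [::]) (FanLeaf 11 [::]))) (FanSplit [:: 0; 0; 1; 0; 0; 0; 0]
 (FanSplit [:: 0; 1; 0; 0; 0; 0; 0]
 (FanLeaf 1 [::]) (FanLeaf 2 [::])) (FanSplit [:: 0; - 1; - 1; 0; 0; 0; 0]
 (FanSplit [:: 0; 1; 0; 0; 0; 0; 0]
 (FanLeaf 12 [::]) (FanLeaf 9 [::])) (FanLeaf 7 [::])))).

Definition t2_witnesses : seq (nat * seq int) := [::
  (1%N, [:: - 1; 0; 0; 1; 1; 1]);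
  (1%N, [:: 1; - 1; 1; 1; 1; 1]);
  (3%N, [:: 0; 2; - 2; 2; 4; 2]);
  (3%N, [:: 2; 0; 0; 0; 2; 2]);
  (3%N, [:: 0; 2; 0; 2; 0; 2]);
  (3%N, [:: 4; - 2; 2; 4; 4; 0]);
  (1%N, [:: 1; 0; 0; 1; 1; 1]);
  (1%N, [:: 0; 0; 1; 1; 1; 1]);
  (2%N, [:: - 1; 1; 0; 2; 2; 3]);
  (2%N, [:: - 2; 1; - 1; 3; 2; 2]);
  (3%N, [:: 0; - 2; - 2; 6; 4; 4]);
  (1%N, [:: 0; - 1; 0; 1; 2; 1]);
  (3%N, [:: 0; - 2; 0; 2; 4; 6])].

Definition t3_steps : seq value_step := [::
  (2%N, false, false, [:: 1; 0; 0]);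
  (6%N, false, false, [:: 0; 1; 0]);
  (11%N, true, true, [:: 0; 0; 1]);
  (10%N, false, false, [:: 1; 1; 0]);
  (5%N, false, false, [:: 0; 1; 1]);
  (7%N, false, false, [:: 1; 1; 1])].

Definition t3_cover : fan_cover :=
FanSplit [:: 0; 0; 1; 0; 0; 0; 0]
 (FanSplit [:: 0; 0; 0; - 1; 0; 0; 0]
 (FanSplit [:: 0; - 1; 0; 0; 0; 0; 0]
 (FanSplit [:: 0; 1; 1; 0; 0; 0; 0]
 (FanLeaf 0 [::]) (FanLeaf 6 [::])) (FanLeaf 3 [::])) (FanSplit [:: 0; 1; 1; 0; 0; 0; 0]
 (FanSplit [:: 0; - 1; 0; 0; 0; 0; 0]
 (FanLeaf 1 [::]) (FanLeaf 2 [::])) (FanSplit [:: 0; - 1; - 1; - 1; 0; 0; 0]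
 (FanLeaf 10 [::]) (FanLeaf 7 [::])))) (FanSplit [:: 0; - 1; 0; 0; 0; 0; 0]
 (FanSplit [:: 0; 0; 1; 1; 0; 0; 0]
 (FanSplit [:: 0; - 1; - 1; - 1; 0; 0; 0]
 (FanLeaf 4 [::]) (FanLeaf 12 [::])) (FanSplit [:: 0; 0; 0; - 1; 0; 0; 0]
 (FanLeaf 13 [::]) (FanLeaf 5 [::]))) (FanSplit [:: 0; 0; 0; - 1; 0; 0; 0]
 (FanLeaf 8 [::]) (FanSplit [:: 0; 0; 1; 1; 0; 0; 0]
 (FanLeaf 9 [::]) (FanLeaf 11 [::])))).

Definition t3_witnesses : seq (nat * seq int) := [::
  (1%N, [:: - 1; 0; 1; 1; 1; 1]);
  (3%N, [:: 2; - 4; 2; 2; 4; 2]);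
  (1%N, [:: 0; 0; - 1; 1; 1; 1]);
  (1%N, [:: 0; 0; 0; 0; 1; 1]);
  (3%N, [:: 0; 2; 0; 2; 0; 2]);
  (3%N, [:: - 2; 0; 2; 4; 4; 0]);
  (3%N, [:: 4; - 2; 0; 2; 4; 4]);
  (2%N, [:: 1; 1; - 1; 2; 3; 2]);
  (1%N, [:: 0; 0; 1; 1; 1; 1]);
  (1%N, [:: - 1; 1; 0; 1; 1; 1]);
  (3%N, [:: - 2; 0; 0; 6; 4; 4]);
  (1%N, [:: 0; - 1; 0; 1; 2; 1]);
  (3%N, [:: 0; - 2; - 2; 2; 4; 6])].

Definition t4_steps : seq value_step := [::
  (2%N, false, false, [:: 1; 0; 0]);
  (14%N, true, true, [:: 0; 1; 0]);
  (11%N, false, false, [:: 0; 0; 1]);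
  (8%N, false, false, [:: 1; 1; 0]);
  (3%N, true, true, [:: 0; 0; 1]);
  (4%N, true, true, [:: 0; 0; 1])].

Definition t4_cover : fan_cover :=
FanSplit [:: 0; - 1; 0; 0; 0; 0; 0]
 (FanSplit [:: 0; 1; 1; 0; 0; 0; 0]
 (FanSplit [:: 0; 1; 1; 1; 0; 0; 0]
 (FanSplit [:: 0; 0; 0; 1; 0; 0; 0]
 (FanLeaf 0 [::]) (FanLeaf 1 [::])) (FanSplit [:: 0; 0; 1; 1; 0; 0; 0]
 (FanLeaf 7 [::]) (FanLeaf 12 [::]))) (FanSplit [:: 0; 0; 0; 1; 0; 0; 0]
 (FanSplit [:: 0; 0; 1; 0; 0; 0; 0]
 (FanLeaf 6 [::]) (FanLeaf 13 [::])) (FanSplit [:: 0; 0; 1; 0; 0; 0; 0]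
 (FanSplit [:: 0; 0; 1; 1; 0; 0; 0]
 (FanLeaf 10 [::]) (FanLeaf 4 [::])) (FanLeaf 5 [::])))) (FanSplit [:: 0; 0; 0; 1; 0; 0; 0]
 (FanSplit [:: 0; 0; 1; 0; 0; 0; 0]
 (FanLeaf 3 [::]) (FanLeaf 8 [::])) (FanSplit [:: 0; 0; 1; 0; 0; 0; 0]
 (FanSplit [:: 0; 0; 1; 1; 0; 0; 0]
 (FanLeaf 2 [::]) (FanLeaf 9 [::])) (FanLeaf 11 [::]))).

Definition t4_witnesses : seq (nat * seq int) := [::
  (1%N, [:: - 1; 1; - 1; 1; 1; 1]);
  (3%N, [:: - 2; 0; 2; 2; 2; 2]);
  (3%N, [:: 2; 0; - 2; 2; 2; 2]);
  (3%N, [:: 2; - 4; 2; 2; 4; 2]);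
  (1%N, [:: 0; 0; 0; 0; 1; 1]);
  (3%N, [:: 0; 2; 0; 2; 0; 2]);
  (1%N, [:: 0; 0; 0; 1; 1; 0]);
  (3%N, [:: 2; - 2; 0; 4; 4; 2]);
  (1%N, [:: 0; 1; - 1; 1; 1; 1]);
  (1%N, [:: - 1; 1; 0; 1; 1; 1]);
  (3%N, [:: 0; - 2; 2; 4; 4; 4]);
  (3%N, [:: - 2; 0; 0; 6; 4; 2]);
  (1%N, [:: 0; - 1; 0; 1; 2; 1]);
  (3%N, [:: 0; 0; - 2; 2; 4; 6])].

Definition t5_steps : seq value_step := [::
  (1%N, false, false, [:: 1; 0; 0]);
  (7%N, true, true, [:: 0; 1; 0]);
  (9%N, true, true, [:: 0; 0; 1]);
  (4%N, false, false, [:: 0; 0; 1]);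
  (13%N, false, false, [:: 0; 0; 1]);
  (10%N, true, true, [:: 0; 0; 1])].

Definition t5_cover : fan_cover :=
FanSplit [:: 0; - 1; 0; 0; 0; 0; 0]
 (FanSplit [:: 0; 0; 0; - 1; 0; 0; 0]
 (FanSplit [:: 0; 0; - 1; - 1; 0; 0; 0]
 (FanSplit [:: 0; 0; 1; 0; 0; 0; 0]
 (FanLeaf 0 [::]) (FanLeaf 1 [::])) (FanLeaf 6 [::])) (FanSplit [:: 0; 0; 1; 0; 0; 0; 0]
 (FanLeaf 10 [::]) (FanLeaf 7 [::]))) (FanSplit [:: 0; - 1; 0; - 1; 0; 0; 0]
 (FanSplit [:: 0; - 1; - 1; - 1; 0; 0; 0]
 (FanSplit [:: 0; 0; 1; 0; 0; 0; 0]
 (FanLeaf 3 [::]) (FanLeaf 2 [::])) (FanSplit [:: 0; 0; - 1; - 1; 0; 0; 0]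
 (FanLeaf 8 [::]) (FanLeaf 13 [::]))) (FanSplit [:: 0; 0; 0; - 1; 0; 0; 0]
 (FanSplit [:: 0; 0; - 1; - 1; 0; 0; 0]
 (FanSplit [:: 0; 0; 1; 0; 0; 0; 0]
 (FanLeaf 11 [::]) (FanLeaf 9 [::])) (FanLeaf 5 [::])) (FanSplit [:: 0; 0; 1; 0; 0; 0; 0]
 (FanLeaf 4 [::]) (FanLeaf 12 [::])))).

Definition t5_witnesses : seq (nat * seq int) := [::
  (3%N, [:: - 4; 0; 2; 4; 2; 4]);
  (1%N, [:: 0; 1; - 1; 1; 1; 1]);
  (1%N, [:: 1; 0; - 1; 1; 1; 1]);
  (3%N, [:: - 2; - 4; 2; 4; 2; 4]);
  (3%N, [:: 0; 2; 0; 0; 2; 2]);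
  (1%N, [:: 1; 0; 0; 1; 0; 1]);
  (3%N, [:: 2; 0; 0; 4; 2; 0]);
  (1%N, [:: 1; 1; - 1; 1; 1; 1]);
  (3%N, [:: 2; - 2; 2; 4; 2; 2]);
  (3%N, [:: - 2; 4; 0; 4; 2; 4]);
  (3%N, [:: - 2; - 2; 4; 4; 2; 4]);
  (1%N, [:: 0; - 1; 0; 2; 1; 1]);
  (3%N, [:: 0; 0; - 2; 4; 6; 4]);
  (1%N, [:: 0; 0; 0; 1; 1; 2])].

Definition t6_steps : seq value_step := [::
  (9%N, false, false, [:: 1; 0; 0]);
  (12%N, false, false, [:: 0; 1; 0]);
  (3%N, false, false, [:: 0; 0; 1]);
  (7%N, true, true, [:: 0; 1; 0]);
  (1%N, false, false, [:: 0; 0; 1]);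
  (6%N, true, true, [:: 0; 0; 1])].

Definition t6_cover : fan_cover :=
FanSplit [:: 0; 0; - 1; 0; 0; 0; 0]
 (FanSplit [:: 0; 1; 1; 0; 0; 0; 0]
 (FanSplit [:: 0; - 1; - 1; - 1; 0; 0; 0]
 (FanSplit [:: 0; - 1; 0; - 1; 0; 0; 0]
 (FanLeaf 0 [::]) (FanLeaf 3 [::])) (FanSplit [:: 0; 0; 0; - 1; 0; 0; 0]
 (FanLeaf 8 [::]) (FanLeaf 11 [::]))) (FanSplit [:: 0; 0; 0; - 1; 0; 0; 0]
 (FanSplit [:: 0; - 1; 0; - 1; 0; 0; 0]
 (FanSplit [:: 0; 1; 0; 0; 0; 0; 0]
 (FanLeaf 1 [::]) (FanLeaf 7 [::])) (FanLeaf 2 [::])) (FanSplit [:: 0; 1; 0; 0; 0; 0; 0]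
 (FanLeaf 9 [::]) (FanLeaf 12 [::])))) (FanSplit [:: 0; 0; 0; - 1; 0; 0; 0]
 (FanSplit [:: 0; - 1; 0; - 1; 0; 0; 0]
 (FanSplit [:: 0; 1; 0; 0; 0; 0; 0]
 (FanLeaf 6 [::]) (FanLeaf 10 [::])) (FanLeaf 13 [::])) (FanSplit [:: 0; 1; 0; 0; 0; 0; 0]
 (FanLeaf 5 [::]) (FanLeaf 4 [::]))).

Definition t6_witnesses : seq (nat * seq int) := [::
  (1%N, [:: - 1; 0; 0; 1; 1; 1]);
  (1%N, [:: 1; - 1; 0; 1; 1; 1]);
  (1%N, [:: 1; 0; - 1; 1; 1; 1]);
  (3%N, [:: 0; 2; - 2; 0; 2; 4]);
  (1%N, [:: 1; 0; 0; 1; 0; 1]);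
  (3%N, [:: 0; 0; 2; 4; 2; 0]);
  (1%N, [:: 1; 0; 0; 1; 1; 1]);
  (3%N, [:: 0; 2; - 2; 4; 4; 4]);
  (2%N, [:: - 1; 1; 1; 2; 2; 2]);
  (3%N, [:: - 2; - 2; 2; 4; 4; 4]);
  (1%N, [:: 0; - 1; 0; 2; 1; 1]);
  (3%N, [:: - 2; - 2; - 2; 4; 6; 4]);
  (1%N, [:: 0; 0; - 1; 1; 1; 2])].

End Certificates.

Theorem mainTheorem3 (R : realType) :
  (forall le, adapted_order (exch (t1 R)) le -> described_by (Delta (t1 R) le) N1) /\
  (forall le, adapted_order (exch (t2 R)) le -> described_by (Delta (t2 R) le) N2) /\
  (forall le, adapted_order (exch (t3 R)) le -> described_by (Delta (t3 R) le) N3) /\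
  (forall le, adapted_order (exch (t4 R)) le -> described_by (Delta (t4 R) le) N4) /\
  (forall le, adapted_order (exch (t5 R)) le -> described_by (Delta (t5 R) le) N5) /\
  (forall le, adapted_order (exch (t6 R)) le -> described_by (Delta (t6 R) le) N6).
Proof.
have main (s : seed R) le c ee steps cov wit n rows : (c < 6)%N -> represents s (chart c) ee ->
    checks (chart c) ee steps cov wit n rows -> adapted_order (exch s) le ->
    described_by (Delta s le) (mx_of_rows 6 n rows).
  move=> c6 s_rep ok le_ad.
  apply: (described (b := c) (ex := expansion) _ _ _ s_rep _ le_ad ok).
  - by move=> K x c' p c'10 x0 pP; apply: (expandsP x0 c'10 pP).
  - exact: expansion_ok.
  - exact: ltn_trans c6 _.
  - by move=> y y0; apply: (chart_solvable c6 y0).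
split; [|split; [|split; [|split; [|split]]]] => le.
- by apply: (main (t1 R) le 0%N t1_rows t1_steps t1_cover t1_witnesses _ _ isT
    (t1_represents R)); vm_compute.
- by apply: (main (t2 R) le 1%N t2_rows t2_steps t2_cover t2_witnesses _ _ isT
    (t2_represents R)); vm_compute.
- by apply: (main (t3 R) le 2%N t3_rows t3_steps t3_cover t3_witnesses _ _ isT
    (t3_represents R)); vm_compute.
- by apply: (main (t4 R) le 3%N t4_rows t4_steps t4_cover t4_witnesses _ _ isT
    (t4_represents R)); vm_compute.
- by apply: (main (t5 R) le 4%N t5_rows t5_steps t5_cover t5_witnesses _ _ isT
    (t5_represents R)); vm_compute.
- by apply: (main (t6 R) le 5%N t6_rows t6_steps t6_cover t6_witnesses _ _ isT
    (t6_represents R)); vm_compute.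
Qed.
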